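(* Let $d=2$, and let $X^{(n)}$ be the number of descendants of vertex $n$ in the random $2$-dag $D_n$. Then, as $n\to\infty$, $$\frac{X^{(n)}}{\sqrt n}\ \overset{\mathrm d}{\longrightarrow}\ \frac{\pi}{2\sqrt2}\,\chi_4,$$ with convergence of all moments. Hence, for every fixed $r>0$, $$\mathbb E\bigl(X^{(n)}\bigr)^r\sim\Bigl(\frac{\pi}{2}\Bigr)^r\,\Gamma\Bigl(\frac r2+2\Bigr)\,n^{r/2},$$ and, in particular, $$\mathbb E X^{(n)}\sim\frac{3\pi^{3/2}}{8}\sqrt n .$$
   Context: The random $2$-dag $D_n$ is the random directed acyclic multigraph on the vertex set $\{1,\dots,n\}$ in which vertex $1$ is a root (outdegree $0$) and each vertex $k=2,\dots,n$ has exactly $2$ outgoing edges, whose endpoints are chosen uniformly at random from $\{1,\dots,k-1\}$, all choices being independent (multiple edges are allowed). $\widehat D_n$ is the subdigraph of $D_n$ consisting of all vertices and edges that can be reached by a directed path from vertex $n$ (including vertex $n$ itself), and $X^{(n)}:=|\widehat D_n|$ is its number of vertices (the number of descendants of $n$). $\chi_4$ denotes a random variable with the $\chi(4)$ distribution, i.e. the distribution of $|\eta|$ where $\eta$ is a standard normal random vector in $\mathbb R^4$; its density is $\frac12x^3e^{-x^2/2}$, $x>0$. In the moment formula $\Gamma$ is the Gamma function. *)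

(* Defs.v *)
From HB Require Import structures.
From mathcomp Require Import all_boot all_order all_algebra finmap.
From mathcomp Require Import all_classical all_reals all_analysis.

Set Implicit Arguments.
Unset Strict Implicit.
Unset Printing Implicit Defensive.

Import Order.TTheory GRing.Theory Num.Theory.
Import numFieldNormedType.Exports.

Local Open Scope classical_set_scope.
Local Open Scope ring_scope.

(* [X i], [i \in D], are mutually independent under [P]: the product rule holds
   for every finite subfamily. *)
Definition mutually_independent (dT dT' : measure_display)
    (T : measurableType dT) (T' : measurableType dT') (R : realType)
    (P : probability T R) (I : choiceType) (D : set I)
    (X : I -> {RV P >-> T'}) : Prop :=
  forall J : {fset I}, [set` J] `<=` D ->
  forall A : I -> set T', (forall i, measurable (A i)) ->
  P (\bigcap_(i in [set` J]) (X i @^-1` A i)) =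
  (\prod_(i <- J) P (X i @^-1` A i))%E.

(* Random [d]-dag on the vertices 1, ..., n: [out k i] is the endpoint of the
   [i]-th edge leaving vertex [k].  The values [out k i] with [k <= 1] or
   [n < k] do not encode edges and are left unconstrained. *)
Definition random_dag (d n : nat) (dT : measure_display)
    (T : measurableType dT) (R : realType) (P : probability T R)
    (out : nat -> 'I_d -> {RV P >-> nat}) : Prop :=
  (forall (k : nat) (i : 'I_d) (j : nat), (1 < k <= n)%N -> (0 < j < k)%N ->
     P [set w | out k i w = j] = ((k.-1)%:R^-1)%:E) /\
  mutually_independent [set e : nat * 'I_d | (1 < e.1 <= n)%N]
    (fun e => out e.1 e.2).

Definition arc (d : nat) (out : nat -> 'I_d -> nat) : rel nat :=
  fun k j => (1 < k)%N && [exists i, out k i == j].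

Definition reachable (d : nat) (out : nat -> 'I_d -> nat) (k j : nat) : Prop :=
  exists p : seq nat, path (arc out) k p /\ last k p = j.

(* [k] counts as one of its own descendants (empty path). *)
Definition num_descendants (d : nat) (out : nat -> 'I_d -> nat) (n : nat) : nat :=
  count (fun j => `[< reachable out n j >]) (iota 1 n).

Definition descendants (d n : nat) (dT : measure_display)
    (T : measurableType dT) (R : realType) (P : probability T R)
    (out : nat -> 'I_d -> {RV P >-> nat}) (w : T) : R :=
  (num_descendants (fun k i => out k i w) n)%:R.

Definition cvg_in_distribution (dT : nat -> measure_display)
    (T : forall n, measurableType (dT n)) (R : realType)
    (P : forall n, probability (T n) R) (X : forall n, T n -> R)
    (dS : measure_display) (S : measurableType dS) (Q : probability S R)
    (Y : S -> R) : Prop :=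
  [/\ forall n, measurable_fun [set: T n] (X n),
      measurable_fun [set: S] Y &
      forall f : R -> R, continuous f ->
        (exists M : R, forall x, `|f x| <= M) ->
        ('E_(P n)[fun w => f (X n w)] @[n --> \oo] -->
         'E_Q[fun w => f (Y w)])%E].

(* Law of a standard normal random vector in R^4. *)
Definition std_normal4 (R : realType) : set (R * R * R * R) -> \bar R :=
  (normal_prob (0 : R) 1 \x normal_prob (0 : R) 1 \x
   normal_prob (0 : R) 1 \x normal_prob (0 : R) 1)%E.

Definition euclidean_norm4 (R : realType) (x : R * R * R * R) : R :=
  let: (x1, x2, x3, x4) := x in
  Num.sqrt (x1 ^+ 2 + x2 ^+ 2 + x3 ^+ 2 + x4 ^+ 2).

Definition has_chi4_distribution (R : realType) (dS : measure_display)
    (S : measurableType dS) (Q : probability S R) (Y : {RV Q >-> R}) : Prop :=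
  forall A : set R, measurable A ->
    distribution Q Y A = @std_normal4 R (@euclidean_norm4 R @^-1` A).

(* Euler's Gamma function, for s > 0. *)
Definition Gamma (R : realType) (s : R) : R :=
  \int[lebesgue_measure]_(t in `]0, +oo[) (t `^ (s - 1) * expR (- t)).

(* Main.v *)
Require Import Defs.
From HB Require Import structures.
From mathcomp Require Import all_boot all_order all_algebra finmap.
From mathcomp Require Import all_classical all_reals all_analysis.
From mathcomp Require Import measurable_realfun gauss_integral.
From mathcomp Require Import zify ring lra.

(** Reveal the vertices in the order n, n - 1, ..., 1, keeping only the number Y
    of pointers that the descendants found so far send to the vertices that are
    still hidden. Given that number, the pointers are independent and uniform on
    the hidden vertices 1, ..., k, so the number Z of them that hit k is binomial
    with parameters Y and 1 / k; vertex k is a descendant iff Z > 0, and then it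
    sends two new pointers to 1, ..., k - 1. Hence the number of descendants of
    m + 1 is 1 plus the number of visits (times with Z > 0) of the Markov chain
    Y -> Y - Z + 2 [Z > 0] started at Y = 2, k = m
    ([num_descendants_found], [found_mean_hist_mean],
    [expectation_descendants]).

    For this chain, polynomials in the quantities (1 + j / k)^Y, with rising
    factorials as coefficients, are exact martingales ([mart_step]), with an
    explicit initial value ([mart_start]). The simplest one is
    M = k^2 ((1 + 1 / k)^Y - 1), and the others show that the c-th moment of M is
    (c + 1)! n^c up to a relative error O(1 / k) as long as k is of order sqrt n
    ([quad_mart_hist_moment]): M / n is close to a Gamma variable of parameter 2.
    The conditional probability 1 - (1 - 1 / k)^Y of visiting k is about
    M / (k^2 + M). As M is almost constant while k runs over the scale sqrt n, the
    number of visits is about the sum over k of M / (k^2 + M), a Riemann sum of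
    an arctangent, that is (pi / 2) sqrt M ([main_approx]). Since chi_4^2 / 2 also
    has the Gamma distribution of parameter 2, this is the announced limit.

    Convergence of expectations is first obtained for x -> cos (t x), which only
    needs finitely many even moments ([cos_of_moments]), then for all continuous
    functions of polynomial growth, by approximating them by polynomials in a
    cosine on a long interval and using bounds on even moments for the rest
    ([cvg_poly_growth], [visits_moment_bound]). The moment bounds come from the
    supermartingale exp (visits - (e - 1) compensator) ([hist_mean_expR]).
    Laws are handled as positive linear functionals; two of them with the even
    moments kappa^(2 q) (q + 1)! agree ([mean_unique]), so that the law of
    pi / (2 sqrt 2) chi_4 may be computed from the normal vector, from the density
    x^3 exp (- x^2 / 2) / 2, or from the density t exp (- t): the last two give the
    values of its moments without any change of variables. *)

Set Implicit Arguments.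
Unset Strict Implicit.
Unset Printing Implicit Defensive.

Import Order.TTheory GRing.Theory Num.Theory.
Import numFieldNormedType.Exports.

Local Open Scope ring_scope.

(** * The pointer chain and its exact martingales *)

Section BinomialMean.
Variable R : realFieldType.
Implicit Types (p s t : R) (h g : nat -> R) (y z : nat).

(** The mean of [h] under the binomial distribution of parameters [y] and [p],
    by conditioning on the first trial: linearity, monotonicity and the
    generating function then follow by induction on [y]. *)
Fixpoint binom_mean y p h : R :=
  if y is y'.+1 then p * binom_mean y' p (fun z => h z.+1) + (1 - p) * binom_mean y' p h
  else h 0%N.

Lemma eq_binom_mean y p h g :
  (forall z, (z <= y)%N -> h z = g z) -> binom_mean y p h = binom_mean y p g.
Proof.
elim: y h g => [|y IH] h g hg /=; first exact: hg.
congr (_ * _ + _ * _); apply: IH => z zy; apply: hg => //.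
by rewrite (leq_trans zy).
Qed.

Lemma binom_mean_le y p h g : 0 <= p <= 1 ->
  (forall z, (z <= y)%N -> h z <= g z) -> binom_mean y p h <= binom_mean y p g.
Proof.
move=> /andP[p0 p1].
elim: y h g => [|y IH] h g hg /=; first exact: hg.
apply: lerD; apply: ler_wpM2l; rewrite ?subr_ge0//; apply: IH => z zy;
  apply: hg => //.
by rewrite (leq_trans zy).
Qed.

Lemma binom_mean_lin y p a h g :
  binom_mean y p (fun z => a * h z + g z) = a * binom_mean y p h + binom_mean y p g.
Proof. by elim: y h g => [|y IH] h g //=; rewrite !IH; ring. Qed.

Lemma binom_mean_cst y p a : binom_mean y p (fun=> a) = a.
Proof. by elim: y => [|y IH] //=; rewrite IH; ring. Qed.

Lemma binom_meanZ y p a h : binom_mean y p (fun z => a * h z) = a * binom_mean y p h.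
Proof.
rewrite -[RHS]addr0 -(binom_mean_cst y p 0) -binom_mean_lin.
by apply: eq_binom_mean => z _; rewrite addr0.
Qed.

Lemma binom_meanD y p h g :
  binom_mean y p (fun z => h z + g z) = binom_mean y p h + binom_mean y p g.
Proof.
rewrite -[binom_mean y p h]mul1r -binom_mean_lin.
by apply: eq_binom_mean => z _; rewrite mul1r.
Qed.

Lemma binom_mean_sum y p n (h : nat -> nat -> R) :
  binom_mean y p (fun z => \sum_(j < n) h j z) = \sum_(j < n) binom_mean y p (h j).
Proof.
elim: n => [|n IH].
  rewrite big_ord0 -[RHS](binom_mean_cst y p).
  by apply: eq_binom_mean => z _; rewrite big_ord0.
rewrite big_ord_recr/= -IH -binom_meanD.
by apply: eq_binom_mean => z _; rewrite big_ord_recr.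
Qed.

Lemma binom_mean_pow y p s :
  binom_mean y p (fun z => s ^+ (y - z)) = (p + (1 - p) * s) ^+ y.
Proof.
elim: y => [|y IH] //=.
rewrite (@eq_binom_mean y p (fun z => s ^+ (y.+1 - z)) (fun z => s * s ^+ (y - z))).
  rewrite binom_meanZ (@eq_binom_mean y p (fun z => s ^+ (y.+1 - z.+1)) (fun z => s ^+ (y - z))).
    by rewrite IH exprS; ring.
  by move=> z _; rewrite subSS.
by move=> z zy; rewrite subSn// exprS.
Qed.

Lemma binom_mean_eq0 y p : binom_mean y p (fun z => (z == 0%N)%:R) = (1 - p) ^+ y.
Proof.
elim: y => [|y IH] //=; rewrite IH (@eq_binom_mean y p _ (fun=> 0))//.
by rewrite binom_mean_cst exprS; ring.
Qed.

Lemma binom_mean_sqr y p a :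
  binom_mean y p (fun z => (z%:R + a) ^+ 2) = y%:R * p * (1 - p) + (y%:R * p + a) ^+ 2.
Proof.
elim: y a => [|y IH] a /=; first by ring.
rewrite (@eq_binom_mean y p _ (fun z => (z%:R + (1 + a)) ^+ 2)); last first.
  by move=> z _; rewrite -natr1 addrA.
by rewrite !IH -natr1; ring.
Qed.

End BinomialMean.

Section Rise.
Variable R : realFieldType.
Implicit Types (x : R).

Definition rise x c : R := \prod_(i < c) (x + i%:R).

Lemma rise0 x : rise x 0 = 1. Proof. by rewrite /rise big_ord0. Qed.
Lemma riseS x c : rise x c.+1 = rise x c * (x + c%:R).
Proof. by rewrite /rise big_ord_recr. Qed.
Lemma riseSl x c : rise x c.+1 = x * rise (x + 1) c.
Proof.
rewrite /rise big_ord_recl addr0; congr (_ * _); apply: eq_bigr => i _.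
rewrite /= /bump leq0n natrD addrA. done.
Qed.

(** Vandermonde's identity for rising factorials, by Pascal's rule. *)
Lemma rise_binomial x z c :
  \sum_(j < c.+1) 'C(c, j)%:R * rise x (c - j) * rise z j = rise (x + z) c.
Proof.
elim: c x z => [|c IH] x z.
  by rewrite big_ord_recl big_ord0 bin0 !rise0; ring.
rewrite riseSl.
transitivity (x * \sum_(j < c.+1) 'C(c, j)%:R * rise (x + 1) (c - j) * rise z j
   + z * \sum_(j < c.+1) 'C(c, j)%:R * rise x (c - j) * rise (z + 1) j); last first.
  by rewrite !IH mulrDl; congr (_ * rise _ c + _ * rise _ c); ring.
rewrite big_ord_recl.
under eq_bigr => j _ do rewrite /= /bump /= add1n binS natrD !mulrDl subSS.
rewrite big_split /= addrA; congr (_ + _).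
- rewrite [in LHS]big_ord_recr /= (bin_small (ltnSn c)) !mul0r addr0.
  rewrite mulr_sumr [in RHS]big_ord_recl; congr (_ + _).
    by rewrite !bin0 !subn0 riseSl; ring.
  apply: eq_bigr => j _; rewrite /= /bump leq0n add1n.
  have -> : (c - j = (c - j.+1).+1)%N by rewrite -subSn.
  by rewrite riseSl; ring.
- by rewrite mulr_sumr; apply: eq_bigr => j _; rewrite riseSl; ring.
Qed.

Lemma rise_one c : rise 1 c = c`!%:R :> R.
Proof.
elim: c => [|c IH]; first by rewrite rise0.
by rewrite riseS IH factS mulnC natrM nat1r.
Qed.

Lemma rise_ge0 x c : 0 <= x -> 0 <= rise x c.
Proof. by move=> x0; apply: prodr_ge0 => i _; rewrite addr_ge0. Qed.

Lemma rise_gt0 x c : 0 < x -> 0 < rise x c.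
Proof. by move=> x0; apply: prodr_gt0 => i _; rewrite ltr_pwDl. Qed.

End Rise.

Section Step.
Variable R : realFieldType.

(** The [z] pointers that hit the revealed vertex are used up; if there is at
    least one, that vertex is a descendant and sends two new pointers. *)
Definition next (y z : nat) : nat := (y - z + if z is 0 then 0 else 2)%N.

Definition phi (c k y : nat) : R := (1 + c%:R / k%:R) ^+ y.

(** Without the two new pointers the generating function of the binomial law
    would map [phi c k] to a multiple of itself; they contribute a factor [(1 +
    c / k) ^+ 2] except on the event [z = 0], whose probability turns [phi c]
    into [phi c.-1]. As the factor [1 - (1 + 0 / k) ^+ 2] vanishes, the
    truncated predecessor is harmless at [c = 0]. *)
Lemma phi_step c k y : (0 < k)%N ->
  binom_mean y k.+1%:R^-1 (fun z => phi c k (next y z)) =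
  (1 + c%:R / k%:R) ^+ 2 * phi c k.+1 y
  + (1 - (1 + c%:R / k%:R) ^+ 2) * phi c.-1 k.+1 y.
Proof.
move=> k0; rewrite /phi; set A := 1 + c%:R / k%:R.
have k1 : k%:R != 0 :> R by rewrite pnatr_eq0 -lt0n.
have k2 : k%:R + 1 != 0 :> R by rewrite natr1 pnatr_eq0.
transitivity (binom_mean y k.+1%:R^-1 (fun z => A ^+ 2 * A ^+ (y - z) +
   ((1 - A ^+ 2) * A ^+ y) * (z == 0%N)%:R)).
  apply: eq_binom_mean => -[|z] zy; rewrite /next /=.
    by rewrite addn0 subn0; ring.
  by rewrite mulr0 addr0 exprD mulrC.
rewrite binom_mean_lin binom_mean_pow binom_meanZ binom_mean_eq0; congr (_ * _ ^+ _ + _).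
  by rewrite /A -natr1; field; rewrite k1 k2.
rewrite -mulrA -exprMn /A.
case: c {A} => [|c]; first by rewrite mul0r addr0 expr1n subrr !mul0r.
congr (_ * _ ^+ _).
by rewrite /= -![_.+1%:R]natr1; field; rewrite k1 k2.
Qed.

(** The combination of [phi 0], ..., [phi c] that is triangular with respect to
    [phi_step] and invariant under it; to leading order it is [(k ^+ 2 * (phi 1
    k y - 1)) ^+ c]. *)
Definition mart c k y : R := rise k%:R c *
  \sum_(j < c.+1) 'C(c, j)%:R * rise (- k%:R) (c - j) * rise k%:R j * phi j k y.

(** Collect the coefficient of each [phi j]: it receives the diagonal term of
    index [j] and the off-diagonal term of index [j.+1]. *)
Lemma mart_step c k y : (0 < k)%N ->
  binom_mean y k.+1%:R^-1 (fun z => mart c k (next y z)) = mart c k.+1 y.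
Proof.
move=> k0; rewrite /mart binom_meanZ.
pose w (k j : nat) : R := 'C(c, j)%:R * rise (- k%:R) (c - j) * rise k%:R j.
rewrite (binom_mean_sum _ _ _ (fun j z => w k j * phi j k (next y z))).
under eq_bigr => j _ do rewrite binom_meanZ phi_step//.
have kn0 : k%:R != 0 :> R by rewrite pnatr_eq0 -lt0n.
pose A j : R := (1 + j%:R / k%:R) ^+ 2.
under eq_bigr => j _ do rewrite mulrDr.
rewrite big_split/= [X in _ + X]big_ord_recl.
have -> : w k ord0 * ((1 - (1 + (@ord0 c)%:R / k%:R) ^+ 2) * phi (@ord0 c).-1 k.+1 y) = 0.
  by rewrite /= mul0r addr0 expr1n subrr mul0r mulr0.
rewrite add0r big_ord_recr/= -addrA addrC -addrA -big_split/= addrC mulrDr.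
rewrite [in RHS]big_ord_recr/= [in RHS]mulrDr.
have shift j : rise k%:R j * (k%:R + j%:R) = k%:R * rise (k.+1)%:R j :> R.
  by rewrite -riseS riseSl natr1.
have kc : (k%:R + c%:R) / k%:R * rise k%:R c = rise k.+1%:R c :> R.
  by rewrite mulrAC [X in X / _]mulrC shift mulrC mulKf.
congr (_ + _).
  rewrite !mulr_sumr; apply: eq_bigr => j _; rewrite /bump leq0n add1n /= /w.
  have [i ci] : exists i, (c = (i + j).+1)%N by exists (c - j.+1)%N; have := ltn_ord j; lia.
  have -> : (c - j)%N = i.+1 by lia.
  have -> : (c - j.+1)%N = i by lia.
  have binj : 'C(c, j.+1)%:R * j.+1%:R = 'C(c, j)%:R * i.+1%:R :> R.
    rewrite -!natrM; congr _%:R.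
    have := mul_bin_left c j; rewrite mulnC => ->.
    by rewrite mulnC; congr (_ * _)%N; lia.
  rewrite [rise (- k.+1%:R) _]riseSl [rise (- k%:R) i.+1]riseS.
  have -> : - k.+1%:R + 1 = - k%:R :> R by rewrite -natr1; ring.
  rewrite -kc (_ : rise k%:R j.+1 = k%:R * rise k.+1%:R j); last by rewrite riseS shift.
  have -> : rise k.+1%:R j = rise k%:R j * (k%:R + j%:R) / k%:R :> R.
    by rewrite shift mulrC mulKf.
  have -> : 'C(c, j.+1)%:R = 'C(c, j)%:R * i.+1%:R / j.+1%:R :> R.
    by rewrite -binj mulfK// pnatr_eq0.
  have -> : k%:R + c%:R = k%:R + (i%:R + j%:R + 1) :> R.
    by congr (_ + _); rewrite [in LHS]ci -natr1 natrD.
  have j1 : j%:R + 1 != 0 :> R by rewrite natr1 pnatr_eq0.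
  rewrite add0n -![_.+1%:R]natr1.
  by field; rewrite j1 kn0.
have b1 : 'C(c, c)%:R = 1 :> R by rewrite binn.
rewrite /w subnn b1 !rise0 /=.
have -> : rise k.+1%:R c = rise k%:R c * (k%:R + c%:R) / k%:R :> R.
  by rewrite shift mulrC mulKf.
by field; rewrite kn0.
Qed.

(** At [y = 2] the factor [rise k j * (1 + j / k) ^+ 2] is a combination of
    [rise (k + 2) j] and [rise (k + 1) j], so that Vandermonde's identity
    evaluates the sum. *)
Lemma mart_start c k : (0 < k)%N ->
  mart c k 2 = rise k%:R c / k%:R * (c`!%:R * (k.+1%:R * c.+1%:R - 1)).
Proof.
move=> k0; rewrite /mart -mulrA; congr (_ * _).
have kn0 : k%:R != 0 :> R by rewrite pnatr_eq0 -lt0n.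
have E (x : R) j : x * rise (x + 1) j = rise x j * (x + j%:R).
  by rewrite -riseS riseSl.
transitivity ((k%:R + 1) / k%:R * \sum_(j < c.+1) 'C(c, j)%:R * rise (- k%:R) (c - j) * rise (k%:R + 1 + 1) j
   - k%:R^-1 * \sum_(j < c.+1) 'C(c, j)%:R * rise (- k%:R) (c - j) * rise (k%:R + 1) j : R).
  rewrite !mulr_sumr -sumrB; apply: eq_bigr => j _.
  have k1 : k%:R + 1 != 0 :> R by rewrite natr1 pnatr_eq0.
  have -> : rise (k%:R + 1 + 1) j = rise k%:R j * (k%:R + j%:R) / k%:R * (k%:R + 1 + j%:R) / (k%:R + 1) :> R.
    by rewrite -E [k%:R * _]mulrC mulfK// -E mulrC mulKf.
  have -> : rise (k%:R + 1) j = rise k%:R j * (k%:R + j%:R) / k%:R :> R.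
    by rewrite -E mulrC mulKf.
  by rewrite /phi; field; rewrite kn0 k1.
rewrite !rise_binomial.
have -> : - k%:R + (k%:R + 1 + 1) = 1 + 1 :> R by ring.
have -> : - k%:R + (k%:R + 1) = 1 :> R by ring.
have -> : rise (1 + 1) c = c`!%:R * c.+1%:R :> R.
  by rewrite -[LHS]mul1r E rise_one nat1r.
by rewrite rise_one -![_.+1%:R]natr1; field.
Qed.
End Step.

(** * Leading-order behaviour of the martingales *)

Section NearMonomial.
Variable R : realFieldType.
Implicit Types (f g : nat -> R) (a b : R) (d e : nat).

(** The asymptotics [f k = a * k ^+ d * (1 + O(1 / k))], with the error
    multiplied by [k] to avoid negative exponents. *)
Definition near_mono f a d := exists2 C : R, 0 <= C &
  forall k, (0 < k)%N -> `|f k - a * k%:R ^+ d| * k%:R <= C * k%:R ^+ d.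

Lemma near_monoM f g a b d e :
  near_mono f a d -> near_mono g b e ->
  near_mono (fun k => f k * g k) (a * b) (d + e).
Proof.
move=> [C C0 hf] [D D0 hg]; exists (C * (`|b| + D) + `|a| * D).
  by rewrite addr_ge0 ?mulr_ge0 ?addr_ge0.
move=> k k0; have k1 : 1 <= k%:R :> R by rewrite ler1n.
have {}hf := hf k k0; have {}hg := hg k k0.
set x := k%:R in hf hg k1 *.
have x0 : 0 <= x by lra.
have xd : 0 <= x ^+ d by rewrite exprn_ge0.
have xe : 0 <= x ^+ e by rewrite exprn_ge0.
have gb : `|g k| <= (`|b| + D) * x ^+ e.
  have -> : g k = b * x ^+ e + (g k - b * x ^+ e) by ring.
  rewrite mulrDl; apply: le_trans (ler_normD _ _) _.
  apply: lerD; first by rewrite normrM (ger0_norm xe).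
  by apply: le_trans hg; rewrite ler_peMr.
have -> : f k * g k - a * b * x ^+ (d + e) =
  (f k - a * x ^+ d) * g k + a * x ^+ d * (g k - b * x ^+ e).
  by rewrite exprD; ring.
apply: le_trans (ler_wpM2r x0 (ler_normD _ _)) _.
rewrite mulrDl exprD [X in _ <= X]mulrDl; apply: lerD.
  rewrite normrM mulrAC -mulrA [X in _ <= X](_ : _ = C * x ^+ d * ((`|b| + D) * x ^+ e)); last by ring.
  by rewrite mulrA; apply: ler_pM => //; rewrite mulr_ge0.
rewrite normrM normrM (ger0_norm xd) -mulrA.
rewrite [X in _ <= X](_ : _ = `|a| * x ^+ d * (D * x ^+ e)); last by ring.
by rewrite ler_wpM2l// mulr_ge0.
Qed.

Lemma near_mono_const a : near_mono (fun=> a) a 0.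
Proof.
by exists 0 => // k _; rewrite expr0 mulr1 subrr normr0 !mul0r.
Qed.

Lemma near_mono_shift a : near_mono (fun k => k%:R + a) 1 1.
Proof.
exists `|a| => // k _; rewrite expr1 mul1r.
by rewrite (_ : _ + a - _ = a) //; ring.
Qed.

Lemma near_mono_ext f g a d : (forall k, f k = g k) -> near_mono f a d ->
  near_mono g a d.
Proof. by move=> fg [C C0 h]; exists C => // k k0; rewrite -fg; apply: h. Qed.

Lemma near_mono_rise c : near_mono (fun k => rise k%:R c) 1 c.
Proof.
elim: c => [|c IH].
  by apply: near_mono_ext (near_mono_const 1) => k; rewrite rise0.
have := near_monoM IH (near_mono_shift c%:R); rewrite mulr1 addn1.
by apply: near_mono_ext => k; rewrite riseS.
Qed.

Lemma near_mono_riseN c : near_mono (fun k => rise (- k%:R) c) ((-1) ^+ c) c.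
Proof.
elim: c => [|c IH].
  by apply: near_mono_ext (near_mono_const 1) => k; rewrite rise0.
have := near_monoM (near_monoM (near_mono_const (-1)) IH)
           (near_mono_shift (- c%:R)).
rewrite mulr1 -exprS add0n addn1.
by apply: near_mono_ext => k; rewrite riseS; ring.
Qed.

Lemma near_monoX f a d c : near_mono f a d ->
  near_mono (fun k => f k ^+ c) (a ^+ c) (d * c).
Proof.
move=> h; elim: c => [|c IH].
  by rewrite muln0; apply: near_mono_ext (near_mono_const 1) => k; rewrite expr0.
rewrite mulnS exprS; apply: near_mono_ext (near_monoM h IH) => k.
by rewrite exprS.
Qed.

Lemma near_mono_inv a c : near_mono (fun k => a + c / k%:R) a 0.
Proof.
exists `|c| => // k k0; rewrite expr0 !mulr1 addrC addKr.
by rewrite normrM normfV normr_nat mulfVK// pnatr_eq0 -lt0n.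
Qed.

(** Two sequences with the same leading term differ by one order less. *)
Lemma near_monoB f g a d : near_mono f a d -> near_mono g a d ->
  exists2 C : R, 0 <= C &
  forall k, (0 < k)%N -> `|f k - g k| * k%:R <= C * k%:R ^+ d.
Proof.
move=> [C C0 hf] [D D0 hg]; exists (C + D); first by rewrite addr_ge0.
move=> k k0; rewrite mulrDl.
apply: le_trans (lerD (hf k k0) (hg k k0)).
rewrite -mulrDl ler_wpM2r//.
by rewrite [X in _ <= _ + X]distrC; apply: ler_distD.
Qed.

End NearMonomial.

Section PhiBounds.
Variable R : realFieldType.
Notation phi := (@phi R).
Notation mart := (@mart R).

Lemma phi_ge1 c k y : 1 <= phi c k y.
Proof. by rewrite /phi exprn_ege1// lerDl divr_ge0. Qed.

Lemma phi_ge0 c k y : 0 <= phi c k y.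
Proof. exact: le_trans ler01 (phi_ge1 _ _ _). Qed.

Lemma phi0 k y : phi 0 k y = 1.
Proof. by rewrite /phi mul0r addr0 expr1n. Qed.

Lemma le_phi c c' k y : (c <= c')%N -> phi c k y <= phi c' k y.
Proof.
move=> cc; rewrite /phi lerXn2r// ?nnegrE ?addr_ge0 ?divr_ge0//.
by rewrite lerD2l ler_wpM2r ?invr_ge0// ler_nat.
Qed.

Lemma rise_le_pow c k : (0 < k)%N -> rise k%:R c <= c`!%:R * k%:R ^+ c :> R.
Proof.
move=> k0; elim: c => [|c IH]; first by rewrite rise0 fact0 mul1r.
rewrite riseS factS natrM exprSr.
rewrite [X in _ <= X](_ : _ = c`!%:R * k%:R ^+ c * (c.+1%:R * k%:R)); last by ring.
apply: ler_pM; rewrite ?rise_ge0 ?addr_ge0 //.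
by rewrite -natrM -natrD ler_nat; nia.
Qed.

Lemma rise_ge_pow c k : k%:R ^+ c <= rise k%:R c :> R.
Proof.
elim: c => [|c IH]; first by rewrite rise0.
by rewrite riseS exprSr ler_pM// ?exprn_ge0// lerDl.
Qed.

Lemma riseN_le c k : `|rise (- k%:R) c| <= rise k%:R c :> R.
Proof.
elim: c => [|c IH]; first by rewrite !rise0 normr1.
rewrite !riseS normrM ler_pM//.
by apply: le_trans (ler_normD _ _) _; rewrite normrN !normr_nat.
Qed.

(** The top term of [mart p] is [rise k p ^+ 2 * phi p]; the lower ones are
    bounded by [phi j] with [j < p]. This allows an induction on [p] for the
    means of [phi p]. *)
Lemma phi_le_mart p k y : (0 < k)%N ->
  phi p k y <= mart p k y / rise k%:R p ^+ 2 + p`!%:R * \sum_(j < p) phi j k y.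
Proof.
move=> k0; have kp : 0 < k%:R :> R by rewrite ltr0n.
have rp := rise_gt0 p kp.
have k2p : 0 < k%:R ^+ (2 * p) :> R by rewrite exprn_gt0.
set S := \sum_(j < p) 'C(p, j)%:R * rise (- k%:R) (p - j) * rise k%:R j * phi j k y.
have mE : mart p k y = rise k%:R p * S + rise k%:R p ^+ 2 * phi p k y.
  by rewrite /mart big_ord_recr /= subnn rise0 binn -/S; ring.
have Sle : `|S| <= k%:R ^+ p * (p`!%:R * \sum_(j < p) phi j k y).
  apply: le_trans (ler_norm_sum _ _ _) _; rewrite !mulr_sumr.
  apply: ler_sum => j _; rewrite normrM (ger0_norm (phi_ge0 _ _ _)) mulrA.
  apply: ler_wpM2r; first exact: phi_ge0.
  rewrite !normrM normr_nat (ger0_norm (rise_ge0 _ (ltW kp))).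
  apply: (@le_trans _ _ ('C(p, j)%:R * ((p - j)`!%:R * k%:R ^+ (p - j)) * (j`!%:R * k%:R ^+ j))).
    apply: ler_pM; rewrite ?mulr_ge0 ?rise_ge0 ?normr_ge0 ?(ltW kp)//; last exact: rise_le_pow.
    apply: ler_wpM2l => //; apply: le_trans (riseN_le _ _) _; exact: rise_le_pow.
  have jp : (j <= p)%N by rewrite ltnW.
  have -> : k%:R ^+ p = k%:R ^+ (p - j) * k%:R ^+ j :> R by rewrite -exprD subnK.
  rewrite -(bin_fact jp) !natrM.
  by rewrite le_eqVlt; apply/orP; left; apply/eqP; ring.
have r2 : 0 < rise k%:R p ^+ 2 :> R by rewrite exprn_gt0.
rewrite -(ler_pM2l r2) mulrDr [_ ^+ 2 * (_ / _)]mulrC divfK ?gt_eqF// mE.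
rewrite addrAC lerDr -lerBlDl sub0r expr2 -mulrA -mulrN ler_pM2l//.
apply: (@le_trans _ _ (k%:R ^+ p * (p`!%:R * \sum_(j < p) phi j k y))).
  by apply: le_trans Sle; rewrite -normrN ler_norm.
rewrite ler_wpM2r ?rise_ge_pow// mulr_ge0// sumr_ge0// => j _.
exact: phi_ge0.
Qed.

Lemma mart_start_near c :
  exists2 C : R, 0 <= C & forall m, (0 < m)%N ->
    `|mart c m 2 - (c.+1)`!%:R * m.+1%:R ^+ c| * m%:R <= C * m%:R ^+ c.
Proof.
have h1 : near_mono (fun m => mart c m 2) (c.+1)`!%:R c.
  have [C C0 h] := near_monoM (near_monoM (near_mono_const c`!%:R) (near_mono_rise R c))
                 (near_mono_inv c.+1%:R c%:R).
  exists C => // k k0; have := h k k0; rewrite addn0 add0n mulr1.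
  rewrite factS mulnC natrM mart_start//.
  have kn0 : k%:R != 0 :> R by rewrite pnatr_eq0 -lt0n.
  suff -> : rise k%:R c / k%:R * (c`!%:R * (k.+1%:R * c.+1%:R - 1)) =
      c`!%:R * rise k%:R c * (c.+1%:R + c%:R / k%:R) :> R by [].
  by rewrite -![_.+1%:R]natr1; field.
have h2 : near_mono (fun m => (c.+1)`!%:R * m.+1%:R ^+ c : R) (c.+1)`!%:R c.
  have := near_monoM (near_mono_const (c.+1)`!%:R) (near_monoX c (near_mono_shift (1 : R))).
  rewrite expr1n mulr1 add0n mul1n.
  by apply: near_mono_ext => k; rewrite natr1.
exact: near_monoB h1 h2.
Qed.

End PhiBounds.

(** * Powers of the quadratic martingale *)

Section Compare.
Variable R : archiRealFieldType.
Notation phi := (@phi R).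
Notation mart := (@mart R).
Implicit Types (a u v : R).

Lemma bernoulli_ge a y : 0 <= a -> 1 + y%:R * a <= (1 + a) ^+ y.
Proof.
move=> a0; elim: y => [|y IH]; first by rewrite mul0r addr0.
rewrite exprS; apply: (@le_trans _ _ ((1 + a) * (1 + y%:R * a))).
  rewrite -natr1; have : 0 <= y%:R * a * a by rewrite !mulr_ge0.
  by lra.
by rewrite ler_wpM2l// addr_ge0.
Qed.

Lemma pow_le_quadratic j :
  exists2 C : R, 0 <= C & forall a, 0 <= a <= 1 ->
    (1 + a) ^+ j <= 1 + j%:R * a + C * a ^+ 2.
Proof.
elim: j => [|j [C C0 IH]]; first by exists 0 => // a _; rewrite mul0r mul0r !addr0.
exists (j%:R + 2 * C); first by rewrite addr_ge0 ?mulr_ge0.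
move=> a a01; have := IH a a01; move: a01 => /andP[a0 a1] IHa.
rewrite exprSr; apply: (@le_trans _ _ ((1 + j%:R * a + C * a ^+ 2) * (1 + a))).
  by rewrite ler_wpM2r// addr_ge0.
rewrite -natr1; have : C * a ^+ 2 * a <= C * a ^+ 2 * 1.
  by rewrite ler_wpM2l// mulr_ge0// sqr_ge0.
by lra.
Qed.

(** Mean value inequality for powers, with the larger base. *)
Lemma pow_diff_le u v y : 1 <= v -> v <= u ->
  u ^+ y - v ^+ y <= y%:R * (u - v) * u ^+ y.
Proof.
move=> v1 vu; have u1 : 1 <= u by exact: le_trans vu.
elim: y => [|y IH]; first by rewrite subrr mul0r mul0r.
have -> : u ^+ y.+1 - v ^+ y.+1 = u * (u ^+ y - v ^+ y) + (u - v) * v ^+ y.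
  by rewrite !exprS; ring.
apply: (@le_trans _ _ (u * (y%:R * (u - v) * u ^+ y) + (u - v) * u ^+ y.+1)).
  apply: lerD; first by rewrite ler_wpM2l//; lra.
  rewrite ler_wpM2l ?subr_ge0//; apply: (@le_trans _ _ (u ^+ y)).
    by rewrite lerXn2r ?nnegrE//; lra.
  by rewrite exprS ler_peMl// exprn_ge0//; lra.
by rewrite -natr1 exprS le_eqVlt; apply/orP; left; apply/eqP; ring.
Qed.

(** Since [(1 + a) ^+ j = 1 + j * a + O(a ^+ 2)] at [a = 1 / k], the two
    exponentials differ by a factor [1 + O(y / k ^+ 2)]; the factor [y / k] is
    absorbed by raising the index of [phi], and two more units of index absorb
    the errors. *)
Lemma phi1_pow_sub j :
  exists2 C : R, 0 <= C & exists k1, forall k y, (k1 <= k)%N ->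
    0 <= phi 1 k y ^+ j - phi j k y /\
    (phi 1 k y ^+ j - phi j k y) * k%:R <= C * phi (j + 3) k y.
Proof.
have [C C0 hC] := pow_le_quadratic j.
exists C => //; exists (maxn (Num.truncn C).+1 j.+1) => k y.
rewrite geq_max => /andP[kC kj].
have k0 : (0 < k)%N by exact: leq_trans kj.
have kp : 0 < k%:R :> R by rewrite ltr0n.
have kR : 1 <= k%:R :> R by rewrite ler1n.
set a : R := k%:R^-1.
have a0 : 0 < a by rewrite invr_gt0.
have a1 : a <= 1 by rewrite invf_le1.
have Ca : C * a <= 1.
  rewrite ler_pdivrMr// mul1r; apply/ltW/(lt_le_trans (truncnS_gt _)).
  by rewrite ler_nat.
have ja : (j%:R + 1) * a <= 1.
  by rewrite ler_pdivrMr// mul1r natr1 ler_nat.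
have phiE c : phi c k y = (1 + c%:R * a) ^+ y by [].
have -> : phi 1 k y ^+ j = ((1 + a) ^+ j) ^+ y.
  by rewrite phiE mul1r -!exprM mulnC.
rewrite !phiE; set u := (1 + a) ^+ j; set v := 1 + j%:R * a.
have uv : v <= u by rewrite bernoulli_ge// ltW.
have v1 : 1 <= v by rewrite lerDl mulr_ge0// ltW.
have u1 : 1 <= u by exact: le_trans uv.
have uvC : u - v <= C * a ^+ 2.
  by rewrite lerBlDl; apply: hC; rewrite (ltW a0) a1.
split; first by rewrite subr_ge0 lerXn2r// nnegrE; lra.
apply: (@le_trans _ _ (y%:R * (u - v) * u ^+ y * k%:R)).
  by rewrite ler_wpM2r ?(ltW kp)//; apply: pow_diff_le.
have ya : y%:R * a <= (1 + a) ^+ y.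
  by apply: le_trans (bernoulli_ge y (ltW a0)); rewrite lerDr.
apply: (@le_trans _ _ (C * ((y%:R * a) * u ^+ y))).
  have -> : C * (y%:R * a * u ^+ y) = y%:R * (C * a ^+ 2) * u ^+ y * k%:R.
    by rewrite /a; field; rewrite gt_eqF.
  by rewrite ler_wpM2r ?ler_wpM2r ?ler_wpM2l// ?exprn_ge0//; lra.
rewrite ler_wpM2l//.
apply: (@le_trans _ _ ((1 + a) ^+ y * u ^+ y)).
  by rewrite ler_wpM2r// exprn_ge0//; lra.
rewrite -exprMn lerXn2r ?nnegrE//.
- by rewrite mulr_ge0//; lra.
- by rewrite addr_ge0// mulr_ge0// ltW.
have uj : u <= 1 + (j%:R + 1) * a.
  have : C * a ^+ 2 <= a by rewrite expr2 mulrA ler_piMl// ltW.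
  by move: uvC; rewrite /v; lra.
apply: (@le_trans _ _ ((1 + a) * (1 + (j%:R + 1) * a))).
  by rewrite ler_wpM2l//; lra.
rewrite natrD; have : a * ((j%:R + 1) * a) <= a * 1 by rewrite ler_wpM2l// ltW.
by lra.
Qed.

(** For [y] of order at most [k] this is of order [k * y]; divided by the number
    of vertices, it converges to a Gamma variable of parameter 2. *)
Definition quad_mart k y : R := k%:R ^+ 2 * (phi 1 k y - 1).

Lemma quad_mart_ge0 k y : 0 <= quad_mart k y.
Proof. by rewrite mulr_ge0 ?sqr_ge0// subr_ge0 phi_ge1. Qed.

Definition ev_dominated (F G : nat -> nat -> R) := exists2 C : R, 0 <= C &
  exists k1, forall k y, (k1 <= k)%N -> F k y <= C * G k y.

Lemma ev_dominated_sum n (F : nat -> nat -> nat -> R) G :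
  (forall k y, 0 <= G k y) ->
  (forall j, (j < n)%N -> ev_dominated (F j) G) ->
  ev_dominated (fun k y => \sum_(j < n) F j k y) G.
Proof.
move=> G0; elim: n => [|n IH] h.
  by exists 0 => //; exists 0%N => k y _; rewrite big_ord0 mul0r.
have [C C0 [k1 h1]] := IH (fun j jn => h j (ltnW jn)).
have [D D0 [k2 h2]] := h n (ltnSn n).
exists (C + D); first exact: addr_ge0.
exists (maxn k1 k2) => k y; rewrite geq_max => /andP[kk1 kk2].
by rewrite big_ord_recr /= mulrDl lerD ?h1 ?h2.
Qed.

(** Expand the power by the binomial formula: each coefficient agrees with that
    of [mart c] to leading order, and each [phi 1 ^+ j] is close to [phi j]. *)
Lemma quad_mart_mart c :
  ev_dominated (fun k y => `|quad_mart k y ^+ c - mart c k y| * k%:R)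
        (fun k y => k%:R ^+ (2 * c) * phi (c + 3) k y).
Proof.
pose s (j : nat) : R := (-1) ^+ (c - j) * 'C(c, j)%:R.
pose w j (k : nat) : R := rise k%:R c * ('C(c, j)%:R * rise (- k%:R) (c - j) * rise k%:R j).
pose F j k y := `|w j k - s j * k%:R ^+ (2 * c)| * k%:R * phi j k y +
   k%:R ^+ (2 * c) * `|s j| * (`|phi 1 k y ^+ j - phi j k y| * k%:R).
have G0 k y : 0 <= k%:R ^+ (2 * c) * phi (c + 3) k y by rewrite mulr_ge0 ?phi_ge0 ?exprn_ge0.
have [C C0 [k1 h]] : ev_dominated (fun k y => \sum_(j < c.+1) F j k y)
    (fun k y => k%:R ^+ (2 * c) * phi (c + 3) k y).
  apply: ev_dominated_sum => // j; rewrite ltnS => jc.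
  have [C C0 hw] : near_mono (w j) (s j) (2 * c).
    have := near_monoM (near_mono_rise R c) (near_monoM (near_monoM (near_mono_const 'C(c, j)%:R) (near_mono_riseN R (c - j))) (near_mono_rise R j)).
    rewrite mul1r mulr1 add0n subnK// addnn -mul2n (mulrC 'C(c, j)%:R).
    by [].
  have [D D0 [k1 hD]] := phi1_pow_sub j.
  exists (C + `|s j| * D); first by rewrite addr_ge0// mulr_ge0.
  exists (maxn k1 1) => k y; rewrite geq_max => /andP[kk1 k0].
  have [d0 hd] := hD k y kk1.
  have kc : 0 <= k%:R ^+ (2 * c) :> R by rewrite exprn_ge0.
  rewrite /F mulrDl; apply: lerD.
    rewrite mulrA; apply: ler_pM; rewrite ?phi_ge0 ?mulr_ge0//; first exact: hw.
    by rewrite le_phi// (leq_trans jc)// leq_addr.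
  rewrite (ger0_norm d0) [X in _ <= X](_ : _ = k%:R ^+ (2 * c) * `|s j| * (D * phi (c + 3) k y)); last by ring.
  rewrite ler_wpM2l ?mulr_ge0//; apply: le_trans hd _.
  by rewrite ler_wpM2l// le_phi// leq_add2r.
exists C => //; exists k1 => k y kk1; apply: le_trans (h k y kk1).
rewrite (eq_bigr (fun j : 'I_c.+1 => (`|w j k - s j * k%:R ^+ (2 * c)| * phi j k y +
   k%:R ^+ (2 * c) * `|s j| * `|phi 1 k y ^+ j - phi j k y|) * k%:R)); last first.
  by move=> j _; rewrite /F; ring.
rewrite -mulr_suml ler_wpM2r//.
have -> : quad_mart k y ^+ c = \sum_(j < c.+1) s j * k%:R ^+ (2 * c) * phi 1 k y ^+ j.
  rewrite /quad_mart exprMn -exprM addrC exprDn mulr_sumr.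
  by apply: eq_bigr => j _; rewrite /s -mulr_natr; ring.
have -> : mart c k y = \sum_(j < c.+1) w j k * phi j k y.
  by rewrite /mart mulr_sumr; apply: eq_bigr => j _; rewrite /w; ring.
rewrite -sumrB; apply: le_trans (ler_norm_sum _ _ _) _; apply: ler_sum => j _.
have -> : s j * k%:R ^+ (2 * c) * phi 1 k y ^+ j - w j k * phi j k y =
  - ((w j k - s j * k%:R ^+ (2 * c)) * phi j k y) +
  k%:R ^+ (2 * c) * s j * (phi 1 k y ^+ j - phi j k y) by ring.
apply: le_trans (ler_normD _ _) _; rewrite normrN !normrM.
by rewrite (ger0_norm (phi_ge0 _ _ _ _)) (@ger0_norm _ (k%:R ^+ (2 * c))) ?exprn_ge0.
Qed.
End Compare.

(** * Expectations over histories of the chain *)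

(** A history is the list of the numbers of hits, latest first; the chain starts
    with the two pointers of the top vertex. *)
Fixpoint ptrs (s : seq nat) : nat :=
  if s is z :: s' then next (ptrs s') z else 2.

Section Hexp.
Variable R : archiRealFieldType.
Variable m : nat.
Implicit Types (F G : seq nat -> R) (i j : nat) (s : seq nat).

(** The expectation over histories of length [i] of the chain started at [k =
    m]: after [i'] steps the hidden vertices are [1], ..., [m - i']. *)
Fixpoint hist_mean i F : R :=
  if i is i'.+1 then
    hist_mean i' (fun s => binom_mean (ptrs s) (m - i')%:R^-1 (fun z => F (z :: s)))
  else F [::].

Lemma eq_hist_mean i F G : (forall s, size s = i -> F s = G s) -> hist_mean i F = hist_mean i G.
Proof.
elim: i F G => [|i IH] F G h /=; first exact: h.
by apply: IH => s si; apply: eq_binom_mean => z _; apply: h; rewrite /= si.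
Qed.

Lemma hist_mean_le i F G : (i <= m)%N ->
  (forall s, size s = i -> F s <= G s) -> hist_mean i F <= hist_mean i G.
Proof.
elim: i F G => [|i IH] F G im h /=; first exact: h.
apply: IH => [|s si]; first exact: ltnW.
apply: binom_mean_le => [|z _]; last by apply: h; rewrite /= si.
have mi : (0 < m - i)%N by rewrite subn_gt0.
by rewrite invr_ge0 ler0n invf_le1 ?ltr0n// ler1n.
Qed.

Lemma hist_mean_lin i a F G :
  hist_mean i (fun s => a * F s + G s) = a * hist_mean i F + hist_mean i G.
Proof.
elim: i F G => [|i IH] F G //=; rewrite -IH; apply: eq_hist_mean => s _.
by rewrite binom_mean_lin.
Qed.

Lemma hist_mean_cst i a : hist_mean i (fun=> a) = a.
Proof.
elim: i => [|i IH] //=; rewrite -[RHS]IH; apply: eq_hist_mean => s _.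
by rewrite binom_mean_cst.
Qed.

Lemma hist_meanZ i a F : hist_mean i (fun s => a * F s) = a * hist_mean i F.
Proof.
rewrite -[RHS]addr0 -(hist_mean_cst i 0) -hist_mean_lin.
by apply: eq_hist_mean => s _; rewrite addr0.
Qed.

Lemma hist_meanD i F G : hist_mean i (fun s => F s + G s) = hist_mean i F + hist_mean i G.
Proof.
rewrite -[hist_mean i F]mul1r -hist_mean_lin.
by apply: eq_hist_mean => s _; rewrite mul1r.
Qed.

Lemma hist_meanB i F G : hist_mean i (fun s => F s - G s) = hist_mean i F - hist_mean i G.
Proof.
rewrite -[- hist_mean i G]mulN1r -hist_meanZ -hist_meanD.
by apply: eq_hist_mean => s _; rewrite mulN1r.
Qed.

Lemma hist_mean_sum i n (F : nat -> seq nat -> R) :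
  hist_mean i (fun s => \sum_(j < n) F j s) = \sum_(j < n) hist_mean i (F j).
Proof.
elim: n => [|n IH].
  rewrite big_ord0 -[RHS](hist_mean_cst i).
  by apply: eq_hist_mean => z _; rewrite big_ord0.
rewrite big_ord_recr/= -IH -hist_meanD.
by apply: eq_hist_mean => z _; rewrite big_ord_recr.
Qed.

Lemma hist_mean_ge0 i F : (i <= m)%N -> (forall s, size s = i -> 0 <= F s) ->
  0 <= hist_mean i F.
Proof. by move=> im F0; rewrite -(hist_mean_cst i 0); apply: hist_mean_le. Qed.

Lemma hist_mean_norm i F : (i <= m)%N -> `|hist_mean i F| <= hist_mean i (fun s => `|F s|).
Proof.
move=> im; rewrite ler_norml -mulN1r -hist_meanZ; apply/andP; split.
  by apply: hist_mean_le => // s _; rewrite mulN1r lerNl -normrN ler_norm.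
by apply: hist_mean_le => // s _; rewrite ler_norm.
Qed.

(** A function of the first [i] steps only: with the latest hit first, dropping
    [j] entries recovers the history at time [i]. *)
Lemma hist_mean_drop i j F : hist_mean (i + j) (fun s => F (drop j s)) = hist_mean i F.
Proof.
elim: j => [|j IH].
  by rewrite addn0; apply: eq_hist_mean => s _; rewrite drop0.
rewrite addnS -[RHS]IH /=; apply: eq_hist_mean => s _.
by rewrite binom_mean_cst.
Qed.

Lemma hist_mean_mart c i : (i < m)%N ->
  hist_mean i (fun s => mart R c (m - i) (ptrs s)) = mart R c m 2.
Proof.
elim: i => [|i IH] im; first by rewrite /= subn0.
rewrite -IH; last exact: ltnW.
rewrite /=; apply: eq_hist_mean => s _.
have -> : (m - i = (m - i.+1).+1)%N by lia.
by apply: mart_step; lia.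
Qed.

End Hexp.

Section Moments.
Variable R : archiRealFieldType.
Notation phi := (@phi R).
Notation mart := (@mart R).

Lemma mart_start_le c : exists2 C : R, 0 <= C &
  forall m, (0 < m)%N -> `|mart c m 2| <= C * m.+1%:R ^+ c.
Proof.
have [C C0 hC] := mart_start_near R c.
exists (C + (c.+1)`!%:R); first by rewrite addr_ge0.
move=> m m0; have := hC m m0.
have m1 : 1 <= m%:R :> R by rewrite ler1n.
set x := mart c m 2; set z := (c.+1)`!%:R * m.+1%:R ^+ c => h.
have mc : m%:R ^+ c <= m.+1%:R ^+ c :> R by rewrite lerXn2r ?nnegrE// ler_nat.
have {}h : `|x - z| <= C * m.+1%:R ^+ c.
  apply: (@le_trans _ _ (`|x - z| * m%:R)); first by rewrite ler_peMr.
  by apply: le_trans h _; rewrite ler_wpM2l.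
have -> : x = (x - z) + z by ring.
rewrite mulrDl; apply: le_trans (ler_normD _ _) _; apply: lerD => //.
by rewrite ger0_norm// mulr_ge0// exprn_ge0.
Qed.

(** Induction on [p] through [phi_le_mart]: the martingale has mean of order [m
    ^+ p], which [rise k p ^+ 2], at least [k ^+ (2 * p)], compensates when [m =
    O(k ^+ 2)]. *)
Lemma hist_mean_phi_le (b p : nat) : exists2 C : R, 0 <= C &
  forall m i, (i < m)%N -> (m.+1 <= b * (m - i) ^ 2)%N ->
    hist_mean m i (fun s => phi p (m - i) (ptrs s)) <= C.
Proof.
have [n] := ubnP p; elim: n p => // n IH p; rewrite ltnS => pn.
have [D D0 hD] : exists2 D : R, 0 <= D & forall j, (j < p)%N ->
    forall m i, (i < m)%N -> (m.+1 <= b * (m - i) ^ 2)%N ->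
    hist_mean m i (fun s => phi j (m - i) (ptrs s)) <= D.
  elim: p pn => [|p IHp] pn; first by exists 0.
  have [D D0 hD] := IHp (ltnW pn); have [C C0 hC] := IH p pn.
  exists (C + D); first exact: addr_ge0.
  move=> j; rewrite ltnS leq_eqVlt => /orP[/eqP ->|jp] m i im hb.
    by apply: le_trans (hC m i im hb) _; rewrite lerDl.
  by apply: le_trans (hD j jp m i im hb) _; rewrite lerDr.
have [C C0 hC] := mart_start_le p.
exists (C * b%:R ^+ p + p`!%:R * (p%:R * D)).
  by rewrite addr_ge0// !mulr_ge0// exprn_ge0.
move=> m i im hb; set k := (m - i)%N in hb *.
have k0 : (0 < k)%N by rewrite subn_gt0.
have kp : 0 < k%:R :> R by rewrite ltr0n.
have m0 : (0 < m)%N by exact: leq_ltn_trans im.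
apply: (@le_trans _ _ (hist_mean m i (fun s => (rise k%:R p ^+ 2)^-1 * mart p k (ptrs s)
    + p`!%:R * \sum_(j < p) phi j k (ptrs s)))).
  apply: hist_mean_le => [|s _]; first exact: ltnW.
  by rewrite [X in X + _]mulrC; apply: phi_le_mart.
rewrite hist_mean_lin hist_mean_mart// hist_meanZ (hist_mean_sum _ _ _ (fun j s => phi j k (ptrs s))).
apply: lerD; last first.
  apply: ler_wpM2l => //; apply: (@le_trans _ _ (\sum_(j < p) D)).
    by apply: ler_sum => j _; apply: hD.
  by rewrite sumr_const card_ord mulr_natl.
have r2 : 0 < rise k%:R p ^+ 2 :> R by rewrite exprn_gt0// rise_gt0.
rewrite mulrC ler_pdivrMr//; apply: le_trans (ler_norm _) _.
apply: le_trans (hC m m0) _; rewrite -mulrA ler_wpM2l//.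
apply: (@le_trans _ _ ((b%:R * k%:R ^+ 2) ^+ p)).
  by rewrite lerXn2r ?nnegrE ?mulr_ge0 ?exprn_ge0// -natrX -natrM ler_nat.
rewrite exprMn -exprM mulnC exprM ler_wpM2l ?exprn_ge0// lerXn2r ?nnegrE ?rise_ge0 ?exprn_ge0//.
exact: rise_ge_pow.
Qed.

(** The mean of [mart c] is known exactly, and replacing it by the power of
    [quad_mart] costs one order in [k] because the means of [phi (c + 3)] are
    bounded on this range of [k]. *)
Lemma hist_mean_quad_mart_moment (b c : nat) : exists2 C : R, 0 <= C & exists k1,
  forall m i, (i < m)%N -> (k1 <= m - i)%N ->
    (m.+1 <= b * (m - i) ^ 2)%N -> ((m - i) ^ 2 <= b * m.+1)%N ->
    `|hist_mean m i (fun s => quad_mart R (m - i) (ptrs s) ^+ c) - (c.+1)`!%:R * m.+1%:R ^+ c|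
      * (m - i)%:R <= C * m.+1%:R ^+ c.
Proof.
have [C C0 [k1 hC]] := quad_mart_mart R c.
have [D D0 hD] := hist_mean_phi_le b (c + 3).
have [E E0 hE] := mart_start_near R c.
exists (C * b%:R ^+ c * D + E).
  by rewrite addr_ge0// !mulr_ge0// exprn_ge0.
exists k1 => m i im kk1 nb bn; set k := (m - i)%N in kk1 nb bn *.
have m0 : (0 < m)%N by exact: leq_ltn_trans im.
set H := hist_mean m i _; set z := (c.+1)`!%:R * m.+1%:R ^+ c.
apply: (@le_trans _ _ (`|H - mart c m 2| * k%:R + `|mart c m 2 - z| * k%:R)).
  by rewrite -mulrDl ler_wpM2r// ler_distD.
rewrite mulrDl; apply: lerD; last first.
  apply: (@le_trans _ _ (`|mart c m 2 - z| * m%:R)).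
    by rewrite ler_wpM2l// ler_nat leq_subr.
  apply: le_trans (hE m m0) _; rewrite ler_wpM2l//.
  by rewrite lerXn2r ?nnegrE// ler_nat.
have -> : H - mart c m 2 = hist_mean m i (fun s => quad_mart R k (ptrs s) ^+ c - mart c k (ptrs s)).
  by rewrite hist_meanB hist_mean_mart.
apply: (@le_trans _ _ (hist_mean m i (fun s => C * k%:R ^+ (2 * c) * phi (c + 3) k (ptrs s)))).
  apply: (@le_trans _ _ (hist_mean m i (fun s => k%:R * `|quad_mart R k (ptrs s) ^+ c - mart c k (ptrs s)|))).
    by rewrite hist_meanZ mulrC ler_wpM2l// hist_mean_norm// ltnW.
  apply: hist_mean_le => [|s _]; first exact: ltnW.
  by rewrite mulrC -mulrA; apply: hC.
rewrite hist_meanZ [X in _ <= X](_ : _ = C * (b%:R * m.+1%:R) ^+ c * D); last first.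
  by rewrite exprMn; ring.
apply: ler_pM.
- by rewrite mulr_ge0// exprn_ge0.
- by apply: hist_mean_ge0 => [|s _]; [exact: ltnW|exact: phi_ge0].
- rewrite ler_wpM2l// exprM lerXn2r ?nnegrE ?exprn_ge0 ?mulr_ge0//.
  by rewrite -natrX -natrM ler_nat.
- exact: hD.
Qed.

End Moments.

(** * Number of visits and its compensator *)

Definition visits (s : seq nat) : nat := count (fun z => 0 < z)%N s.

Section Process.
Variable R : archiRealFieldType.
Notation phi := (@phi R).
Notation mart := (@mart R).
Notation quad_mart := (@quad_mart R).
Variable m : nat.
Notation hist_mean := (@hist_mean R m).

Definition past (j : nat) (s : seq nat) : seq nat := drop (size s - j) s.

Lemma past_cons j z s : (j <= size s)%N -> past j (z :: s) = past j s.
Proof. by move=> js; rewrite /past /= subSn. Qed.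

Lemma past_id s : past (size s) s = s.
Proof. by rewrite /past subnn drop0. Qed.

Lemma size_past j s : (j <= size s)%N -> size (past j s) = j.
Proof. by move=> js; rewrite /past size_drop subKn. Qed.

Lemma hist_mean_past j i (G : seq nat -> R) : (j <= i)%N ->
  hist_mean i (fun s => G (past j s)) = hist_mean j G.
Proof.
move=> ji; rewrite -(hist_mean_drop m j (i - j) G) subnKC//.
by apply: eq_hist_mean => s si; rewrite /past si.
Qed.

Definition past_sum (f : nat -> seq nat -> R) (s : seq nat) : R :=
  \sum_(j < size s) f j (past j s).

Lemma past_sum_cons f z s : past_sum f (z :: s) = past_sum f s + f (size s) s.
Proof.
rewrite /past_sum /= big_ord_recr /= past_cons// past_id; congr (_ + _).
by apply: eq_bigr => j _; rewrite past_cons// ltnW.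
Qed.

Lemma hist_mean_past_sum i f :
  hist_mean i (past_sum f) = \sum_(j < i) hist_mean j (f j).
Proof.
transitivity (hist_mean i (fun s => \sum_(j < i) f j (past j s))).
  by apply: eq_hist_mean => s si; rewrite /past_sum si.
rewrite (hist_mean_sum _ _ _ (fun j s => f j (past j s))); apply: eq_bigr => j _.
by rewrite hist_mean_past// ltnW.
Qed.

Definition quad_mart_hist (s : seq nat) : R := quad_mart (m - size s) (ptrs s).

Lemma quad_mart_mart1 k y : (0 < k)%N -> quad_mart k y = mart 1 k y.
Proof.
move=> k0; rewrite /quad_mart /mart !big_ord_recr big_ord0 /= !subn0 subnn.
rewrite bin0 bin1 !riseS !rise0 phi0 /=. ring.
Qed.

Lemma quad_mart_hist_ge0 s : 0 <= quad_mart_hist s. Proof. exact: quad_mart_ge0. Qed.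

Lemma binom_mean_quad_mart_hist s : ((size s).+1 < m)%N ->
  binom_mean (ptrs s) (m - size s)%:R^-1 (fun z => quad_mart_hist (z :: s)) = quad_mart_hist s.
Proof.
move=> sm; rewrite /quad_mart_hist /=.
have e : (m - size s = (m - (size s).+1).+1)%N by lia.
have k0 : (0 < m - (size s).+1)%N by lia.
rewrite e quad_mart_mart1// -mart_step//.
by apply: eq_binom_mean => z _; rewrite quad_mart_mart1.
Qed.

Lemma hist_mean_quad_mart_hist i : (i < m)%N -> hist_mean i quad_mart_hist = (2 * m + 1)%:R.
Proof.
move=> im; have m0 : (0 < m)%N by exact: leq_ltn_trans im.
transitivity (mart 1 m 2).
  rewrite -(hist_mean_mart R 1 im); apply: eq_hist_mean => s si.
  by rewrite /quad_mart_hist si quad_mart_mart1// subn_gt0.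
have mn0 : m%:R != 0 :> R by rewrite pnatr_eq0 -lt0n.
rewrite -quad_mart_mart1// /quad_mart /phi natrD natrM.
by field.
Qed.

(** Orthogonality: the martingale property lets the later value be replaced by
    the earlier one against any function of the past. *)
Lemma hist_mean_quad_mart_hist_cross j i (G : seq nat -> R) : (j + i < m)%N ->
  hist_mean (j + i) (fun s => G (past j s) * quad_mart_hist s) = hist_mean j (fun s => G s * quad_mart_hist s).
Proof.
elim: i => [|i IH] jm.
  by rewrite addn0; apply: eq_hist_mean => s si; rewrite -{1}si past_id.
rewrite -IH; last lia.
rewrite addnS /=; apply: eq_hist_mean => s si.
rewrite -[X in _ = _ * X]binom_mean_quad_mart_hist si; last lia.
rewrite -binom_meanZ; apply: eq_binom_mean => z _; rewrite past_cons// si; lia.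
Qed.

(** A convex function lies above its tangent at [t]. *)
Lemma tangent_le p (x t : R) : 0 <= x -> 0 <= t ->
  t ^+ p.+1 + p.+1%:R * t ^+ p * (x - t) <= x ^+ p.+1.
Proof.
move=> x0 t0; elim: p => [|p IH]; first by rewrite expr0 !expr1; lra.
apply: (@le_trans _ _ (x * (t ^+ p.+1 + p.+1%:R * t ^+ p * (x - t)))); last first.
  by rewrite [X in _ <= X]exprS ler_wpM2l//.
rewrite -subr_ge0 [X in 0 <= X](_ : _ = p.+1%:R * t ^+ p * (x - t) ^+ 2).
  by apply: mulr_ge0; rewrite ?sqr_ge0// mulr_ge0 ?exprn_ge0.
by rewrite -[p.+2%:R]natr1 !exprS; ring.
Qed.

(** Jensen's inequality for the convex power, through the tangent at the earlier
    value: its linear term has mean zero by orthogonality. *)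
Lemma hist_mean_quad_mart_hist_pow_le j i p : (j <= i)%N -> (i < m)%N ->
  hist_mean j (fun s => quad_mart_hist s ^+ p.+1) <= hist_mean i (fun s => quad_mart_hist s ^+ p.+1).
Proof.
move=> ji im.
have {}ji : (j + (i - j))%N = i by rewrite subnKC.
rewrite -{}ji in im *; move: (i - j)%N im => {}i im.
set T := fun s t => t ^+ p.+1 + p.+1%:R * t ^+ p * (quad_mart_hist s - t).
apply: (@le_trans _ _ (hist_mean (j + i) (fun s => T s (quad_mart_hist (past j s))))); last first.
  by apply: hist_mean_le => [|s _]; [exact: ltnW|exact: tangent_le (quad_mart_hist_ge0 _) (quad_mart_hist_ge0 _)].
rewrite le_eqVlt; apply/orP; left; apply/eqP.
transitivity (hist_mean (j + i) (fun s => (fun s => quad_mart_hist s ^+ p.+1 - p.+1%:R * quad_mart_hist s ^+ p.+1) (past j s)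
   + (fun s => p.+1%:R * quad_mart_hist s ^+ p) (past j s) * quad_mart_hist s)).
  rewrite hist_meanD (hist_mean_quad_mart_hist_cross (fun s => p.+1%:R * quad_mart_hist s ^+ p))// (hist_mean_past (fun s => quad_mart_hist s ^+ p.+1 - p.+1%:R * quad_mart_hist s ^+ p.+1)) ?leq_addr//.
  rewrite -hist_meanD; apply: eq_hist_mean => s _; rewrite !exprS; ring.
by apply: eq_hist_mean => s _; rewrite /T !exprS; ring.
Qed.

(** Pythagoras for the increments of a square-integrable martingale. *)
Lemma hist_mean_quad_mart_hist_sqr_diff j i : (j <= i)%N -> (i < m)%N ->
  hist_mean i (fun s => (quad_mart_hist (past j s) - quad_mart_hist s) ^+ 2) =
  hist_mean i (fun s => quad_mart_hist s ^+ 2) - hist_mean j (fun s => quad_mart_hist s ^+ 2).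
Proof.
move=> ji im.
have jim : (j + (i - j) < m)%N by rewrite subnKC.
have cr := hist_mean_quad_mart_hist_cross (fun s => quad_mart_hist s) jim; rewrite subnKC// in cr.
have -> : hist_mean j (fun s => quad_mart_hist s ^+ 2) = 2 * hist_mean i (fun s => quad_mart_hist (past j s) * quad_mart_hist s)
   - hist_mean i (fun s => (fun s => quad_mart_hist s ^+ 2) (past j s)).
  rewrite (hist_mean_past (fun s => quad_mart_hist s ^+ 2))// cr.
  have -> : hist_mean j (fun s => quad_mart_hist s * quad_mart_hist s) = hist_mean j (fun s => quad_mart_hist s ^+ 2).
    by apply: eq_hist_mean => s _; rewrite expr2.
  by ring.
rewrite -hist_meanZ -!hist_meanB; apply: eq_hist_mean => s _; ring.
Qed.

(** The probability that at least one of [y] uniform pointers hits a given one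
    of [k] vertices. *)
Definition hit_prob (k y : nat) : R := 1 - (1 - k%:R^-1) ^+ y.
Definition next_hit_prob (s : seq nat) : R := hit_prob (m - size s) (ptrs s).

Lemma hit_prob_bounds k y : (0 < k)%N -> 0 <= hit_prob k y <= 1.
Proof.
move=> k0; have ki : 0 <= (k%:R^-1 : R) <= 1.
  by rewrite invr_ge0 ler0n invf_le1 ?ltr0n// ler1n.
move: ki => /andP[k1 k2]; rewrite /hit_prob subr_ge0 exprn_ile1//=; try lra.
by rewrite lerBlDl lerDr exprn_ge0//; lra.
Qed.

Lemma pow_sub_le (u v : R) y : 0 <= v -> v <= u -> u <= 1 ->
  u ^+ y - v ^+ y <= y%:R * (u - v).
Proof.
move=> v0 vu u1; elim: y => [|y IH]; first by rewrite subrr mul0r.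
have -> : u ^+ y.+1 - v ^+ y.+1 = u * (u ^+ y - v ^+ y) + (u - v) * v ^+ y.
  by rewrite !exprS; ring.
rewrite -natr1 [X in _ <= X]mulrDl mul1r lerD//.
  apply: le_trans IH; rewrite ler_piMl// subr_ge0 lerXn2r// nnegrE; lra.
by rewrite ler_piMr ?subr_ge0// exprn_ile1//; lra.
Qed.

Lemma y_le_quad_mart k y : (0 < k)%N -> y%:R <= quad_mart k y / k%:R.
Proof.
move=> k0; have kp : 0 < k%:R :> R by rewrite ltr0n.
rewrite ler_pdivlMr// /quad_mart expr2 -mulrA [X in X <= _]mulrC ler_pM2l//.
rewrite -ler_pdivrMl// mulrC lerBrDl /phi mul1r.
by apply: bernoulli_ge; rewrite invr_ge0 ltW.
Qed.

Lemma hit_prob_le k y : (0 < k)%N -> hit_prob k y <= quad_mart k y / k%:R ^+ 2.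
Proof.
move=> k0; have kp : 0 < k%:R :> R by rewrite ltr0n.
have k1 : 1 <= k%:R :> R by rewrite ler1n.
have ki : 0 <= (k%:R^-1 : R) <= 1 by rewrite invr_ge0 (ltW kp) invf_le1.
move: ki => /andP[ki0 ki1].
apply: (@le_trans _ _ (y%:R * k%:R^-1)).
  rewrite /hit_prob -{1}(expr1n R y); apply: le_trans (pow_sub_le _ _ _ _) _; try lra.
rewrite expr2 invfM mulrA ler_wpM2r//; exact: y_le_quad_mart.
Qed.

(** With [u = 1 / (1 + 1 / k)], the fraction is exactly [1 - u ^+ y], and [u]
    differs from [1 - 1 / k] by at most [1 / k ^+ 2]. *)
Lemma hit_prob_approx k y : (0 < k)%N ->
  `|hit_prob k y - quad_mart k y / (k%:R ^+ 2 + quad_mart k y)| <= quad_mart k y / k%:R ^+ 3.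
Proof.
move=> k0; have kp : 0 < k%:R :> R by rewrite ltr0n.
have k1 : 1 <= k%:R :> R by rewrite ler1n.
have ki : 0 < (k%:R^-1 : R) <= 1 by rewrite invr_gt0 kp invf_le1.
move: ki => /andP[ki0 ki1].
set u := (1 + k%:R^-1)^-1 : R.
have u0 : 0 < u by rewrite invr_gt0; lra.
have u1 : u <= 1 by rewrite invf_le1; lra.
have -> : quad_mart k y / (k%:R ^+ 2 + quad_mart k y) = 1 - u ^+ y.
  rewrite /quad_mart /phi mul1r exprVn.
  have h0 : (1 + k%:R^-1) ^+ y != 0 :> R by rewrite expf_neq0// gt_eqF; lra.
  move: ((1 + k%:R^-1) ^+ y) h0 => w w0; field.
  rewrite w0 /= (_ : _ + _ = k%:R ^+ 2 * w); last by ring.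
  by rewrite mulf_neq0// expf_neq0// gt_eqF.
have vu : 1 - k%:R^-1 <= u.
  rewrite /u -[X in _ <= X]mul1r ler_pdivlMr; last lra.
  by rewrite -subr_ge0 [X in 0 <= X](_ : _ = k%:R^-1 ^+ 2) ?sqr_ge0//; ring.
have uv : u - (1 - k%:R^-1) <= k%:R^-1 ^+ 2.
  rewrite lerBlDr -[u]mul1r ler_pdivrMr; last lra.
  rewrite -subr_ge0 [X in 0 <= X](_ : _ = k%:R^-1 ^+ 3) ?exprn_ge0//; ring.
rewrite /hit_prob (_ : 1 - _ - _ = u ^+ y - (1 - k%:R^-1) ^+ y); last by ring.
rewrite ger0_norm; last by rewrite subr_ge0 lerXn2r// nnegrE; lra.
apply: le_trans (pow_sub_le _ _ vu u1) _; first lra.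
apply: (@le_trans _ _ (quad_mart k y / k%:R * k%:R^-1 ^+ 2)).
  by apply: ler_pM => //; [rewrite subr_ge0|exact: y_le_quad_mart].
by rewrite -mulrA -exprVn -exprS.
Qed.

Lemma frac_lip (k : nat) (x t : R) : (0 < k)%N -> 0 <= x -> 0 <= t ->
  `|x / (k%:R ^+ 2 + x) - t / (k%:R ^+ 2 + t)| <= `|x - t| / k%:R ^+ 2.
Proof.
move=> k0 x0 t0; have kp : 0 < k%:R ^+ 2 :> R by rewrite exprn_gt0// ltr0n.
set K := k%:R ^+ 2 in kp *.
have -> : x / (K + x) - t / (K + t) = (x - t) * (K / ((K + x) * (K + t))).
  by field; rewrite !gt_eqF//; lra.
rewrite normrM ler_wpM2l//  ger0_norm; last by rewrite divr_ge0 ?mulr_ge0//; lra.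
rewrite ler_pdivrMr; last by rewrite mulr_gt0//; lra.
rewrite mulrC ler_pdivlMr// -expr2.
have : 0 <= x * t by rewrite mulr_ge0.
have : 0 <= K * x by rewrite mulr_ge0// ltW.
have : 0 <= K * t by rewrite mulr_ge0// ltW.
by rewrite expr2; lra.
Qed.

(** Telescoping, from [1 / (k + 1) ^+ 2 <= 1 / k - 1 / (k + 1)]. *)
Lemma sum_inv_sqr i : (i < m)%N ->
  \sum_(j < i) ((m - j)%:R ^+ 2)^-1 <= (m - i)%:R^-1 :> R.
Proof.
move=> im; apply: (@le_trans _ _ ((m - i)%:R^-1 - m%:R^-1)); last first.
  by rewrite gerBl invr_ge0.
elim: i im => [|i IH] im; first by rewrite big_ord0 subn0 subrr.
rewrite big_ord_recr /=; have {}IH := IH (ltnW im).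
have -> : (m - i = (m - i.+1).+1)%N by lia.
have k0 : (0 < m - i.+1)%N by lia.
rewrite (_ : m - i = (m - i.+1).+1)%N in IH; last by lia.
move: (m - i.+1)%N k0 IH => k k0 IH.
have kp : 0 < k%:R :> R by rewrite ltr0n.
have : (k.+1%:R ^+ 2)^-1 <= k%:R^-1 - k.+1%:R^-1 :> R.
  have -> : k%:R^-1 - k.+1%:R^-1 = (k%:R * k.+1%:R)^-1 :> R.
    by rewrite -natr1; field; rewrite !gt_eqF// ltr_wpDl.
  rewrite lef_pV2 ?posrE ?mulr_gt0 ?exprn_gt0 ?ltr0n//.
  by rewrite expr2 ler_wpM2r// ler_nat.
move=> h; rewrite [X in _ <= X](_ : _ = (k.+1%:R^-1 - m%:R^-1) + (k%:R^-1 - k.+1%:R^-1)); last by ring.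
exact: lerD.
Qed.

(** The visits minus their compensator form a martingale, whose variance is at
    most the mean of the compensator; that mean is bounded by the sum of [(2 * m
    + 1) / k ^+ 2] because [hit_prob] is at most [quad_mart / k ^+ 2]. *)
Lemma visits_comp i : (i < m)%N ->
  hist_mean i (fun s => ((visits s)%:R - past_sum (fun _ => next_hit_prob) s) ^+ 2) <=
  (2 * m + 1)%:R / (m - i)%:R.
Proof.
move=> im.
apply: (@le_trans _ _ (\sum_(j < i) hist_mean j next_hit_prob)).
  elim: i im => [|i IH] im /=.
    by rewrite /visits /past_sum /= !big_ord0 subrr expr0n.
  rewrite big_ord_recr /=; apply: le_trans (lerD (IH (ltnW im)) (lexx _)).
  rewrite -hist_meanD; apply: hist_mean_le => [|s si]; first by rewrite ltnW// ltnW.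
  set d := (visits s)%:R - past_sum (fun _ => next_hit_prob) s.
  have k0 : (0 < m - i)%N by lia.
  have qE : binom_mean (ptrs s) (m - i)%:R^-1 (fun z => (z == 0%N)%:R) = 1 - next_hit_prob s.
    by rewrite binom_mean_eq0 /next_hit_prob si /hit_prob; ring.
  rewrite (@eq_binom_mean _ _ _ _ (fun z => ((d + - next_hit_prob s) ^+ 2 - (d + 1 - next_hit_prob s) ^+ 2) * (z == 0%N)%:R + (d + 1 - next_hit_prob s) ^+ 2)).
    rewrite binom_mean_lin binom_mean_cst qE -subr_ge0 [X in 0 <= X](_ : _ = next_hit_prob s ^+ 2) ?sqr_ge0//.
    by ring.
  move=> [|z] _; rewrite past_sum_cons /visits /=.
    by rewrite add0n -/(visits s) /d; ring.
  by rewrite natrD -/(visits s) /d; ring.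
apply: (@le_trans _ _ (\sum_(j < i) (2 * m + 1)%:R * ((m - j)%:R ^+ 2)^-1)).
  apply: ler_sum => j _; have jm : (j < m)%N by exact: ltn_trans im.
  rewrite -(hist_mean_quad_mart_hist jm) mulrC -hist_meanZ; apply: hist_mean_le => [|s sj]; first exact: ltnW.
  by rewrite mulrC /next_hit_prob /quad_mart_hist sj; apply: hit_prob_le; rewrite subn_gt0.
by rewrite -mulr_sumr ler_wpM2l// sum_inv_sqr.
Qed.

End Process.

(** * The Riemann sum giving the factor pi / 2 *)

Section Atan.
Variable R : realType.
Implicit Types (a b x : R).

Lemma atan_incr a b : 0 <= a -> a < b ->
  (b - a) / (1 + b ^+ 2) <= atan b - atan a <= (b - a) / (1 + a ^+ 2).
Proof.
move=> a0 ab.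
have [c] := @MVT R atan (fun x => (1 + x ^+ 2)^-1) a b ab (fun x _ => is_derive1_atan x)
  (continuous_subspaceT (@continuous_atan R)).
rewrite in_itv/= => /andP[ac cb] ->.
rewrite ![_ * (b - a)]mulrC !ler_pM2l ?subr_gt0//.
have pos y : 0 < 1 + y ^+ 2 :> R by rewrite ltr_pwDl// sqr_ge0.
by rewrite !lef_pV2 ?posrE// !lerD2l !lerXn2r ?nnegrE//; lra.
Qed.

Lemma atan_ge0 x : 0 <= x -> 0 <= atan x.
Proof. by move=> x0; rewrite -(atan0 R); apply: le_atan. Qed.

Lemma atan_le x : 0 <= x -> atan x <= x.
Proof.
rewrite le_eqVlt => /orP[/eqP <-|x0]; first by rewrite atan0.
have /andP[_] := atan_incr (lexx 0) x0.
by rewrite atan0 !subr0 expr0n addr0 divr1.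
Qed.

(** The complementary angle is the arctangent of [1 / x]. *)
Lemma atan_cofact x : 0 < x -> pi / 2 - atan x <= x^-1.
Proof.
move=> x0; have t0 : 0 < atan x.
  by rewrite -(atan0 R); apply: lt_atan.
have t1 := atan_ltpi2 x.
have xi : 0 <= x^-1 by rewrite invr_ge0 ltW.
suff <- : atan x^-1 = pi / 2 - atan x by exact: atan_le.
rewrite -[RHS]tanK; last by rewrite in_itv/=; apply/andP; split; lra.
congr atan; rewrite -[x in LHS]atanK /tan invf_div.
by rewrite sinB cosB sin_pihalf cos_pihalf; congr (_ / _); ring.
Qed.

Lemma sum_le_telescope i (F G : nat -> R) :
  (forall j, (j < i)%N -> F j <= G j - G j.+1) -> \sum_(j < i) F j <= G 0%N - G i.
Proof.
elim: i => [|i IH] h; first by rewrite big_ord0 subrr.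
rewrite big_ord_recr /= (_ : G 0%N - G i.+1 = (G 0%N - G i) + (G i - G i.+1)); last by ring.
by apply: lerD; [apply: IH => j ji; apply: h; exact: ltnW|exact: h].
Qed.

(** With [r = sqrt x], the summand lies between increments of [r * atan (k / r)]
    at consecutive arguments. The sum is therefore [r * (pi / 2)] up to the
    missing small [k] and the missing tail. *)
Lemma frac_sum_approx (m i : nat) (x : R) : (i < m)%N -> 0 <= x ->
  `|\sum_(j < i) x / ((m - j)%:R ^+ 2 + x) - pi / 2 * Num.sqrt x|
  <= (m - i).+1%:R + x / m.+1%:R.
Proof.
move=> im; rewrite le_eqVlt => /orP[/eqP <-|x0].
  rewrite sqrtr0 mulr0 subr0 big1 ?normr0; last by move=> j _; rewrite mul0r.
  by rewrite mul0r addr0.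
set r := Num.sqrt x.
have r0 : 0 < r by rewrite sqrtr_gt0.
have xr : x = r ^+ 2 by rewrite sqr_sqrtr// ltW.
have incr (k : nat) : r * (atan (k.+1%:R / r) - atan (k%:R / r)) <= x / (k%:R ^+ 2 + x)
   /\ x / (k.+1%:R ^+ 2 + x) <= r * (atan (k.+1%:R / r) - atan (k%:R / r)).
  have k0 : 0 <= k%:R / r by rewrite divr_ge0// ltW.
  have k1 : k%:R / r < k.+1%:R / r by rewrite ltr_pM2r ?invr_gt0// ltr_nat.
  have /andP[h1 h2] := atan_incr k0 k1.
  have -> : x / (k%:R ^+ 2 + x) = r * ((k.+1%:R / r - k%:R / r) / (1 + (k%:R / r) ^+ 2)).
    rewrite xr -[k.+1%:R]natr1; field; rewrite (gt_eqF r0) /=.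
    by rewrite gt_eqF// ltr_pwDl ?sqr_ge0// exprn_gt0.
  have -> : x / (k.+1%:R ^+ 2 + x) = r * ((k.+1%:R / r - k%:R / r) / (1 + (k.+1%:R / r) ^+ 2)).
    rewrite xr -[k.+1%:R]natr1; field; rewrite (gt_eqF r0) /=.
    by rewrite gt_eqF// ltr_pwDl ?sqr_ge0// exprn_gt0.
  by split; rewrite ler_pM2l.
have up : \sum_(j < i) x / ((m - j)%:R ^+ 2 + x) <= r * (atan (m%:R / r) - atan ((m - i)%:R / r)).
  rewrite mulrBr -{2}[m]subn0.
  apply: (sum_le_telescope (F := fun j => x / ((m - j)%:R ^+ 2 + x))
            (G := fun j => r * atan ((m - j)%:R / r))) => j ji.
  rewrite -mulrBr; have := (incr (m - j.+1)%N).2.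
  by have -> : ((m - j.+1).+1 = m - j)%N by lia.
have lo : r * (atan (m.+1%:R / r) - atan ((m - i).+1%:R / r)) <= \sum_(j < i) x / ((m - j)%:R ^+ 2 + x).
  rewrite -[X in _ <= X]opprK -sumrN lerNr -mulrN opprB mulrBr.
  have := sum_le_telescope (i := i) (F := fun j => - (x / ((m - j)%:R ^+ 2 + x)))
            (G := fun j => - (r * atan ((m - j).+1%:R / r))).
  rewrite subn0 opprK [- _ + _]addrC; apply=> j ji.
  have -> : ((m - j.+1).+1 = m - j)%N by lia.
  by rewrite -opprD lerN2 -mulrBr; exact: (incr (m - j)%N).1.
rewrite ler_distl; apply/andP; split.
  apply: le_trans lo; rewrite mulrBr.
  have h1 : r * atan ((m - i).+1%:R / r) <= (m - i).+1%:R.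
    rewrite -[X in _ <= X](mulfVK (lt0r_neq0 r0)) mulrC ler_pM2r//.
    by apply: atan_le; rewrite divr_ge0// ltW.
  have h2 : r * (pi / 2 - atan (m.+1%:R / r)) <= x / m.+1%:R.
    apply: (@le_trans _ _ (r * (m.+1%:R / r)^-1)).
      by rewrite ler_pM2l// atan_cofact// divr_gt0.
    by rewrite invf_div xr expr2 mulrA.
  have aux (X A B P Q : R) : Q <= A -> X - P <= B -> X - (A + B) <= P - Q by lra.
  by apply: aux h1 _; rewrite [pi / 2 * r]mulrC -mulrBr.
apply: le_trans up _.
apply: (@le_trans _ _ (pi / 2 * r)); last first.
  by rewrite lerDl addr_ge0// divr_ge0// ltW.
rewrite mulrC ler_pM2r//.
rewrite lerBlDr; apply: le_trans (ltW (atan_ltpi2 _)) _.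
by rewrite lerDl atan_ge0// divr_ge0// ltW.
Qed.

End Atan.

Section Approx.
Variable R : realType.
Notation quad_mart := (@quad_mart R).
Notation hist_mean := (@hist_mean R).
Notation quad_mart_hist := (@quad_mart_hist R).

(** A linear replacement for the square root in the Cauchy-Schwarz inequality. *)
Lemma amgm (d l : R) : 0 < l -> `|d| <= (l + d ^+ 2 / l) / 2.
Proof.
move=> l0; rewrite ler_pdivlMr// -subr_ge0.
rewrite (_ : _ - _ = (`|d| - l) ^+ 2 / l).
  by rewrite divr_ge0 ?sqr_ge0// ltW.
rewrite -[d ^+ 2]real_normK ?num_real//; field; exact: lt0r_neq0.
Qed.

(** The four sources of error are: visits against compensator (variance bound),
    hitting probabilities against [M / (k ^+ 2 + M)], the earlier values of the
    martingale against its last value [M], and the Riemann sum. For the third,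
    the increments are controlled in mean square by [V] between the levels [iK]
    and [i], and only in mean before [iK], where the weights [1 / k ^+ 2] have a
    small sum. The parameters [be] and [la] split square roots by the
    arithmetic-geometric inequality. *)
Lemma visits_approx (m i iK : nat) (be la V k0 e : R) :
  (i < m)%N -> (iK <= i)%N -> 0 < be -> 0 < la ->
  V = hist_mean m i (fun s => quad_mart_hist m s ^+ 2) - hist_mean m iK (fun s => quad_mart_hist m s ^+ 2) ->
  k0 = (m - i)%:R -> e = (2 * m + 1)%:R ->
  hist_mean m i (fun s => `|(visits s)%:R - pi / 2 * Num.sqrt (quad_mart_hist m s)|) <=
  (be + e / k0 / be) / 2 + e / k0 ^+ 2 + (la + V / la) / 2 / k0
  + 2 * e / (m - iK)%:R + (k0 + 1) + 2.
Proof.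
move=> im iKi be0 la0 VE k0E eE.
have k0N : (0 < m - i)%N by rewrite subn_gt0.
have k0p : 0 < k0 by rewrite k0E ltr0n.
have k1 : 1 <= k0 by rewrite k0E ler1n.
have e0 : 0 <= e by rewrite eE.
have V0 : 0 <= V by rewrite VE subr_ge0; apply: hist_mean_quad_mart_hist_pow_le.
have iKm : (iK < m)%N by exact: leq_ltn_trans im.
pose D s : R := (visits s)%:R - past_sum (fun _ => next_hit_prob R m) s.
pose g (j : nat) (t : seq nat) : R := quad_mart_hist m t / (m - j)%:R ^+ 3.
pose h (s : seq nat) (j : nat) (t : seq nat) : R := `|quad_mart_hist m t - quad_mart_hist m s| / (m - j)%:R ^+ 2.
have pw s : size s = i -> `|(visits s)%:R - pi / 2 * Num.sqrt (quad_mart_hist m s)| <=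
   `|D s| + past_sum g s + past_sum (h s) s + ((m - i).+1%:R + quad_mart_hist m s / m.+1%:R).
  move=> si; set x := quad_mart_hist m s; have x0 : 0 <= x by exact: quad_mart_hist_ge0.
  set S := \sum_(j < i) x / ((m - j)%:R ^+ 2 + x).
  have -> : (visits s)%:R - pi / 2 * Num.sqrt x = D s + (past_sum (fun _ => next_hit_prob R m) s - S) + (S - pi / 2 * Num.sqrt x).
    by rewrite /D; ring.
  apply: le_trans (ler_normD _ _) _; apply: lerD; last exact: frac_sum_approx.
  apply: le_trans (ler_normD _ _) _; rewrite -addrA lerD2l.
  rewrite /S /past_sum si -sumrB -big_split /=.
  apply: le_trans (ler_norm_sum _ _ _) _; apply: ler_sum => j _.
  have sj : size (past j s) = j by rewrite size_past// si ltnW.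
  have mj : (0 < m - j)%N by rewrite subn_gt0 (ltn_trans _ im).
  rewrite /g /h /next_hit_prob /quad_mart_hist sj -/(quad_mart_hist m s) -/x.
  set y := ptrs (past j s).
  have -> : hit_prob R (m - j) y - x / ((m - j)%:R ^+ 2 + x) =
    (hit_prob R (m - j) y - quad_mart (m - j) y / ((m - j)%:R ^+ 2 + quad_mart (m - j) y)) +
    (quad_mart (m - j) y / ((m - j)%:R ^+ 2 + quad_mart (m - j) y) - x / ((m - j)%:R ^+ 2 + x)) by ring.
  apply: le_trans (ler_normD _ _) _; apply: lerD; first exact: hit_prob_approx.
  by apply: frac_lip => //; exact: quad_mart_ge0.
apply: (@le_trans _ _ (hist_mean m i (fun s => `|D s| + past_sum g s + past_sum (h s) s + ((m - i).+1%:R + quad_mart_hist m s / m.+1%:R)))).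
  by apply: hist_mean_le => //; exact: ltnW.
rewrite !hist_meanD hist_mean_cst.
have T1 : hist_mean m i (fun s => `|D s|) <= (be + e / k0 / be) / 2.
  apply: (@le_trans _ _ (hist_mean m i (fun s => be / 2 + (2 * be)^-1 * D s ^+ 2))).
    apply: hist_mean_le => [|s _]; first exact: ltnW.
    apply: le_trans (amgm _ be0) _; rewrite le_eqVlt; apply/orP; left; apply/eqP.
    by field; rewrite gt_eqF.
  rewrite hist_meanD hist_mean_cst hist_meanZ [X in _ <= X]mulrDl lerD2l.
  have := visits_comp R im; rewrite -eE -k0E -/(D _) => hD.
  rewrite [X in _ <= X](_ : _ = (2 * be)^-1 * (e / k0)); last by field; rewrite !gt_eqF.
  by rewrite ler_wpM2l// invr_ge0 mulr_ge0// ltW.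
have T2 : hist_mean m i (past_sum g) <= e / k0 ^+ 2.
  rewrite hist_mean_past_sum; apply: (@le_trans _ _ (\sum_(j < i) e / k0 * ((m - j)%:R ^+ 2)^-1)).
    apply: ler_sum => j _; have jm : (j < m)%N by exact: ltn_trans im.
    rewrite /g; under eq_hist_mean => s _ do rewrite mulrC.
    rewrite hist_meanZ hist_mean_quad_mart_hist// -eE mulrC -mulrA ler_wpM2l//.
    rewrite exprS invfM ler_wpM2r ?invr_ge0 ?exprn_ge0// k0E lef_pV2 ?posrE ?ltr0n ?subn_gt0//.
    by rewrite ler_nat leq_sub2l// ltnW.
  rewrite -mulr_sumr expr2 invfM mulrA ler_wpM2l ?divr_ge0 ?(ltW k0p)//.
  by rewrite ?k0E; exact: sum_inv_sqr.
have T4 : hist_mean m i (fun s => quad_mart_hist m s / m.+1%:R) <= 2.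
  under eq_hist_mean => s _ do rewrite mulrC.
  rewrite hist_meanZ hist_mean_quad_mart_hist// mulrC ler_pdivrMr// -natrM ler_nat; lia.
have T3 : hist_mean m i (fun s => past_sum (h s) s) <= (la + V / la) / 2 / k0 + 2 * e / (m - iK)%:R.
  pose hj j s : R := h s j (past j s).
  have -> : hist_mean m i (fun s => past_sum (h s) s) = \sum_(j < i) hist_mean m i (hj j).
    rewrite -(hist_mean_sum _ _ _ hj); apply: eq_hist_mean => s si.
    by rewrite /past_sum si.
  have hjE j : (j <= i)%N -> hist_mean m i (hj j) = hist_mean m i (fun s => `|quad_mart_hist m (past j s) - quad_mart_hist m s|) * ((m - j)%:R ^+ 2)^-1.
    by move=> ji; rewrite mulrC -hist_meanZ; apply: eq_hist_mean => s _; rewrite /hj /h mulrC.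
  have small j : (iK <= j <= i)%N -> hist_mean m i (hj j) <= (la + V / la) / 2 * ((m - j)%:R ^+ 2)^-1.
    move=> /andP[iKj ji]; rewrite hjE// ler_wpM2r// ?invr_ge0 ?exprn_ge0//.
    apply: (@le_trans _ _ (hist_mean m i (fun s => la / 2 + (2 * la)^-1 * (quad_mart_hist m (past j s) - quad_mart_hist m s) ^+ 2))).
      apply: hist_mean_le => [|s _]; first exact: ltnW.
      apply: le_trans (amgm _ la0) _; rewrite le_eqVlt; apply/orP; left; apply/eqP.
      by field; rewrite gt_eqF.
    rewrite hist_meanD hist_mean_cst hist_meanZ [X in _ <= X]mulrDl lerD2l hist_mean_quad_mart_hist_sqr_diff//.
    rewrite [X in _ <= X](_ : _ = (2 * la)^-1 * V); last by field; rewrite !gt_eqF.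
    rewrite ler_wpM2l ?invr_ge0 ?mulr_ge0 ?(ltW la0)// VE lerD2l lerN2.
    by apply: hist_mean_quad_mart_hist_pow_le => //; exact: leq_ltn_trans im.
  have big j : (j <= i)%N -> hist_mean m i (hj j) <= 2 * e * ((m - j)%:R ^+ 2)^-1.
    move=> ji; rewrite hjE// ler_wpM2r// ?invr_ge0 ?exprn_ge0//.
    apply: (@le_trans _ _ (hist_mean m i (fun s => quad_mart_hist m (past j s) + quad_mart_hist m s))).
      apply: hist_mean_le => [|s _]; first exact: ltnW.
      by apply: le_trans (ler_normB _ _) _; rewrite !ger0_norm ?quad_mart_hist_ge0.
    rewrite hist_meanD (hist_mean_past m (quad_mart_hist m))// !hist_mean_quad_mart_hist//; last exact: leq_ltn_trans im.
    by rewrite -eE; lra.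
  rewrite -(subnKC iKi) big_split_ord /= addrC; apply: lerD.
    rewrite subnKC//; apply: (@le_trans _ _ (\sum_(j < i) (la + V / la) / 2 * ((m - j)%:R ^+ 2)^-1)).
      rewrite -[in X in _ <= X](subnKC iKi) [X in _ <= X]big_split_ord /=.
      apply: (@le_trans _ _ (\sum_(j < i - iK) (la + V / la) / 2 * ((m - (iK + j))%:R ^+ 2)^-1)).
        apply: ler_sum => j _; apply: small; rewrite leq_addr /=.
        by have := ltn_ord j; lia.
      rewrite lerDr; apply: sumr_ge0 => j _.
      by rewrite !mulr_ge0 ?invr_ge0 ?addr_ge0 ?exprn_ge0// ?mulr_ge0 ?invr_ge0// ltW.
    rewrite -mulr_sumr ler_wpM2l//; last by rewrite ?k0E; exact: sum_inv_sqr.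
    by rewrite !mulr_ge0// addr_ge0 ?mulr_ge0 ?invr_ge0// ltW.
  rewrite subnKC//; apply: (@le_trans _ _ (\sum_(j < iK) 2 * e * ((m - j)%:R ^+ 2)^-1)).
    by apply: ler_sum => j _; apply: big; apply: leq_trans iKi; exact: ltnW.
  by rewrite -mulr_sumr ler_wpM2l ?mulr_ge0//; by rewrite ?k0E; exact: sum_inv_sqr.
rewrite -[(m - i).+1%:R]natr1 -k0E; move: T1 T2 T3 T4; lra.
Qed.

End Approx.

(** * Exponential moments and power means *)

Section VisitMoments.
Variable R : realType.
Notation quad_mart := (@quad_mart R).
Notation hist_mean := (@hist_mean R).
Notation quad_mart_hist := (@quad_mart_hist R).
Notation qsum m := (@past_sum R (fun _ => next_hit_prob R m)).

(** A supermartingale: a step multiplies the conditional mean by [exp (- be * q)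
    * (1 + be * q)] with [be = e - 1], which is at most 1. *)
Lemma hist_mean_expR (m i : nat) : (i <= m)%N ->
  hist_mean m i (fun s => expR ((visits s)%:R - (expR 1 - 1) * qsum m s)) <= 1.
Proof.
set be := expR 1 - 1 : R.
elim: i => [|i IH] im.
  by rewrite /= /past_sum big_ord0 mulr0 subrr expR0.
apply: le_trans (IH (ltnW im)) => /=; apply: hist_mean_le => [|s si]; first exact: ltnW.
set D := (visits s)%:R - be * qsum m s; set q := next_hit_prob R m s.
have k0 : (0 < m - i)%N by rewrite subn_gt0.
have qE : binom_mean (ptrs s) (m - i)%:R^-1 (fun z => (z == 0%N)%:R) = 1 - q.
  by rewrite binom_mean_eq0 /q /next_hit_prob si /hit_prob; ring.
rewrite (@eq_binom_mean _ _ _ _ (fun z => (expR (D - be * q) * (1 - expR 1)) * (z == 0%N)%:R + expR (D - be * q) * expR 1)).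
  rewrite binom_mean_lin binom_mean_cst qE.
  have -> : expR (D - be * q) * (1 - expR 1) * (1 - q) + expR (D - be * q) * expR 1 = expR (D - be * q) * (1 + be * q).
    by rewrite /be; ring.
  apply: (@le_trans _ _ (expR (D - be * q) * expR (be * q))).
    by rewrite ler_wpM2l ?expR_ge0// expR_ge1Dx.
  by rewrite -expRD subrK.
move=> [|z] _; rewrite past_sum_cons /visits /= -/(visits s) -/q.
  rewrite add0n (_ : _%:R - _ = D - be * q); last by rewrite /D; ring.
  by rewrite mulr1; ring.
rewrite natrD (_ : _ + _ - _ = (D - be * q) + 1); last by rewrite /D; ring.
by rewrite mulr0 add0r expRD.
Qed.

(** Jensen's inequality with weights of arbitrary mass, from the tangent at the
    weighted mean. *)
Lemma power_mean n (w x : 'I_n -> R) p :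
  (forall j, 0 <= w j) -> (forall j, 0 <= x j) ->
  (\sum_j w j * x j) ^+ p.+1 <= (\sum_j w j) ^+ p * \sum_j w j * x j ^+ p.+1.
Proof.
move=> w0 x0; set W := \sum_j w j; set S := \sum_j w j * x j.
have W0 : 0 <= W by exact: sumr_ge0.
have S0 : 0 <= S by apply: sumr_ge0 => j _; rewrite mulr_ge0.
have T0 : 0 <= \sum_j w j * x j ^+ p.+1.
  by apply: sumr_ge0 => j _; rewrite mulr_ge0// exprn_ge0.
have [W00|Wn0] := eqVneq W 0.
  have -> : S = 0.
    apply: big1 => j _; have /psumr_eq0P := W00 => /(_ (fun j _ => w0 j)) -> //.
    by rewrite mul0r.
  by rewrite exprS mul0r mulr_ge0// exprn_ge0.
have Wp : 0 < W by rewrite lt_neqAle eq_sym Wn0.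
set t := S / W.
have t0 : 0 <= t by rewrite divr_ge0.
have h : \sum_j w j * (t ^+ p.+1 + p.+1%:R * t ^+ p * (x j - t)) <= \sum_j w j * x j ^+ p.+1.
  by apply: ler_sum => j _; rewrite ler_wpM2l// tangent_le.
have hE : \sum_j w j * (t ^+ p.+1 + p.+1%:R * t ^+ p * (x j - t)) = W * t ^+ p.+1.
  rewrite (eq_bigr (fun j => w j * (t ^+ p.+1 - p.+1%:R * t ^+ p * t) + p.+1%:R * t ^+ p * (w j * x j))).
    rewrite big_split /= -mulr_suml -mulr_sumr -/S -/W.
    have -> : S = W * t by rewrite /t mulrC divfK.
    by rewrite !exprS; ring.
  by move=> j _; ring.
rewrite hE in h.
have -> : S ^+ p.+1 = W ^+ p * (W * t ^+ p.+1).
  by rewrite /t mulrA -exprSr expr_div_n mulrC divfK// expf_neq0.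
by rewrite ler_wpM2l// exprn_ge0.
Qed.

(** Either [x] is at most twice [be * c], or [x] is at most twice the excess [x
    - be * c], whose power is dominated by its exponential. *)
Lemma pow_le_expR (x c be : R) p : 0 <= x -> 0 <= c -> 0 <= be ->
  x ^+ p.+1 <= 2 ^+ p.+1 * (p.+1`!%:R * expR (x - be * c) + be ^+ p.+1 * c ^+ p.+1).
Proof.
move=> x0 c0 be0; rewrite -exprMn mulrDr.
have h1 : 0 <= 2 ^+ p.+1 * (p.+1`!%:R * expR (x - be * c)).
  by rewrite !mulr_ge0 ?exprn_ge0// expR_ge0.
have bc : 0 <= be * c by rewrite mulr_ge0.
have h2 : 0 <= 2 ^+ p.+1 * (be * c) ^+ p.+1 by rewrite mulr_ge0 ?exprn_ge0.
have [xc|xc] := leP x (2 * (be * c)).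
  apply: (@le_trans _ _ (2 ^+ p.+1 * (be * c) ^+ p.+1)); last by rewrite lerDr.
  by rewrite -exprMn lerXn2r ?nnegrE//; lra.
apply: (@le_trans _ _ (2 ^+ p.+1 * (p.+1`!%:R * expR (x - be * c)))); last by rewrite lerDl.
have d0 : 0 <= x - be * c by lra.
apply: (@le_trans _ _ (2 ^+ p.+1 * (x - be * c) ^+ p.+1)).
  by rewrite -exprMn lerXn2r ?nnegrE//; lra.
rewrite ler_wpM2l ?exprn_ge0//.
have := expR_ge1Dxn p d0; rewrite -ler_pdivrMl ?ltr0n ?fact_gt0//.
rewrite mulrC; apply: le_trans; rewrite lerDr//.
Qed.

(** By the power mean inequality with weights [1 / k ^+ 2], of total mass at
    most [1 / (m - i)], it suffices to bound the moments of the martingale,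
    which increase with time. *)
Lemma qsum_moment (m i p : nat) : (i < m)%N ->
  hist_mean m i (fun s => qsum m s ^+ p.+1) <=
  hist_mean m i (fun s => quad_mart_hist m s ^+ p.+1) / (m - i)%:R ^+ p.+1.
Proof.
move=> im; set H := hist_mean m i (fun s => quad_mart_hist m s ^+ p.+1).
pose w (j : nat) : R := ((m - j)%:R ^+ 2)^-1.
have w0 j : 0 <= w j by rewrite invr_ge0 exprn_ge0.
have W : \sum_(j < i) w j <= (m - i)%:R^-1 by exact: sum_inv_sqr.
have W0 : 0 <= \sum_(j < i) w j by exact: sumr_ge0.
have H0 : 0 <= H.
  by apply: hist_mean_ge0 => [|s _]; [exact: ltnW|rewrite exprn_ge0// quad_mart_hist_ge0].
pose F j s : R := w j * quad_mart_hist m (past j s) ^+ p.+1.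
apply: (@le_trans _ _ (hist_mean m i (fun s => (\sum_(j < i) w j) ^+ p * \sum_(j < i) F j s))).
  apply: hist_mean_le => [|s si]; first exact: ltnW.
  apply: le_trans (power_mean _ (fun j : 'I_i => w0 j) (fun j : 'I_i => quad_mart_hist_ge0 R m (past j s))).
  rewrite lerXn2r ?nnegrE//.
  - apply: sumr_ge0 => j _; rewrite /next_hit_prob.
    have js : (j < i)%N by rewrite -si.
    by have /andP[] := @hit_prob_bounds R (m - size (past j s)) (ptrs (past j s)) ltac:(rewrite size_past; lia).
  - by apply: sumr_ge0 => j _; rewrite mulr_ge0// quad_mart_hist_ge0.
  - rewrite /past_sum si; apply: ler_sum => j _.
    have ji := ltn_ord j.
    have sj : size (past j s) = j by rewrite size_past// si ltnW.
    rewrite mulrC /next_hit_prob /quad_mart_hist /w sj; apply: hit_prob_le; lia.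
rewrite hist_meanZ (hist_mean_sum _ _ _ F) exprSr invfM mulrA mulrC.
have FE : \sum_(j < i) hist_mean m i (F j) <= (\sum_(j < i) w j) * H.
  rewrite mulr_suml; apply: ler_sum => j _; rewrite /F hist_meanZ ler_wpM2l//.
  rewrite (hist_mean_past m (fun s => quad_mart_hist m s ^+ p.+1)); last exact: ltnW.
  by apply: hist_mean_quad_mart_hist_pow_le => //; exact: ltnW.
apply: (@le_trans _ _ ((\sum_(j < i) w j) * H * (\sum_(j < i) w j) ^+ p)).
  by rewrite ler_wpM2r// exprn_ge0.
rewrite [X in X <= _](_ : _ = H * ((\sum_(j < i) w j) ^+ p * (\sum_(j < i) w j))); last by ring.
rewrite -exprSr [X in _ <= X](_ : _ = H * ((m - i)%:R^-1) ^+ p.+1).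
  by rewrite ler_wpM2l// lerXn2r// nnegrE invr_ge0.
by rewrite exprSr exprVn; ring.
Qed.

(** Writing [r] for the integer square root of [m.+1], the levels are [m - i = r
    / a] and [m - iK = r * a]: the first is small and the second large compared
    with [sqrt m], both by a constant factor. *)
Lemma two_levels (a k1 : nat) : (0 < a)%N -> exists N, forall m, (N <= m)%N ->
  exists i iK, [/\ (iK <= i < m)%N, (k1 <= m - i)%N,
    [/\ m.+1 <= 16 * a ^ 2 * (m - i) ^ 2,
    (m - i) ^ 2 <= 16 * a ^ 2 * m.+1,
    m.+1 <= 16 * a ^ 2 * (m - iK) ^ 2 &
    (m - iK) ^ 2 <= 16 * a ^ 2 * m.+1]%N,
    (a ^ 2 * (m - i) ^ 2 <= m.+1)%N & (a ^ 2 * m.+1 <= 4 * (m - iK) ^ 2)%N].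
Proof.
move=> a0; exists (((k1 + 2) * a + a + 2) ^ 2)%N => m Nm.
have [r /andP[r1 r2]] : exists r, (r ^ 2 <= m.+1 < r.+1 ^ 2)%N.
  elim: (m.+1) => [|n [r /andP[h1 h2]]]; first by exists 0%N.
  have [h|h] := ltnP n.+1 (r.+1 ^ 2)%N; first by exists r; rewrite h andbT (leq_trans h1).
  exists r.+1; rewrite h /=; by apply: leq_ltn_trans h2 _; rewrite ltn_exp2r.
(* The threshold on [m] is chosen so that [r / a] exceeds [k1 + 2] and [r * a]
   stays below [m]. *)
have rN : ((k1 + 2) * a + a + 2 <= r)%N.
  rewrite leqNgt; apply/negP => h.
  have : (r.+1 ^ 2 <= ((k1 + 2) * a + a + 2) ^ 2)%N by rewrite leq_exp2r.
  by move=> h'; have := leq_trans (leq_trans r2 h') Nm; rewrite ltnNge leqnSn.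
set k := (r %/ a)%N; set K := (r * a)%N.
have kr : (k * a <= r)%N by exact: leq_divM.
have rk : (r < k.+1 * a)%N by exact: ltn_ceil.
have k2 : (k1 + 2 <= k)%N by rewrite leq_divRL//; lia.
have ra : (a + 2 <= r)%N by apply: leq_trans rN; rewrite -addnA leq_addl.
have Km : (K < m)%N.
  have : (r * (a + 2) <= r ^ 2)%N by rewrite -mulnn leq_mul.
  by rewrite mulnDr -/K; lia.
have kK : (k <= K)%N by apply: leq_trans (leq_div _ _) _; rewrite leq_pmulr.
have r4 : (m.+1 <= 4 * r ^ 2)%N by 
  apply: leq_trans (ltnW r2) _; rewrite -(expnMn 2 r 2) leq_exp2r//; lia.
have rk2 : (r <= 2 * a * k)%N.
  apply: leq_trans (ltnW rk) _; rewrite mulnAC leq_mul2r; apply/orP; right.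
  by apply: (@leq_trans (k + k)); [rewrite -addn1 leq_add2l (leq_trans _ k2)// addn2|rewrite mul2n addnn].
have ri2 : (r ^ 2 <= (2 * a * k) ^ 2)%N by rewrite leq_exp2r.
have kr2 : ((k * a) ^ 2 <= r ^ 2)%N by rewrite leq_exp2r.
(* From here on everything is linear in the squares of [a], [k] and [r]. *)
exists (m - k)%N, (m - K)%N; rewrite !subKn//; [|exact: ltnW|exact: leq_trans kK (ltnW Km)].
have A1 : (1 <= a ^ 2)%N by rewrite expn_gt0 a0.
rewrite !expnMn in ri2 kr2; rewrite /K !expnMn.
move: (a ^ 2)%N (k ^ 2)%N (r ^ 2)%N A1 r1 r4 ri2 kr2 => A k' r' A1 r1 r4 ri2 kr2.
have Akk : (k' <= k' * A)%N by rewrite leq_pmulr.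
have rA : (r' <= r' * A)%N by rewrite leq_pmulr.
have rAA : (r' * A <= A * (r' * A))%N by rewrite leq_pmull.
have mA : (m.+1 <= A * m.+1)%N by rewrite leq_pmull.
have rmA : (r' * A <= A * m.+1)%N by rewrite mulnC leq_mul.
split; [apply/andP; split; lia|lia| | |].
- split.
  + by apply: leq_trans r4 _; lia.
  + by lia.
  + by lia.
  + by lia.
- by lia.
- have : (A * m.+1 <= A * (4 * r'))%N by rewrite leq_mul.
  by lia.
Qed.

End VisitMoments.

(** * Moment bounds and reduction to one level *)

Section Final.
Variable R : realType.
Notation hist_mean := (@hist_mean R).
Notation quad_mart_hist := (@quad_mart_hist R).

Lemma quad_mart_hist_moment (b c : nat) : exists2 C : R, 0 <= C & exists k1,
  forall m i, (i < m)%N -> (k1 <= m - i)%N ->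
    (m.+1 <= b * (m - i) ^ 2)%N -> ((m - i) ^ 2 <= b * m.+1)%N ->
    `|hist_mean m i (fun s => quad_mart_hist m s ^+ c) - (c.+1)`!%:R * m.+1%:R ^+ c|
      * (m - i)%:R <= C * m.+1%:R ^+ c.
Proof.
have [C C0 [k1 h]] := hist_mean_quad_mart_moment R b c; exists C => //; exists k1 => m i im kk nb bn.
have := h m i im kk nb bn.
have -> : hist_mean m i (fun s => quad_mart R (m - i) (ptrs s) ^+ c) = hist_mean m i (fun s => quad_mart_hist m s ^+ c).
  by apply: eq_hist_mean => s si; rewrite /quad_mart_hist si.
by [].
Qed.

Lemma visits_drop j s : (visits s <= visits (drop j s) + j)%N.
Proof.
rewrite /visits -{1}(cat_take_drop j s) count_cat addnC leq_add2l.
by apply: leq_trans (count_size _ _) _; rewrite size_take_min geq_minl.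
Qed.

Lemma visits_drop_ge j s : (visits (drop j s) <= visits s)%N.
Proof. by rewrite /visits -{2}(cat_take_drop j s) count_cat leq_addl. Qed.

Lemma pow_add_le (x y : R) p : 0 <= x -> 0 <= y ->
  (x + y) ^+ p <= 2 ^+ p * (x ^+ p + y ^+ p).
Proof.
move=> x0 y0; wlog xy : x y x0 y0 / x <= y => [h|].
  have [xy|/ltW xy] := leP x y; first exact: h.
  by rewrite addrC [x ^+ p + _]addrC; exact: h.
apply: (@le_trans _ _ ((2 * y) ^+ p)).
  by rewrite lerXn2r ?nnegrE ?addr_ge0 ?mulr_ge0//; lra.
by rewrite exprMn ler_wpM2l ?exprn_ge0// lerDr exprn_ge0.
Qed.

(** Stop at a level [m - i] of order [sqrt m]. Up to there, [pow_le_expR]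
    compares the visits with their compensator, whose moments come from those of
    the martingale; the remaining [m - i] vertices contribute at most [m - i]. *)
Lemma visits_moment_bound (q : nat) : exists2 C : R, 0 <= C & exists N,
  forall m, (N <= m)%N ->
    hist_mean m m (fun s => (visits s).+1%:R ^+ (2 * q.+1)) <= C * m.+1%:R ^+ q.+1.
Proof.
have [C C0 [k1 hC]] := quad_mart_hist_moment 16 (2 * q.+1).
have [N hN] := two_levels (maxn k1 1) (ltn0Sn 0).
set P := (2 * q.+1)%N in hC *.
set D := C + (P.+1)`!%:R.
have D0 : 0 <= D by rewrite addr_ge0.
set be := expR 1 - 1 : R.
have be0 : 0 <= be by rewrite subr_ge0; apply: le_trans (expR_ge1Dx _); rewrite lerDl.
exists (2 ^+ P * (4 ^+ q.+1 + 2 ^+ P * (P`!%:R + be ^+ P * (D * 16 ^+ q.+1)))).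
  by repeat first [exact: D0|exact: be0|exact: ler0n|apply: exprn_ge0|apply: mulr_ge0|apply: addr_ge0].
exists N => m /hN [i [iK [/andP[_ im]]]].
rewrite geq_max => /andP[kk k0] [nb bn _ _] b2 _ {iK}.
rewrite exp1n !muln1 mul1n in nb bn b2.
have k0p : 0 < (m - i)%:R :> R by rewrite ltr0n.
set n := m.+1%:R : R.
have n1 : 1 <= n by rewrite ler1n.
have n0 : 0 <= n by [].
have kn : (m - i)%:R ^+ 2 <= n by rewrite -natrX ler_nat.
have nk : n <= 16 * (m - i)%:R ^+ 2 by rewrite -natrX -natrM ler_nat.
have PE : P = (2 * q).+2 by rewrite /P mulnS.
(* Here the level has order [sqrt m], so the error term of the moment is of the
   order of the moment itself. *)
have HM : hist_mean m i (fun s => quad_mart_hist m s ^+ P) <= D * n ^+ P.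
  have := hC m i im kk nb bn; set H := hist_mean m i _ => h.
  have {}h : `|H - (P.+1)`!%:R * n ^+ P| <= C * n ^+ P.
    by apply: le_trans h; rewrite ler_peMr// ler1n.
  by have := ler_normlW h; rewrite /D mulrDl; lra.
have HQ : hist_mean m i (fun s => (visits s)%:R ^+ P) <= 2 ^+ P * (P`!%:R + be ^+ P * (D * 16 ^+ q.+1)) * n ^+ q.+1.
  apply: (@le_trans _ _ (hist_mean m i (fun s => 2 ^+ P * (P`!%:R * expR ((visits s)%:R - be * past_sum (fun _ => next_hit_prob R m) s) + be ^+ P * past_sum (fun _ => next_hit_prob R m) s ^+ P)))).
    apply: hist_mean_le => [|s si]; first exact: ltnW.
    rewrite PE; apply: pow_le_expR => //.
    apply: sumr_ge0 => j _; have js : (j < i)%N by rewrite -si.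
    have kj : (0 < m - size (past j s))%N.
      by rewrite subn_gt0 size_past; [exact: ltn_trans im|exact: ltnW].
    by have /andP[] := @hit_prob_bounds R (m - size (past j s)) (ptrs (past j s)) kj.
  rewrite hist_meanZ hist_meanD !hist_meanZ -mulrA ler_wpM2l ?exprn_ge0// mulrDl; apply: lerD.
    rewrite ler_wpM2l//; apply: le_trans (hist_mean_expR R (ltnW im)) _.
    by rewrite exprn_ege1.
  rewrite -mulrA ler_wpM2l ?exprn_ge0//.
  have := qsum_moment R (2 * q).+1 im; rewrite -PE => /le_trans; apply.
  rewrite ler_pdivrMr ?exprn_gt0//; apply: le_trans HM _.
  rewrite -!mulrA ler_wpM2l// /P !exprM -!exprMn.
  rewrite lerXn2r ?nnegrE ?mulr_ge0 ?exprn_ge0//.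
  by rewrite mulrCA expr2 ler_wpM2l.
have -> : hist_mean m m (fun s => (visits s).+1%:R ^+ P) =
   hist_mean m (i + (m - i)) (fun s => (visits s).+1%:R ^+ P) by rewrite subnKC// ltnW.
apply: (@le_trans _ _ (hist_mean m (i + (m - i)) (fun s => (fun t => 2 ^+ P * (((m - i).+1%:R) ^+ P + (visits t)%:R ^+ P)) (drop (m - i) s)))).
  apply: hist_mean_le => [|s _]; first by rewrite subnKC// ltnW.
  apply: le_trans _ (pow_add_le _ _ _) => //.
  rewrite lerXn2r ?nnegrE ?addr_ge0// -natrD ler_nat.
  by rewrite addSn ltnS addnC visits_drop.
rewrite (hist_mean_drop m i (m - i) (fun t => 2 ^+ P * (((m - i).+1%:R) ^+ P + (visits t)%:R ^+ P))).
rewrite hist_meanZ hist_meanD hist_mean_cst -mulrA ler_wpM2l ?exprn_ge0// mulrDl; apply: lerD => //.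
rewrite /P exprM -exprMn lerXn2r ?nnegrE ?exprn_ge0 ?mulr_ge0//.
have k1' : 1 <= (m - i)%:R :> R by rewrite ler1n.
rewrite -natr1; apply: (@le_trans _ _ (4 * (m - i)%:R ^+ 2)); last by rewrite ler_wpM2l.
by nra.
Qed.

(** Every error term of [visits_approx] is at most a small multiple of [sqrt m]
    or a constant, once the ratio [a] of the levels to [sqrt m] is large and [m]
    is large given [a]. *)
Lemma main_approx (ep : R) : 0 < ep -> exists b, forall k1, exists N,
  forall m, (N <= m)%N -> exists i,
   [/\ (i < m)%N, (k1 <= m - i)%N, (m.+1 <= b * (m - i) ^ 2)%N,
       ((m - i) ^ 2 <= b * m.+1)%N &
       hist_mean m i (fun s => `|(visits s)%:R - pi / 2 * Num.sqrt (quad_mart_hist m s)|)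
       + (m - i).+1%:R <= ep * Num.sqrt m.+1%:R].
Proof.
move=> ep0.
(* With this ratio the tail [4 * s / A] and the level [s / A] are small against
   [ep * s]. *)
set a := (Num.truncn (80 / ep)).+1.
have a0 : (0 < a)%N by [].
pose A : R := a%:R.
have ap : 0 < A by rewrite ltr0n.
have aep : 80 / A <= ep.
  rewrite ler_pdivrMr// mulrC -ler_pdivrMr// ltW//; exact: truncnS_gt.
exists (16 * a ^ 2)%N => k1.
have [C C0 [k2 hC]] := quad_mart_hist_moment (16 * a ^ 2) 2.
have [N hN] := two_levels (maxn (maxn k1 k2) 1) a0.
set la := ep / (16 * A).
have la0 : 0 < la by rewrite divr_gt0 ?mulr_gt0.
(* [c0] gathers the error terms that stay bounded when [m] grows. *)
set c0 := 16 * A / ep + 32 * A ^+ 2 + 16 * A ^+ 2 * C / la + 4.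
set B := c0 * 4 / ep.
have [N2 hN2] : exists N2, forall m, (N2 <= m)%N -> B <= Num.sqrt m.+1%:R.
  exists (Num.truncn (B ^+ 2)).+1 => m Nm.
  apply: le_trans (ler_norm _) _; rewrite -sqrtr_sqr ler_sqrt ?ler0n//.
  apply: ltW; apply: lt_le_trans (truncnS_gt _) _.
  by rewrite ler_nat (leq_trans Nm).
exists (maxn N N2) => m; rewrite geq_max => /andP[Nm N2m].
have [i [iK [/andP[iKi im]]]] := hN m Nm.
rewrite !geq_max -andbA => /and3P[kk1 kk2 k0] [nb bn nbK bnK] aK aKK.
exists i; split => //.
set n := m.+1%:R : R; set s := Num.sqrt n.
have n0 : 0 < n by rewrite ltr0n.
have s0 : 0 < s by rewrite sqrtr_gt0.
have ns : n = s ^+ 2 by rewrite sqr_sqrtr// ltW.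
have Bs : B <= s := hN2 m N2m.
set k := (m - i)%:R : R; set K := (m - iK)%:R : R.
have kp : 0 < k by rewrite ltr0n.
have iKm : (iK < m)%N by exact: leq_ltn_trans im.
have Kp : 0 < K by rewrite ltr0n subn_gt0.
have sk : s <= 4 * A * k.
  rewrite -(@ler_pXn2r _ 2) ?nnegrE ?mulr_ge0 ?(ltW s0) ?(ltW kp)// -ns.
  rewrite (_ : (4 * A * k) ^+ 2 = (16 * a ^ 2 * (m - i) ^ 2)%N%:R); first by rewrite ler_nat.
  by rewrite natrM [X in _ = X * _]natrM !natrX -/k -/A; ring.
have ks : A * k <= s.
  rewrite -(@ler_pXn2r _ 2) ?nnegrE ?mulr_ge0 ?(ltW s0) ?(ltW kp)// -ns.
  by rewrite exprMn /A /k -!natrX -natrM ler_nat.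
have sK : A * s <= 2 * K.
  rewrite -(@ler_pXn2r _ 2) ?nnegrE ?mulr_ge0 ?(ltW s0) ?(ltW Kp)// exprMn -ns exprMn.
  by rewrite /A /K -!natrX -!natrM ler_nat.
have kK : k <= K by rewrite ler_nat leq_sub2l.
set V := hist_mean m i (fun s => quad_mart_hist m s ^+ 2) - hist_mean m iK (fun s => quad_mart_hist m s ^+ 2).
(* The second moments at both levels are [3! * n ^+ 2] up to [O(n ^+ 2 / k)],
   so their leading terms cancel in [V]. *)
have Vk : V * k <= 2 * C * n ^+ 2.
  have h1 := hC m i im kk2 nb bn; have h2 := hC m iK iKm _ nbK bnK.
  have {}h2 := h2 (leq_trans kk2 (leq_sub2l _ iKi)).
  move: h1 h2; rewrite -/k -/K -/n; set H1 := hist_mean m i _; set H2 := hist_mean m iK _ => h1 h2.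
  have {}h2 : `|H2 - 3`!%:R * n ^+ 2| * k <= C * n ^+ 2.
    by apply: le_trans h2; rewrite ler_wpM2l.
  have VE : V <= `|H1 - 3`!%:R * n ^+ 2| + `|H2 - 3`!%:R * n ^+ 2|.
    apply: le_trans (ler_norm _) _; rewrite [X in _ <= _ + X]distrC.
    exact: ler_distD.
  apply: (@le_trans _ _ ((`|H1 - 3`!%:R * n ^+ 2| + `|H2 - 3`!%:R * n ^+ 2|) * k)).
    by rewrite ler_wpM2r// ltW.
  by rewrite mulrDl; lra.
have eE : (2 * m + 1)%:R <= 2 * s ^+ 2 :> R.
  by rewrite -ns -natrM ler_nat mulnS addnC leq_add2r.
set e := (2 * m + 1)%:R : R in eE *.
have be0 : 0 < ep / 4 * s by rewrite mulr_gt0// divr_gt0.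
have la1 : 0 < la * s ^+ 2 by rewrite mulr_gt0// exprn_gt0.
have := visits_approx im iKi be0 la1 (erefl V) (erefl k) (erefl e).
have e0 : 0 <= e by [].
set X := hist_mean m i _ => hX.
have u4 : s / k <= 4 * A by rewrite ler_pdivrMr.
have u0 : 0 <= s / k by rewrite divr_ge0 ?(ltW s0) ?(ltW kp).
have u2 : (s / k) ^+ 2 <= 16 * A ^+ 2.
  rewrite (_ : 16 * A ^+ 2 = (4 * A) ^+ 2); last by ring.
  by rewrite lerXn2r ?nnegrE ?u0 ?mulr_ge0 ?(ltW ap)//.
have t1 : e / k / (ep / 4 * s) <= 32 * A / ep.
  rewrite (_ : e / k / (ep / 4 * s) = (4 / ep) * (e / k / s)); last first.
    by field; rewrite !gt_eqF.
  rewrite (_ : 32 * A / ep = (4 / ep) * (8 * A)); last by field; rewrite gt_eqF.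
  rewrite ler_pM2l ?divr_gt0// ler_pdivrMr// ler_pdivrMr//.
  apply: le_trans eE _; apply: (@le_trans _ _ (2 * s * (4 * A * k))).
    by rewrite expr2 mulrA ler_pM2l ?mulr_gt0.
  by rewrite le_eqVlt; apply/orP; left; apply/eqP; ring.
have t2 : e / k ^+ 2 <= 32 * A ^+ 2.
  apply: (@le_trans _ _ (2 * (s / k) ^+ 2)); last by lra.
  by rewrite expr_div_n mulrA ler_pM2r// invr_gt0 exprn_gt0.
have t3 : la * s ^+ 2 / k <= ep / 4 * s.
  rewrite (_ : la * s ^+ 2 / k = la * s * (s / k)); last by field; rewrite gt_eqF.
  rewrite (_ : ep / 4 * s = la * s * (4 * A)); last by rewrite /la; field; rewrite gt_eqF.
  by have las : 0 < la * s := mulr_gt0 la0 s0; rewrite ler_pM2l.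
have t4 : V / (la * s ^+ 2) / k <= 32 * A ^+ 2 * C / la.
  have V2 : V <= 2 * C * n ^+ 2 / k by rewrite ler_pdivlMr.
  apply: (@le_trans _ _ (2 * C * n ^+ 2 / k / (la * s ^+ 2) / k)).
    by rewrite ler_pM2r ?invr_gt0// ler_pM2r ?invr_gt0.
  rewrite ns (_ : 2 * C * _ / k / _ / k = 2 * C / la * (s / k) ^+ 2); last first.
    by field; rewrite !gt_eqF.
  rewrite (_ : 32 * _ * C / la = 2 * C / la * (16 * A ^+ 2)); last by field; rewrite gt_eqF.
  by rewrite ler_wpM2l// divr_ge0 ?(ltW la0)// mulr_ge0.
have t5 : e / K <= 4 * s / A.
  rewrite ler_pdivrMr//; apply: le_trans eE _.
  rewrite mulrAC ler_pdivlMr//.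
  have : 2 * s * (A * s) <= 2 * s * (2 * K) by rewrite ler_pM2l ?mulr_gt0.
  by rewrite expr2; lra.
have t6 : k <= s / A by rewrite ler_pdivlMr// mulrC.
have t7 : s / A <= ep / 80 * s.
  rewrite mulrC ler_pM2r//; lra.
have t8 : c0 <= ep / 4 * s.
  have : B * (ep / 4) <= s * (ep / 4) by rewrite ler_pM2r ?divr_gt0.
  have -> : B * (ep / 4) = c0 by rewrite /B; field; rewrite gt_eqF.
  by rewrite mulrC.
rewrite -natr1 -/k.
rewrite (_ : (ep / 4 * s + e / k / (ep / 4 * s)) / 2 = ep / 4 * s / 2 + e / k / (ep / 4 * s) / 2) in hX; last by rewrite mulrDl.
rewrite (_ : (la * s ^+ 2 + V / (la * s ^+ 2)) / 2 / k = (la * s ^+ 2 / k) / 2 + (V / (la * s ^+ 2) / k) / 2) in hX; last by ring.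
rewrite (_ : 2 * e / K = 2 * (e / K)) in hX; last by rewrite mulrA.
have t1' : 32 * A / ep = 2 * (16 * A / ep) by ring.
have t4' : 32 * A ^+ 2 * C / la = 2 * (16 * A ^+ 2 * C / la) by ring.
have t5' : 4 * s / A = 4 * (s / A) by ring.
rewrite t1' in t1; rewrite t4' in t4; rewrite t5' in t5.
rewrite /c0 in t8.
move: (e / k / (ep / 4 * s)) (e / k ^+ 2) (la * s ^+ 2 / k) (V / (la * s ^+ 2) / k) (e / K) (s / A)
  (16 * A / ep) (32 * A ^+ 2) (16 * A ^+ 2 * C / la) t1 t2 t3 t4 t5 t6 t7 t8 hX => x1 x2 x3 x4 x5 x6 x7 x8 x9.
rewrite (_ : ep / 4 * s / 2 = (ep * s) / 8); last by field.
rewrite (_ : ep / 4 * s = (ep * s) / 4); last by field.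
rewrite (_ : ep / 80 * s = (ep * s) / 80); last by field.
have : 0 < ep * s by rewrite mulr_gt0.
move: (ep * s) => x10 *; lra.
Qed.

End Final.

Local Open Scope classical_set_scope.
Local Open Scope ring_scope.

(** * Taylor bounds for the cosine *)

Section DeriveFun.
Variable R : realType.
Implicit Types (f g : R -> R) (x a df dg : R).

Lemma is_derive_pow n x : is_derive x 1 (fun y : R => y ^+ n.+1) (n.+1%:R * x ^+ n).
Proof.
apply: DeriveDef; first exact: exprn_derivable.
by rewrite exp_derive /= /GRing.scale /= mulr1.
Qed.

Lemma is_derive_scale f df a x :
  is_derive x 1 f df -> is_derive x 1 (fun y => a * f y) (a * df).
Proof. by move=> h; exact: (is_deriveZ a h). Qed.

Lemma is_derive_add f g df dg x :
  is_derive x 1 f df -> is_derive x 1 g dg ->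
  is_derive x 1 (fun y => f y + g y) (df + dg).
Proof. by move=> h1 h2; exact: (is_deriveD h1 h2). Qed.

Lemma is_derive_sumf n (F : nat -> R -> R) (dF : nat -> R) x :
  (forall i, is_derive x 1 (F i) (dF i)) ->
  is_derive x 1 (fun y => \sum_(i < n) F i y) (\sum_(i < n) dF i).
Proof.
move=> h; elim: n => [|n IH].
  rewrite big_ord0 (_ : (fun _ => _) = cst 0); first exact: is_derive_cst.
  by apply/funext => y; rewrite big_ord0.
rewrite big_ord_recr /= (_ : (fun _ => _) = (fun y => \sum_(i < n) F i y + F n y)).
  exact: is_derive_add.
by apply/funext => y; rewrite big_ord_recr.
Qed.

Lemma MVT_all f (f' : R -> R) (a b : R) : a < b ->
  (forall x, is_derive x 1 f (f' x)) ->
  exists2 c, a < c < b & f b - f a = f' c * (b - a).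
Proof.
move=> ab h; have [c] := @MVT R f f' a b ab (fun x _ => h x)
  (derivable_within_continuous (fun x _ => @ex_derive _ _ _ _ _ _ _ (h x))).
by rewrite in_itv/= => abc e; exists c.
Qed.

End DeriveFun.

Section CosTaylor.
Variable R : realType.
Implicit Types x : R.

Lemma fact_ratio n : (n`!%:R)^-1 = n.+1%:R * (n.+1`!%:R)^-1 :> R.
Proof. by rewrite factS natrM invfM mulVKf// pnatr_eq0. Qed.

(** Integration of a bound on the derivative, in the form of monotonicity of [x
    ^+ p.+1 / p.+1`! -+ f]. *)
Lemma norm_le_of_derive (f df : R -> R) p :
  (forall x, is_derive x 1 f (df x)) -> f 0 = 0 ->
  (forall x, 0 <= x -> `|df x| <= x ^+ p / p`!%:R) ->
  forall x, 0 <= x -> `|f x| <= x ^+ p.+1 / p.+1`!%:R.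
Proof.
move=> hf f0 hdf x; rewrite le_eqVlt => /orP[/eqP <-|x0].
  by rewrite f0 normr0 expr0n mul0r.
have mono (s : R) : s = 1 \/ s = -1 -> s * f x <= x ^+ p.+1 / p.+1`!%:R.
  move=> sE; pose g (y : R) := p.+1`!%:R^-1 * y ^+ p.+1 + - s * f y.
  have hg (y : R) : is_derive y 1 g (y ^+ p / p`!%:R - s * df y).
    have := is_derive_add (is_derive_scale p.+1`!%:R^-1 (is_derive_pow p y)) (is_derive_scale (- s) (hf y)).
    move=> /is_derive_eq; apply; rewrite (fact_ratio p) mulNr; congr (_ - _).
    by ring.
  have [c /andP[c0 cx]] := MVT_all x0 hg.
  rewrite /g f0 expr0n !mulr0 addr0 !subr0 => e.
  rewrite -subr_ge0 mulrC -mulNr e mulr_ge0 ?(ltW x0)// subr_ge0.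
  apply: le_trans (hdf c (ltW c0)); case: sE => ->.
    by rewrite mul1r ler_norm.
  by rewrite mulN1r -normrN ler_norm.
rewrite ler_norml; apply/andP; split; last by rewrite -[f x]mul1r; apply: mono; left.
by rewrite lerNl -mulN1r; apply: mono; right.
Qed.

Definition cos_poly K x : R := \sum_(c < K) (-1) ^+ c / (2 * c)`!%:R * x ^+ (2 * c).
Definition sin_poly K x : R := \sum_(c < K) (-1) ^+ c / (2 * c).+1`!%:R * x ^+ (2 * c).+1.

Lemma is_derive_sin_poly K x : is_derive x 1 (sin_poly K) (cos_poly K x).
Proof.
have := is_derive_sumf K (fun c => is_derive_scale ((-1) ^+ c / (2 * c).+1`!%:R) (is_derive_pow (2 * c) x)).
move=> /is_derive_eq; apply; apply: eq_bigr => c _.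
by rewrite (fact_ratio (2 * c)); ring.
Qed.

Lemma is_derive_cos_poly K x : is_derive x 1 (cos_poly K.+1) (- sin_poly K x).
Proof.
rewrite (_ : cos_poly K.+1 = (fun y : R => 1 + \sum_(c < K) (-1) ^+ c.+1 / (2 * c).+2`!%:R * y ^+ (2 * c).+2)); last first.
  apply/funext => y; rewrite /cos_poly big_ord_recl muln0 fact0 !expr0 divr1 mulr1.
  by congr (_ + _); apply: eq_bigr => c _; rewrite /= /bump leq0n add1n mulnS.
have h := is_derive_sumf K (fun c => is_derive_scale ((-1) ^+ c.+1 / (2 * c).+2`!%:R) (is_derive_pow (2 * c).+1 x)).
have := is_derive_add (is_derive_cst (1 : R) x 1) h.
move=> /is_derive_eq; apply; rewrite add0r -sumrN; apply: eq_bigr => c _.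
by rewrite (fact_ratio (2 * c).+1) exprS; ring.
Qed.

(** The two bounds are proved together by induction, integrating one into the
    other; it is essential that the error is at most the first omitted term. *)
Lemma cos_sin_taylor K x : 0 <= x ->
  `|cos x - cos_poly K x| <= x ^+ (2 * K) / (2 * K)`!%:R /\
  `|sin x - sin_poly K x| <= x ^+ (2 * K).+1 / (2 * K).+1`!%:R.
Proof.
have sin_of_cos k : (forall x, 0 <= x -> `|cos x - cos_poly k x| <= x ^+ (2 * k) / (2 * k)`!%:R) ->
    forall x, 0 <= x -> `|sin x - sin_poly k x| <= x ^+ (2 * k).+1 / (2 * k).+1`!%:R.
  move=> hc; apply: (norm_le_of_derive (df := fun y => cos y - cos_poly k y)) => //.
    by move=> y; have := is_deriveB (is_derive_sin y) (is_derive_sin_poly k y).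
  rewrite sin0 sub0r /sin_poly big1 ?oppr0// => c _.
  by rewrite expr0n mulr0.
have cosK : forall x, 0 <= x -> `|cos x - cos_poly K x| <= x ^+ (2 * K) / (2 * K)`!%:R.
  elim: K => [|K IH] {}x x0.
    by rewrite /cos_poly big_ord0 subr0 muln0 expr0 fact0 divr1 cos_max.
  rewrite mulnS; apply: (norm_le_of_derive (f := fun y => cos y - cos_poly K.+1 y)
     (df := fun y => - (sin y - sin_poly K y))) => //.
  - move=> y; have := is_deriveB (is_derive_cos y) (is_derive_cos_poly K y).
    by move=> /is_derive_eq; apply; ring.
  - rewrite cos0 /cos_poly big_ord_recl big1 ?addr0; first by rewrite muln0 fact0 !expr0 divr1 mulr1 subrr.
    by move=> c _; rewrite /= /bump leq0n add1n mulnS expr0n mulr0.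
  - by move=> y y0; rewrite normrN; apply: sin_of_cos.
by move=> x0; split; [exact: cosK|exact: sin_of_cos].
Qed.

Lemma cos_taylor K x : 0 <= x ->
  `|cos x - cos_poly K x| <= x ^+ (2 * K) / (2 * K)`!%:R.
Proof. by move=> /(cos_sin_taylor K)[]. Qed.

Lemma cos_lip (x y : R) : `|cos x - cos y| <= `|x - y|.
Proof.
wlog xy : x y / x < y => [h|].
  have [/h//|yx|->] := ltgtP x y; last by rewrite !subrr.
  by rewrite distrC [ `|x - y|]distrC; apply: h.
have [c _ e] := MVT_all xy (fun z => @is_derive_cos R z).
rewrite distrC e normrM normrN [ `|x - y|]distrC ler_piMl//.
exact: sin_max.
Qed.

End CosTaylor.

(** * Uniform approximation by polynomials in the cosine *)

Section CosBernstein.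
Variable R : realType.
Implicit Types x y : R.

(** Heine's theorem; only [x] is required to lie in the segment. *)
Lemma segment_unif_cont (g : R -> R) (a b ep : R) : continuous g -> 0 < ep ->
  exists2 d : R, 0 < d & forall x y, a <= x <= b -> `|x - y| < d -> `|g x - g y| <= ep.
Proof.
move=> cg ep0.
have ep2 : 0 < ep / 2 by rewrite divr_gt0.
have /compact_near_coveringP ncov := @segment_compact R a b.
have H : \forall d \near (0 : R)^'+, `[a, b] `<=`
    (fun x => forall y, `|x - y| < d -> `|g x - g y| <= ep).
  apply: (ncov R _ (fun d x => forall y, `|x - y| < d -> `|g x - g y| <= ep)) => x _.
  have /cvgrPdist_le /(_ _ ep2) /nbhs_ballP [r /= r0 hr] := cg x.
  have r2 : 0 < r / 2 by rewrite divr_gt0.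
  exists (ball x (r / 2), [set d | d < r / 2]) => /=.
    by split; [exact: nbhsx_ballx|exact: nbhs_right_lt].
  move=> [x' d] [/= xx' dr] y xy.
  have h1 : `|g x - g x'| <= ep / 2.
    by apply: hr; apply: le_ball xx'; lra.
  have h2 : `|g x - g y| <= ep / 2.
    apply: hr; rewrite -ball_normE /= in xx' *.
    rewrite (_ : x - y = (x - x') + (x' - y)); last by ring.
    by apply: le_lt_trans (ler_normD _ _) _; lra.
  rewrite (_ : g x' - g y = - (g x - g x') + (g x - g y)); last by ring.
  by apply: le_trans (ler_normD _ _) _; rewrite normrN; lra.
have [d [hd d0]] := filter_ex (filterI H (nbhs_right_gt (0 : R))).
by exists d => // x y xab; apply: hd; rewrite /= in_itv.
Qed.

(** The increment of the cosine over a gap [d] attains a positive minimum by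
    compactness, and widening the gap only increases it. *)
Lemma cos_gap (d : R) : 0 < d -> exists2 e : R, 0 < e &
  forall x y, 0 <= x <= pi -> 0 <= y <= pi -> d <= `|x - y| -> e <= `|cos x - cos y|.
Proof.
move=> d0; have [dpi|dpi] := ltP pi d.
  exists 1 => // x y /andP[x0 x1] /andP[y0 y1]; have : `|x - y| <= pi by rewrite ler_norml; lra.
  lra.
have pd : 0 <= pi - d by rewrite subr_ge0.
have cf : {within `[0, pi - d], continuous (fun x => cos x - cos (x + d))}.
  apply: continuous_subspaceT => x; apply: cvgB; first exact: continuous_cos.
  apply: (@continuous_comp _ _ _ (fun x : R => x + d) (@cos R)); last exact: continuous_cos.
  by apply: cvgD; [exact: cvg_id|exact: cvg_cst].
have [c] := EVT_min pd cf.
rewrite in_itv/= => /andP[c0 c1] hc.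
exists (cos c - cos (c + d)).
  rewrite subr_gt0 ltr_cos ?in_itv/=; lra.
have key x y : 0 <= x -> y <= pi -> d <= y - x -> cos c - cos (c + d) <= cos x - cos y.
  move=> x0 y1 xy; have xpi : x \in `[0, (pi - d)]%R by rewrite in_itv/=; lra.
  apply: le_trans (hc x xpi) _; rewrite lerD2l lerN2.
  have [->//|yxd] := eqVneq y (x + d).
  by apply: ltW; rewrite ltr_cos ?in_itv/=; lra.
move=> x y /andP[x0 x1] /andP[y0 y1]; have [xy|xy] := leP x y => h.
  by apply: le_trans (ler_norm _); apply: key => //; rewrite ler0_norm in h; lra.
by rewrite distrC; apply: le_trans (ler_norm _); apply: key => //; rewrite ger0_norm in h; lra.
Qed.

(** Korovkin's inequality with the test function [cos]: uniform continuity for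
    close points, and boundedness against [cos_gap] for distant ones. *)
Lemma cos_quadratic_modulus (g : R -> R) ep : continuous g -> 0 < ep ->
  exists2 C : R, 0 <= C & forall x y, 0 <= x <= pi -> 0 <= y <= pi ->
    `|g x - g y| <= ep + C * (cos x - cos y) ^+ 2.
Proof.
move=> cg ep0.
have [d d0 hd] := segment_unif_cont 0 pi cg ep0.
have [e e0 he] := cos_gap d0.
have cng : {within `[0, pi], continuous (fun x => `|g x|)}.
  by apply: continuous_subspaceT => x; apply: cvg_norm; exact: cg.
have [c _ hc] := EVT_max (pi_ge0 R) cng.
set B := `|g c| in hc.
have B0 : 0 <= B by exact: normr_ge0.
exists (2 * B / e ^+ 2); first by apply: divr_ge0; [rewrite mulr_ge0|exact: sqr_ge0].
move=> x y xpi ypi.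
have C0 : 0 <= 2 * B / e ^+ 2 by apply: divr_ge0; [rewrite mulr_ge0|exact: sqr_ge0].
have [xy|xy] := ltP `|x - y| d.
  by apply: le_trans (hd _ _ xpi xy) _; rewrite lerDl mulr_ge0// sqr_ge0.
apply: (@le_trans _ _ (2 * B)).
  apply: le_trans (ler_normB _ _) _.
  have := hc x; have := hc y; rewrite !in_itv/= => /(_ ypi) h1 /(_ xpi) h2.
  by rewrite mulr2n mulrDl mul1r lerD.
apply: (@le_trans _ _ (2 * B / e ^+ 2 * (cos x - cos y) ^+ 2)); last by rewrite lerDr ltW.
rewrite -mulrA ler_peMr ?mulr_ge0// mulrC ler_pdivlMr ?exprn_gt0// mul1r.
have := he x y xpi ypi xy; rewrite -[(cos x - cos y) ^+ 2]real_normK ?num_real// => h.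
by rewrite lerXn2r// nnegrE ltW.
Qed.

(** An affine image of the cosine in [[0, 1]], used as the parameter of a
    Bernstein operator. *)
Definition cosp x : R := (1 - cos x) / 2.

Lemma cosp01 x : 0 <= cosp x <= 1.
Proof.
have := cos_geN1 x; have := cos_le1 x; rewrite /cosp; lra.
Qed.

(** Bernstein's proof of Weierstrass' theorem in the variable [cosp x]: the
    variance of the binomial law bounds the quadratic modulus. *)
Lemma cos_bernstein (g : R -> R) ep : continuous g -> 0 < ep ->
  exists N (h : nat -> R),
   (forall z, (z <= N)%N -> exists2 x, 0 <= x <= pi & h z = g x) /\
   (forall x, 0 <= x <= pi -> `|g x - binom_mean N (cosp x) h| <= ep).
Proof.
move=> cg ep0; have ep2 : 0 < ep / 2 by rewrite divr_gt0.
have [C C0 hC] := cos_quadratic_modulus cg ep2.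
pose N := (Num.truncn (2 * C / ep)).+1.
have Np : 0 < N%:R :> R by rewrite ltr0n.
have CN : C / N%:R <= ep / 2.
  rewrite ler_pdivrMr// mulrC -ler_pdivrMr//.
  rewrite (_ : C / (ep / 2) = 2 * C / ep); last by field; rewrite gt_eqF.
  by apply: ltW; exact: truncnS_gt.
(* The Bernstein nodes: [cosp (nd z) = z / N]. *)
pose nd z : R := acos (1 - 2 * (z%:R / N%:R)).
have ndP z : (z <= N)%N -> 0 <= nd z <= pi /\ cos (nd z) = 1 - 2 * (z%:R / N%:R).
  move=> zN; apply: acos_def.
  have z1 : z%:R / N%:R <= 1 :> R by rewrite ler_pdivrMr// mul1r ler_nat.
  have z0 : 0 <= z%:R / N%:R :> R by rewrite divr_ge0// ltW.
  by lra.
exists N, (fun z => g (nd z)); split=> [z zN|x xpi].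
  by exists (nd z) => //; have [] := ndP z zN.
have p01 := cosp01 x.
apply: (@le_trans _ _ (binom_mean N (cosp x) (fun z => ep / 2 + (4 * C / N%:R ^+ 2) * (z%:R + - (N%:R * cosp x)) ^+ 2))).
  rewrite -(binom_mean_cst N (cosp x) (g x)).
  have -> : binom_mean N (cosp x) (fun=> g x) - binom_mean N (cosp x) (fun z => g (nd z)) =
     binom_mean N (cosp x) (fun z => g x - g (nd z)).
    have := binom_mean_lin N (cosp x) (-1) (fun z => g (nd z)) (fun=> g x).
    rewrite mulN1r addrC => <-; apply: eq_binom_mean => z _; ring.
  have bnd z : (z <= N)%N -> `|g x - g (nd z)| <= ep / 2 + (4 * C / N%:R ^+ 2) * (z%:R + - (N%:R * cosp x)) ^+ 2.
    move=> zN; have [nz cz] := ndP z zN; apply: le_trans (hC _ _ xpi nz) _.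
    rewrite cz (_ : cos x = 1 - 2 * cosp x); last by rewrite /cosp; field.
    rewrite le_eqVlt; apply/orP; left; apply/eqP; field; exact: lt0r_neq0.
  rewrite ler_norml; apply/andP; split.
    rewrite lerNl -mulN1r -binom_meanZ; apply: binom_mean_le => // z zN.
    by apply: le_trans (bnd z zN); rewrite mulN1r -normrN ler_norm.
  by apply: binom_mean_le => // z zN; apply: le_trans (bnd z zN); exact: ler_norm.
rewrite binom_meanD binom_mean_cst binom_meanZ binom_mean_sqr subrr expr0n addr0.
have q : cosp x * (1 - cosp x) <= 4^-1.
  by rewrite -subr_ge0 (_ : _ - _ = (cosp x - 2^-1) ^+ 2) ?sqr_ge0//; field.
apply: (@le_trans _ _ (ep / 2 + C / N%:R)); last by lra.
rewrite lerD2l (_ : 4 * C / _ * _ = (4 * C / N%:R) * (cosp x * (1 - cosp x))); last first.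
  by field; exact: lt0r_neq0.
apply: (@le_trans _ _ (4 * C / N%:R * 4^-1)).
  by rewrite ler_wpM2l// divr_ge0 ?mulr_ge0// ltW.
by rewrite le_eqVlt; apply/orP; left; apply/eqP; field; exact: lt0r_neq0.
Qed.

End CosBernstein.

(** * Mean functionals determined by even moments *)

Section PolyGrowth.
Variable R : realType.
Implicit Types (f g : R -> R) (L : (R -> R) -> R) (a t x : R).

(** Only the values on [x >= 0] matter, since the laws considered live there;
    even powers make the bounds compatible with even moments. *)
Definition poly_growth f := continuous f /\
  exists2 C : R, 0 <= C & exists p, forall x, 0 <= x -> `|f x| <= C * (1 + x ^+ (2 * p)).

Lemma poly_growth_bounded f M : continuous f -> (forall x, 0 <= x -> `|f x| <= M) -> poly_growth f.
Proof.
move=> cf hM; split => //; exists M; first exact: le_trans (hM 0 (lexx _)).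
exists 0%N => x x0; apply: le_trans (hM x x0) _.
have M0 : 0 <= M by exact: le_trans (hM 0 (lexx _)).
by rewrite expr0; lra.
Qed.

Lemma even_pow_le (p q : nat) x : (p <= q)%N -> x ^+ (2 * p) <= 1 + x ^+ (2 * q).
Proof.
move=> pq; rewrite !exprM; have y0 : 0 <= x ^+ 2 by exact: sqr_ge0.
move: (x ^+ 2) y0 => y y0; have [y1|y1] := leP y 1.
  by apply: (@le_trans _ _ 1); [rewrite exprn_ile1|rewrite lerDl exprn_ge0].
apply: (@le_trans _ _ (y ^+ q)); first by rewrite ler_weXn2l// ltW.
by rewrite lerDr.
Qed.

Lemma poly_growth_lin a f g : poly_growth f -> poly_growth g -> poly_growth (fun x => a * f x + g x).
Proof.
move=> [cf [C C0 [p hf]]] [cg [D D0 [q hg]]]; split.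
  move=> x; apply: cvgD; last exact: cg.
  by apply: cvgM; [exact: cvg_cst|exact: cf].
exists (2 * (`|a| * C + D)); first by rewrite mulr_ge0// addr_ge0// mulr_ge0.
exists (maxn p q) => x x0.
have e1 := even_pow_le x (leq_maxl p q); have e2 := even_pow_le x (leq_maxr p q).
set Y := x ^+ (2 * maxn p q) in e1 e2 *.
have Y0 : 0 <= Y by exact: exprn_ge0.
apply: le_trans (ler_normD _ _) _; rewrite normrM.
apply: (@le_trans _ _ (`|a| * (C * (2 + Y)) + D * (2 + Y))).
  apply: lerD.
    rewrite ler_wpM2l//; apply: le_trans (hf x x0) _; rewrite ler_wpM2l//; lra.
  by apply: le_trans (hg x x0) _; rewrite ler_wpM2l//; lra.
rewrite [X in _ <= X](_ : _ = (`|a| * C + D) * (2 * (1 + Y))); last by ring.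
rewrite mulrA -mulrDl ler_wpM2l ?addr_ge0 ?mulr_ge0//; lra.
Qed.

Lemma poly_growth_cst a : poly_growth (fun=> a).
Proof. by apply: (@poly_growth_bounded _ `|a|) => // x; exact: cvg_cst. Qed.

Lemma poly_growth_pow p : poly_growth (fun x => x ^+ (2 * p)).
Proof.
split; first exact: exprn_continuous.
exists 1 => //; exists p => x x0; rewrite mul1r ger0_norm ?exprn_ge0//.
by rewrite lerDr.
Qed.

Lemma continuous_cosM t : continuous (fun x => cos (t * x)).
Proof.
move=> x; apply: (@continuous_comp _ _ _ (fun x : R => t * x) (@cos R)).
  by apply: cvgM; [exact: cvg_cst|exact: cvg_id].
exact: continuous_cos.
Qed.

Lemma poly_growth_cos t : poly_growth (fun x => cos (t * x)).
Proof. apply: (@poly_growth_bounded _ 1) => [|x _]; [exact: continuous_cosM|exact: cos_max]. Qed.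

(** The abstract counterpart of expectation under a law on [x >= 0] with all
    moments; it covers integrals and the finite sums of the chain alike. *)
Record mean_functional L : Prop := MeanFunctional {
  mf_lin : forall a f g, poly_growth f -> poly_growth g -> L (fun x => a * f x + g x) = a * L f + L g;
  mf_le : forall f g, poly_growth f -> poly_growth g -> (forall x, 0 <= x -> f x <= g x) -> L f <= L g;
  mf_one : L (fun=> 1) = 1 }.

Section MeanTheory.
Variable L : (R -> R) -> R.
Hypothesis mL : mean_functional L.

Lemma mf_scale a f : poly_growth f -> L (fun x => a * f x) = a * L f.
Proof.
move=> pf.
have h0 : L (fun=> 0) = 0.
  have := mf_lin mL 1 (poly_growth_cst 0) (poly_growth_cst 0).
  rewrite (_ : (fun x => 1 * 0 + 0) = fun=> 0 : R); first by lra.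
  by apply/funext => x; lra.
rewrite -[RHS]addr0 -h0 -(mf_lin mL a pf (poly_growth_cst 0)); congr L.
by apply/funext => x; rewrite addr0.
Qed.

Lemma mf_cst a : L (fun=> a) = a.
Proof.
rewrite -[RHS]mulr1 -(mf_one mL) -(mf_scale a (poly_growth_cst 1)); congr L.
by apply/funext => x; rewrite mulr1.
Qed.

Lemma poly_growth_sum n (F : nat -> R -> R) :
  (forall i, poly_growth (F i)) -> poly_growth (fun x => \sum_(i < n) F i x).
Proof.
move=> h; elim: n => [|n IH].
  by rewrite (_ : (fun x => _) = fun=> 0); [exact: poly_growth_cst|apply/funext=> x; rewrite big_ord0].
rewrite (_ : (fun x => _) = fun x => 1 * F n x + \sum_(i < n) F i x); first exact: poly_growth_lin.
by apply/funext => x; rewrite big_ord_recr /= mul1r addrC.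
Qed.

Lemma mf_sum n (F : nat -> R -> R) : (forall i, poly_growth (F i)) ->
  L (fun x => \sum_(i < n) F i x) = \sum_(i < n) L (F i).
Proof.
move=> h; elim: n => [|n IH].
  by rewrite big_ord0 -[RHS](mf_cst 0); congr L; apply/funext=> x; rewrite big_ord0.
rewrite big_ord_recr /= addrC -IH -[L (F n)]mul1r -(mf_lin mL)//; last exact: poly_growth_sum.
by congr L; apply/funext => x; rewrite big_ord_recr /= mul1r addrC.
Qed.

(** The triangle inequality for means. *)
Lemma mf_dist f g h : poly_growth f -> poly_growth g -> poly_growth h ->
  (forall x, 0 <= x -> `|f x - g x| <= h x) -> `|L f - L g| <= L h.
Proof.
move=> pf pg ph fgh.
have e : L f - L g = L (fun x => -1 * g x + f x) by rewrite (mf_lin mL)//; ring.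
have pd : poly_growth (fun x => -1 * g x + f x) by exact: poly_growth_lin.
have pN : poly_growth (fun x => -1 * h x + 0) by apply: poly_growth_lin => //; exact: poly_growth_cst.
rewrite e ler_norml; apply/andP; split.
  have -> : - L h = L (fun x => -1 * h x + 0).
    by rewrite (mf_lin mL)// ?mf_cst; [ring|exact: poly_growth_cst].
  apply: (mf_le mL) => // x x0; have := fgh x x0; rewrite ler_norml; lra.
by apply: (mf_le mL) => // x x0; have := fgh x x0; rewrite ler_norml; lra.
Qed.

(** Apply the functional to the Taylor bound of the cosine. *)
Lemma mf_cos_taylor K t :
  `|L (fun x => cos (t * x)) - \sum_(c < K) (-1) ^+ c / (2 * c)`!%:R * t ^+ (2 * c) * L (fun x => x ^+ (2 * c))|
  <= t ^+ (2 * K) / (2 * K)`!%:R * L (fun x => x ^+ (2 * K)).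
Proof.
have pF c : poly_growth (fun x => (-1) ^+ c / (2 * c)`!%:R * t ^+ (2 * c) * x ^+ (2 * c)).
  rewrite (_ : (fun x => _) = fun x => (-1) ^+ c / (2 * c)`!%:R * t ^+ (2 * c) * x ^+ (2 * c) + 0).
    by apply: poly_growth_lin; [exact: poly_growth_pow|exact: poly_growth_cst].
  by apply/funext => x; rewrite addr0.
have pG : poly_growth (fun x => t ^+ (2 * K) / (2 * K)`!%:R * x ^+ (2 * K)).
  rewrite (_ : (fun x => _) = fun x => t ^+ (2 * K) / (2 * K)`!%:R * x ^+ (2 * K) + 0).
    by apply: poly_growth_lin; [exact: poly_growth_pow|exact: poly_growth_cst].
  by apply/funext => x; rewrite addr0.
have -> : \sum_(c < K) (-1) ^+ c / (2 * c)`!%:R * t ^+ (2 * c) * L (fun x => x ^+ (2 * c)) =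
   L (fun x => \sum_(c < K) (-1) ^+ c / (2 * c)`!%:R * t ^+ (2 * c) * x ^+ (2 * c)).
  rewrite (mf_sum K pF); apply: eq_bigr => c _; rewrite mf_scale//; exact: poly_growth_pow.
rewrite -mf_scale; last exact: poly_growth_pow.
apply: mf_dist => //; [exact: poly_growth_cos|exact: poly_growth_sum pF|] => x x0.
have -> : cos (t * x) = cos (`|t| * x).
  by rewrite -[LHS]cos_norm normrM (ger0_norm x0).
have := @cos_taylor R K (`|t| * x); rewrite mulr_ge0// => /(_ isT).
rewrite /cos_poly exprMn exprM real_normK ?num_real// -exprM mulrAC.
congr (`|_ - _| <= _); apply: eq_bigr => c _.
by rewrite exprMn exprM real_normK ?num_real// -exprM mulrA.
Qed.

End MeanTheory.

(** Truncate the Taylor series where the remainder, controlled by the next even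
    moment, is small; finitely many moments then determine the value up to [ep]. *)
Lemma cos_of_moments (mu : nat -> R) t ep :
  (t ^+ (2 * K) / (2 * K)`!%:R * mu K @[K --> \oo] --> (0 : R)) -> 0 < ep ->
  exists K (d : R), 0 < d /\ forall L1 L2, mean_functional L1 -> mean_functional L2 ->
   (forall c, (c <= K)%N -> `|L1 (fun x => x ^+ (2 * c)) - mu c| <= d) ->
   (forall c, (c <= K)%N -> `|L2 (fun x => x ^+ (2 * c)) - mu c| <= d) ->
   `|L1 (fun x => cos (t * x)) - L2 (fun x => cos (t * x))| <= ep.
Proof.
move=> hmu ep0.
have ep8 : 0 < ep / 8 by rewrite divr_gt0.
have [K hK] : exists K, t ^+ (2 * K) / (2 * K)`!%:R * mu K <= ep / 8.
  have /cvgrPdist_le /(_ _ ep8) [K _ hK] := hmu.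
  exists K; have := hK K (leqnn _); rewrite /= sub0r normrN.
  exact: le_trans (ler_norm _).
pose w c : R := t ^+ (2 * c) / (2 * c)`!%:R.
have w0 c : 0 <= w c by rewrite divr_ge0// exprM exprn_ge0// sqr_ge0.
pose W := \sum_(c < K) w c + w K + 1.
have S0 : 0 <= \sum_(c < K) w c by exact: sumr_ge0.
have W1 : 1 <= W by have := w0 K; rewrite /W; lra.
exists K, (ep / 8 / W); split; first by rewrite divr_gt0//; lra.
set d := ep / 8 / W.
have dW : d * W = ep / 8 by rewrite /d divfK// gt_eqF//; lra.
have d0 : 0 < d by rewrite divr_gt0//; lra.
have one L : mean_functional L -> (forall c, (c <= K)%N -> `|L (fun x => x ^+ (2 * c)) - mu c| <= d) ->
  `|L (fun x => cos (t * x)) - \sum_(c < K) (-1) ^+ c / (2 * c)`!%:R * t ^+ (2 * c) * mu c| <= ep / 2.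
  move=> mL hL; set A := L _; set B := \sum_(c < K) _.
  set D := \sum_(c < K) (-1) ^+ c / (2 * c)`!%:R * t ^+ (2 * c) * L (fun x => x ^+ (2 * c)).
  apply: le_trans (ler_distD D _ _) _.
  have h1 : `|A - D| <= w K * (mu K + d).
    apply: le_trans (mf_cos_taylor mL K t) _; rewrite -/(w K) ler_wpM2l//.
    by have := hL K (leqnn _); rewrite ler_distl => /andP[_]; lra.
  have h2 : `|D - B| <= d * \sum_(c < K) w c.
    rewrite -sumrB; apply: le_trans (ler_norm_sum _ _ _) _.
    rewrite mulr_sumr; apply: ler_sum => c _; rewrite -mulrBr normrM mulrC.
    apply: ler_pM => //; first by apply: hL; exact: ltnW.
    rewrite !normrM normrX normrN1 expr1n mul1r normfV normr_nat mulrC.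
    by rewrite (ger0_norm (_ : 0 <= t ^+ (2 * c)))// exprM exprn_ge0// sqr_ge0.
  have h3 : d * W = d * (\sum_(c < K) w c) + d * w K + d by rewrite /W; ring.
  have h4 : w K * mu K <= ep / 8 := hK.
  have h5 : 0 <= d * w K by rewrite mulr_ge0// ltW.
  have h6 : 0 <= d * \sum_(c < K) w c by rewrite mulr_ge0// ltW.
  move: h1; rewrite mulrDr [w K * d]mulrC => h1; lra.
move=> L1 L2 mL1 mL2 h1 h2.
have {}h1 := one L1 mL1 h1; have {}h2 := one L2 mL2 h2.
set B := \sum_(c < K) _ in h1 h2.
apply: le_trans (ler_distD B _ _) _.
by rewrite [X in _ + X]distrC; lra.
Qed.

Section CosToAll.
Variables (L : nat -> (R -> R) -> R) (L0 : (R -> R) -> R).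
Hypothesis mL : forall n, mean_functional (L n).
Hypothesis mL0 : mean_functional L0.
Hypothesis hcos : forall t, L n (fun x => cos (t * x)) @[n --> \oo] --> L0 (fun x => cos (t * x)).
Hypothesis hbnd : forall q, exists2 C : R, 0 <= C & exists N, forall n, (N <= n)%N ->
  L n (fun x => x ^+ (2 * q)) <= C.

Let good f := poly_growth f /\ L n f @[n --> \oo] --> L0 f.

Let good_lin a f g : good f -> good g -> good (fun x => a * f x + g x).
Proof.
move=> [pf hf] [pg hg]; split; first exact: poly_growth_lin.
rewrite (mf_lin mL0)//.
under eq_fun do rewrite (mf_lin (mL _))//.
by apply: cvgD hg; apply: cvgM hf; exact: cvg_cst.
Qed.

Let good_eq f g : good f -> f =1 g -> good g.
Proof. by move=> hf /funext <-. Qed.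

(** A Bernstein polynomial in [cosp] is a trigonometric polynomial: each trial
    multiplies by [cosp (s * x)], and the product formula turns this into
    frequencies shifted by [s]. The extra frequency [t] makes the induction
    work. *)
Lemma cvg_cos_binom_mean (s : R) N (h : nat -> R) t :
  good (fun x => cos (t * x) * binom_mean N (cosp (s * x)) h).
Proof.
elim: N h t => [|N IH] h t /=.
  have c0 : good (fun=> 0).
    split; first exact: poly_growth_cst.
    rewrite (mf_cst mL0); under eq_fun do rewrite (mf_cst (mL _)).
    exact: cvg_cst.
  have ct : good (fun x => cos (t * x)) by split; [exact: poly_growth_cos|exact: hcos].
  by apply: good_eq (good_lin (h 0%N) ct c0) _ => x; rewrite addr0 mulrC.
set h' := fun z => h z.+1.
(* Expand [cosp (s * x)] and use [cos (t * x) * cos (s * x) = (cos ((t + s) *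
   x) + cos ((t - s) * x)) / 2]. *)
apply: good_eq (good_lin 2^-1 (IH h' t) (good_lin (- 4^-1) (IH h' (t + s)) (good_lin (- 4^-1) (IH h' (t - s))
  (good_lin 2^-1 (IH h t) (good_lin 4^-1 (IH h (t + s)) (good_lin (4^-1 - 1) (IH h (t - s)) (IH h (t - s)))))))) _.
move=> x; rewrite [(t + s) * x]mulrDl [(t - s) * x]mulrBl cosD cosB.
set b1 := binom_mean _ _ h'; set b2 := binom_mean _ _ h.
by rewrite /cosp; field.
Qed.

(** On [[0, l]] the function is close to a trigonometric polynomial of
    half-period [l], which is bounded by the values of [f] on that interval;
    beyond [l] both are at most a small multiple of [x ^+ (2 * p.+1)], whose
    means are bounded. *)
Lemma cvg_poly_growth f : poly_growth f -> L n f @[n --> \oo] --> L0 f.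
Proof.
move=> pf; have [cf [C C0 [p hf]]] := pf.
have [B B0 [N0 hB]] := hbnd p.+1.
set B' := B + L0 (fun x => x ^+ (2 * p.+1)).
have B'0 : 0 <= B'.
  rewrite addr_ge0// -(mf_cst mL0 0); apply: (mf_le mL0); [exact: poly_growth_cst|exact: poly_growth_pow|].
  by move=> x x0; rewrite exprn_ge0.
apply/cvgrPdist_le => ep ep0.
have ep8 : 0 < ep / 8 by rewrite divr_gt0.
have ep81 : 0 < Num.min (ep / 8) 1 by rewrite lt_min ep8 ltr01.
set e1 := Num.min (ep / 8) 1 in ep81.
have e11 : e1 <= 1 by rewrite ge_min lexx orbT.
have e1e : e1 <= ep / 8 by rewrite ge_min lexx.
(* [l] is the cut-off: the contribution of [x >= l] is at most [D / l ^+ 2]. *)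
set D := (4 * C + 1) * B'.
have D0 : 0 <= D by rewrite mulr_ge0// addr_ge0// mulr_ge0.
pose l := 1 + D / (ep / 8).
have l1 : 1 <= l by rewrite lerDl divr_ge0// ltW.
have lD : D / l ^+ 2 <= ep / 8.
  rewrite ler_pdivrMr; last by rewrite exprn_gt0//; lra.
  rewrite mulrC -ler_pdivrMr//; apply: (@le_trans _ _ l); first by rewrite lerDr.
  by rewrite expr2 ler_peMr//; lra.
have lp : 0 < l by lra.
pose s := pi / l.
have s0 : 0 < s by rewrite divr_gt0// pi_gt0.
have cg : continuous (fun th : R => f (th / s)).
  move=> x; apply: (@continuous_comp _ _ _ (fun x : R => x / s) f); last exact: cf.
  by apply: cvgM; [exact: cvg_id|exact: cvg_cst].
have [N [h [hN hg]]] := cos_bernstein cg ep81.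
pose G x := binom_mean N (cosp (s * x)) h.
have [pG cG] : poly_growth G /\ L n G @[n --> \oo] --> L0 G.
  have := cvg_cos_binom_mean s N h 0.
  rewrite (_ : (fun x => cos (0 * x) * _) = G)//.
  by apply/funext => x; rewrite mul0r cos0 mul1r.
(* The Bernstein polynomial takes values in the convex hull of those of [f] on
   [[0, l]], hence is bounded everywhere. *)
have hM z : (z <= N)%N -> `|h z| <= C * (1 + l ^+ (2 * p)).
  move=> zN; have [x /andP[x0 xpi] ->] := hN z zN.
  apply: le_trans (hf _ _) _; first by rewrite divr_ge0// ltW.
  rewrite ler_wpM2l// lerD2l lerXn2r ?nnegrE ?divr_ge0 ?pi_ge0 ?(ltW s0) ?(ltW lp)//.
  rewrite ler_pdivrMr// /s mulrCA divff ?mulr1// gt_eqF//.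
have GM x : `|G x| <= C * (1 + l ^+ (2 * p)).
  have p01 := cosp01 (s * x).
  rewrite /G ler_norml; apply/andP; split.
    rewrite -(binom_mean_cst N (cosp (s * x)) (- _)).
    by apply: binom_mean_le => // z zN; have := hM z zN; rewrite ler_norml => /andP[].
  rewrite -[X in _ <= X](binom_mean_cst N (cosp (s * x))).
  by apply: binom_mean_le => // z zN; have := hM z zN; rewrite ler_norml => /andP[].
pose H x := (4 * C + 1) / l ^+ 2 * x ^+ (2 * p.+1) + e1.
have pH : poly_growth H by apply: poly_growth_lin; [exact: poly_growth_pow|exact: poly_growth_cst].
have fGH x : 0 <= x -> `|f x - G x| <= H x.
  move=> x0; have [xl|lx] := leP x l.
    apply: (@le_trans _ _ e1); last first.
      by rewrite lerDr mulr_ge0 ?exprn_ge0// divr_ge0 ?exprn_ge0 ?(ltW lp)// addr_ge0// mulr_ge0.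
    have sx : 0 <= s * x <= pi.
      rewrite mulr_ge0 ?(ltW s0)//= /s mulrAC ler_pdivrMr// ler_pM2l ?pi_gt0//.
    by have := hg (s * x) sx; rewrite [s * x / s]mulrAC divff ?mul1r// gt_eqF.
  have x1 : 1 <= x by lra.
  have X1 : 1 <= x ^+ (2 * p) by rewrite exprn_ege1.
  have lX : l ^+ (2 * p) <= x ^+ (2 * p) by rewrite lerXn2r ?nnegrE//; lra.
  apply: (@le_trans _ _ ((4 * C + 1) * x ^+ (2 * p))).
    apply: le_trans (ler_normB _ _) _; apply: (@le_trans _ _ (C * (1 + x ^+ (2 * p)) + C * (1 + l ^+ (2 * p)))).
      by apply: lerD; [exact: hf|exact: GM].
    have a1 : C * l ^+ (2 * p) <= C * x ^+ (2 * p) by rewrite ler_wpM2l.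
    have a2 : C * 1 <= C * x ^+ (2 * p) by rewrite ler_wpM2l.
    by move: a1 a2; lra.
  apply: (@le_trans _ _ ((4 * C + 1) / l ^+ 2 * x ^+ (2 * p.+1))); last by rewrite lerDl ltW.
  rewrite mulnS exprD -mulrA ler_wpM2l ?addr_ge0 ?mulr_ge0//.
  rewrite mulrA ler_peMl ?exprn_ge0// mulrC ler_pdivlMr ?exprn_gt0// mul1r.
  by rewrite lerXn2r ?nnegrE//; lra.
have LH : L0 H <= ep / 4.
  rewrite /H (mf_lin mL0); [|exact: poly_growth_pow|exact: poly_growth_cst].
  rewrite (mf_cst mL0); apply: (@le_trans _ _ (D / l ^+ 2 + e1)); last by lra.
  rewrite lerD2r /D -!mulrA ler_wpM2l ?addr_ge0 ?mulr_ge0// mulrC ler_wpM2r ?invr_ge0 ?exprn_ge0 ?(ltW lp)//.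
  by rewrite /B' lerDr.
have LnH n : (N0 <= n)%N -> L n H <= ep / 4.
  move=> Nn; rewrite /H (mf_lin (mL n)); [|exact: poly_growth_pow|exact: poly_growth_cst].
  rewrite (mf_cst (mL n)); apply: (@le_trans _ _ (D / l ^+ 2 + e1)); last by lra.
  rewrite lerD2r /D -!mulrA ler_wpM2l ?addr_ge0 ?mulr_ge0// mulrC ler_wpM2r ?invr_ge0 ?exprn_ge0 ?(ltW lp)//.
  apply: le_trans (hB n Nn) _; rewrite /B' lerDl -(mf_cst mL0 0).
  by apply: (mf_le mL0); [exact: poly_growth_cst|exact: poly_growth_pow|] => x x0; rewrite exprn_ge0.
have d0 := mf_dist mL0 pf pG pH fGH.
have ep4 : 0 < ep / 4 by rewrite divr_gt0.
have /cvgrPdist_le /(_ _ ep4) [N1 _ hN1] := cG.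
exists (maxn N0 N1) => // n /=; rewrite geq_max => /andP[n0 n1].
have dn := mf_dist (mL n) pf pG pH fGH; have := LnH n n0; have := hN1 n n1 => /= h3 h4.
apply: le_trans (ler_distD (L0 G) _ _) _.
apply: le_trans (lerD (lexx _) (ler_distD (L n G) _ _)) _.
by rewrite [ `|L n G - L n f|]distrC; lra.
Qed.

End CosToAll.

End PolyGrowth.

(** * Gaussian and Gamma integrals by parts *)

Section Parts.
Variable R : realType.
Notation mu := (@lebesgue_measure R).
Implicit Types (f F : R -> R) (x : R).

Lemma is_derive_continuous F f : (forall x, is_derive x 1 F (f x)) -> continuous F.
Proof.
by move=> h x; apply: differentiable_continuous; apply/derivable1_diffP; exact: ex_derive.
Qed.

Lemma ge0_integral_derive_y f F (a l : R) :
  (forall x, is_derive x 1 F (f x)) -> continuous f ->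
  (forall x, a <= x -> 0 <= f x) -> F x @[x --> +oo%R] --> l ->
  (\int[mu]_(x in `[a, +oo[) (f x)%:E = (l - F a)%:E)%E.
Proof.
move=> dF cf f0 Fl; rewrite (@ge0_continuous_FTC2y R f F a l) ?EFinB//.
- exact: continuous_subspaceT.
- by apply: cvg_at_right_filter; exact: is_derive_continuous dF a.
- by move=> x _; rewrite derive1E; exact: derive_val.
Qed.

Lemma integral_derive f F (a b : R) : a <= b ->
  (forall x, is_derive x 1 F (f x)) -> continuous f ->
  (\int[mu]_(x in `[a, b]) (f x)%:E = (F b - F a)%:E)%E.
Proof.
rewrite le_eqVlt => /orP[/eqP <-|ab] dF cf.
  by rewrite set_itv1 integral_set1 subrr.
have cF := is_derive_continuous dF.
rewrite (@continuous_FTC2 R f F a b ab (continuous_subspaceT cf)) ?EFinB//.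
- split; first by move=> x _; exact: ex_derive.
    by apply: cvg_at_right_filter; exact: cF.
  by apply: cvg_at_left_filter; exact: cF.
- by move=> x _; rewrite derive1E; exact: derive_val.
Qed.

(** Integration by parts over the half-line for nonnegative functions, in a form
    that covers infinite integrals: the difference [f1 - f2] is split at the
    point [a] where it changes sign, so that the fundamental theorem is applied
    to functions of constant sign. *)
Lemma eq_integral_of_derive (f1 f2 F : R -> R) (a : R) : 0 <= a ->
  continuous f1 -> continuous f2 ->
  (forall x, 0 <= x -> 0 <= f1 x) -> (forall x, 0 <= x -> 0 <= f2 x) ->
  (forall x, is_derive x 1 F (f1 x - f2 x)) -> F 0 = 0 -> F x @[x --> +oo%R] --> 0 ->
  (forall x, 0 <= x <= a -> f1 x <= f2 x) -> (forall x, a <= x -> f2 x <= f1 x) ->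
  (\int[mu]_(x in `[0%R, +oo[) (f1 x)%:E = \int[mu]_(x in `[0%R, +oo[) (f2 x)%:E)%E.
Proof.
move=> a0 c1 c2 p1 p2 dF F0 Foo h12 h21.
have m1 D : measurable D -> measurable_fun D f1.
  by move=> mD; apply: measurable_funS (continuous_measurable_fun c1).
have m2 D : measurable D -> measurable_fun D f2.
  by move=> mD; apply: measurable_funS (continuous_measurable_fun c2).
have cd : continuous (fun x => f1 x - f2 x) by move=> x; apply: cvgB; [exact: c1|exact: c2].
have cdN : continuous (fun x => f2 x - f1 x) by move=> x; apply: cvgB; [exact: c2|exact: c1].
have T1 : (\int[mu]_(x in `[a, +oo[) (f1 x - f2 x)%:E = (- F a)%:E)%E.
  rewrite (ge0_integral_derive_y dF cd _ Foo) ?sub0r// => x ax.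
  by rewrite subr_ge0 h21.
have T2 : (\int[mu]_(x in `[0%R, a]) (f2 x - f1 x)%:E = (- F a)%:E)%E.
  have dFN x : is_derive x 1 (fun y => -1 * F y) (f2 x - f1 x).
    by move: (is_derive_scale (-1) (dF x)) => /is_derive_eq; apply; ring.
  by rewrite (integral_derive a0 dFN cdN) F0 mulr0 subr0 mulN1r.
have E1 : (\int[mu]_(x in `[a, +oo[) (f1 x)%:E = (- F a)%:E + \int[mu]_(x in `[a, +oo[) (f2 x)%:E)%E.
  rewrite -T1 -ge0_integralD//=.
  - by apply: eq_integral => x _; rewrite -EFinD subrK.
  - by move=> x; rewrite in_itv/= andbT => ax; rewrite lee_fin subr_ge0 h21.
  - by apply/measurable_EFinP; apply: measurable_funS (continuous_measurable_fun cd).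
  - by move=> x; rewrite in_itv/= andbT => ax; rewrite lee_fin p2// (le_trans a0).
  - by apply/measurable_EFinP; exact: m2.
have E2 : (\int[mu]_(x in `[0%R, a]) (f2 x)%:E = (- F a)%:E + \int[mu]_(x in `[0%R, a]) (f1 x)%:E)%E.
  rewrite -T2 -ge0_integralD//=.
  - by apply: eq_integral => x _; rewrite -EFinD subrK.
  - by move=> x; rewrite in_itv/= => ax; rewrite lee_fin subr_ge0 h12.
  - by apply/measurable_EFinP; apply: measurable_funS (continuous_measurable_fun cdN).
  - by move=> x; rewrite in_itv/= => /andP[x0 _]; rewrite lee_fin p1.
  - by apply/measurable_EFinP; exact: m1.
have split (f : R -> R) : continuous f -> (forall x, 0 <= x -> 0 <= f x) ->
   (\int[mu]_(x in `[0%R, +oo[) (f x)%:E = \int[mu]_(x in `[0%R, a]) (f x)%:E + \int[mu]_(x in `[a, +oo[) (f x)%:E)%E.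
  move=> cf pf.
  have mf D : measurable D -> measurable_fun D f.
    by move=> mD; apply: measurable_funS (continuous_measurable_fun cf).
  rewrite -(@integral_itv_bndo_bndc R _ a); last by apply/measurable_EFinP; exact: mf.
  rewrite -ge0_integral_setU//=.
  - congr (integral _ _ _); apply/seteqP; split => x /=; rewrite !in_itv/= !andbT.
      by move=> x0; have [ax|xa] := leP a x; [right|left; rewrite x0].
    by move=> [/andP[]//|ax]; exact: le_trans ax.
  - by apply/measurable_EFinP; apply: mf; exact: measurableU.
  - by move=> x /=; rewrite !in_itv/= !andbT => -[/andP[x0 _]|ax]; rewrite lee_fin pf// (le_trans a0).
  - by apply/disj_setPS => x /=; rewrite !in_itv/= andbT => -[/andP[_ xa]]; rewrite leNgt xa.
by rewrite (split f1)// (split f2)// E1 E2 addeA; congr adde; rewrite addeC.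
Qed.

End Parts.

Section GaussGamma.
Variable R : realType.
Notation mu := (@lebesgue_measure R).
Implicit Types x : R.

Definition gauss_weight x : R := expR (- (x ^+ 2 / 2)).

Lemma cvg_pow_expRN p : x ^+ p * expR (- x) @[x --> +oo%R] --> (0 : R).
Proof.
apply/cvgrPdist_le => e e0; near=> x.
have x0 : 0 < x by near: x; exact: nbhs_pinfty_gt.
rewrite sub0r normrN ger0_norm ?mulr_ge0 ?exprn_ge0 ?expR_ge0 ?(ltW x0)//.
rewrite expRN ler_pdivrMr ?expR_gt0//.
apply: (@le_trans _ _ (e * (x ^+ p.+1 / p.+1`!%:R))).
  rewrite (_ : e * _ = x ^+ p * (e * x / p.+1`!%:R)); last by rewrite exprS; ring.
  rewrite ler_peMr ?exprn_ge0 ?(ltW x0)// ler_pdivlMr ?ltr0n ?fact_gt0// mul1r.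
  by rewrite -ler_pdivrMl//.
rewrite ler_pM2l//; apply: le_trans (expR_ge1Dxn p (ltW x0)).
by rewrite lerDr.
Unshelve. all: by end_near. Qed.

Lemma cvg_pow_gauss_weight p : x ^+ p * gauss_weight x @[x --> +oo%R] --> (0 : R).
Proof.
apply: (@squeeze_cvgr _ _ _ _ (cst 0) (fun x => x ^+ p * expR (- x))); last 2 first.
- exact: cvg_cst.
- exact: cvg_pow_expRN.
near=> x; have x2 : 2 <= x by near: x; apply: nbhs_pinfty_ge; rewrite num_real.
have x0 : 0 <= x by lra.
apply/andP; split; first by rewrite mulr_ge0 ?exprn_ge0 ?expR_ge0.
rewrite ler_wpM2l ?exprn_ge0// ler_expR lerN2 ler_pdivlMr// expr2 ler_wpM2l//.
Unshelve. all: by end_near. Qed.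

Lemma cvgN1M0 (u : R -> R) : u x @[x --> +oo%R] --> (0 : R) ->
  -1 * u x @[x --> +oo%R] --> (0 : R).
Proof.
by move=> h; rewrite -[X in _ --> X](mulr0 (-1)); apply: cvgM h; exact: cvg_cst.
Qed.

Lemma is_derive_gauss_weight x : is_derive x 1 gauss_weight (- x * gauss_weight x).
Proof.
have h : is_derive x 1 (fun y : R => - 2^-1 * y ^+ 2) (- x).
  by move: (is_derive_scale (- 2^-1) (is_derive_pow 1 x)) => /is_derive_eq; apply; field.
rewrite (_ : gauss_weight = fun y => expR (- 2^-1 * y ^+ 2)); last first.
  by apply/funext => y; rewrite /gauss_weight mulNr mulrC.
have := @is_derive1_comp R expR (fun y : R => - 2^-1 * y ^+ 2) x _ _ (is_derive_expR _) h.
by move=> /is_derive_eq; apply; rewrite /= mulrC.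
Qed.

Lemma continuous_pow_gauss_weight p : continuous (fun x : R => x ^+ p * gauss_weight x).
Proof.
move=> x; apply: cvgM; first exact: exprn_continuous.
exact: is_derive_continuous is_derive_gauss_weight x.
Qed.

Definition gauss_moment p : \bar R := (\int[mu]_(x in `[0%R, +oo[) (x ^+ p * gauss_weight x)%:E)%E.

Lemma is_derive_pow_mul (w : R -> R) (d : R) p x : is_derive x 1 w d ->
  is_derive x 1 (fun y => y ^+ p.+1 * w y) (p.+1%:R * x ^+ p * w x + x ^+ p.+1 * d).
Proof.
move=> h; have := is_deriveM (is_derive_pow p x) h; move=> /is_derive_eq; apply.
by rewrite /GRing.scale /=; ring.
Qed.

(** The primitive is [- x ^+ p.+1 * exp (- x ^+ 2 / 2)]; the sign changes at
    [sqrt (p + 1)]. *)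
Lemma gauss_moment_rec p : gauss_moment p.+2 = (p.+1%:R%:E * gauss_moment p)%E.
Proof.
have pw0 q x : 0 <= x -> 0 <= x ^+ q * gauss_weight x.
  by move=> x0; rewrite mulr_ge0 ?exprn_ge0// expR_ge0.
have -> : (p.+1%:R%:E * gauss_moment p)%E = (\int[mu]_(x in `[0%R, +oo[) (p.+1%:R * (x ^+ p * gauss_weight x))%:E)%E.
  rewrite -ge0_integralZl//=.
  - apply/measurable_EFinP; apply: measurable_funS (continuous_measurable_fun _) => //.
    exact: continuous_pow_gauss_weight.
  - by move=> x; rewrite in_itv/= andbT => x0; rewrite lee_fin pw0.
apply: (@eq_integral_of_derive _ _ _ (fun x => -1 * (x ^+ p.+1 * gauss_weight x)) (Num.sqrt p.+1%:R)).
- exact: sqrtr_ge0.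
- exact: continuous_pow_gauss_weight.
- by move=> x; apply: cvgM; [exact: cvg_cst|exact: continuous_pow_gauss_weight].
- by move=> x; exact: pw0.
- by move=> x x0; rewrite mulr_ge0// pw0.
- move=> x; have := is_derive_scale (-1) (is_derive_pow_mul p (is_derive_gauss_weight x)).
  by move=> /is_derive_eq; apply; rewrite !exprS; ring.
- by rewrite expr0n mul0r mulr0.
- by apply: cvgN1M0; exact: cvg_pow_gauss_weight.
- move=> x /andP[x0 xa]; rewrite (_ : x ^+ p.+2 * _ = x ^+ 2 * (x ^+ p * gauss_weight x)); last by rewrite !exprS; ring.
  rewrite ler_wpM2r ?pw0//.
  by rewrite -[X in _ <= X]sqr_sqrtr// lerXn2r// nnegrE.
- move=> x xa; have x0 : 0 <= x by apply: le_trans xa; exact: sqrtr_ge0.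
  rewrite (_ : x ^+ p.+2 * _ = x ^+ 2 * (x ^+ p * gauss_weight x)); last by rewrite !exprS; ring.
  rewrite ler_wpM2r ?pw0//.
  by rewrite -[X in X <= _]sqr_sqrtr// lerXn2r// nnegrE.
Qed.

Lemma gauss_moment1 : gauss_moment 1 = 1%E.
Proof.
have dF (x : R) : is_derive x 1 (fun y => -1 * gauss_weight y) (x ^+ 1 * gauss_weight x).
  have := is_derive_scale (-1) (is_derive_gauss_weight x); move=> /is_derive_eq; apply.
  by rewrite expr1; ring.
have Foo : -1 * gauss_weight x @[x --> +oo%R] --> (0 : R).
  apply: cvgN1M0; have := @cvg_pow_gauss_weight 0.
  by under eq_fun do rewrite expr0 mul1r.
rewrite /gauss_moment (ge0_integral_derive_y dF (continuous_pow_gauss_weight (p := 1)) _ Foo).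
  by rewrite /gauss_weight expr0n mul0r oppr0 expR0 mulr1 sub0r opprK.
by move=> x x0; rewrite mulr_ge0 ?expr1// expR_ge0.
Qed.

Lemma gauss_moment_odd c : gauss_moment (2 * c).+1 = (2 ^+ c * c`!%:R)%:E.
Proof.
elim: c => [|c IH]; first by rewrite muln0 gauss_moment1 expr0 fact0 mul1r.
rewrite mulnS gauss_moment_rec IH -EFinM; congr EFin.
have -> : (2 * c).+2%:R = 2 * c.+1%:R :> R by rewrite -natrM mulnS.
by rewrite factS natrM exprS; ring.
Qed.

Definition gamma_moment p : \bar R := (\int[mu]_(x in `[0%R, +oo[) (x ^+ p * expR (- x))%:E)%E.

Lemma is_derive_expRN x : is_derive x 1 (fun y : R => expR (- y)) (- expR (- x)).
Proof.
have := @is_derive1_comp R expR (fun y : R => - y) x _ _ (is_derive_expR _) (is_deriveNid x 1).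
by move=> /is_derive_eq; apply; rewrite /= mulrN1.
Qed.

Lemma continuous_pow_expRN p : continuous (fun x : R => x ^+ p * expR (- x)).
Proof.
move=> x; apply: cvgM; first exact: exprn_continuous.
exact: is_derive_continuous is_derive_expRN x.
Qed.

(** The primitive is [- x ^+ p.+1 * exp (- x)]; the sign changes at [p + 1]. *)
Lemma gamma_moment_rec p : gamma_moment p.+1 = (p.+1%:R%:E * gamma_moment p)%E.
Proof.
have pw0 q x : 0 <= x -> 0 <= x ^+ q * expR (- x).
  by move=> x0; rewrite mulr_ge0 ?exprn_ge0// expR_ge0.
have -> : (p.+1%:R%:E * gamma_moment p)%E = (\int[mu]_(x in `[0%R, +oo[) (p.+1%:R * (x ^+ p * expR (- x)))%:E)%E.
  rewrite -ge0_integralZl//=.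
  - apply/measurable_EFinP; apply: measurable_funS (continuous_measurable_fun _) => //.
    exact: continuous_pow_expRN.
  - by move=> x; rewrite in_itv/= andbT => x0; rewrite lee_fin pw0.
apply: (@eq_integral_of_derive _ _ _ (fun x => -1 * (x ^+ p.+1 * expR (- x))) p.+1%:R).
- by [].
- exact: continuous_pow_expRN.
- by move=> x; apply: cvgM; [exact: cvg_cst|exact: continuous_pow_expRN].
- by move=> x; exact: pw0.
- by move=> x x0; rewrite mulr_ge0// pw0.
- move=> x; have := is_derive_scale (-1) (is_derive_pow_mul p (is_derive_expRN x)).
  by move=> /is_derive_eq; apply; rewrite !exprS; ring.
- by rewrite expr0n mul0r mulr0.
- by apply: cvgN1M0; exact: cvg_pow_expRN.
- by move=> x /andP[x0 xa]; rewrite exprS -mulrA ler_wpM2r ?pw0.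
- move=> x xa; have x0 : 0 <= x by apply: le_trans xa.
  by rewrite exprS -mulrA ler_wpM2r ?pw0.
Qed.

Lemma gamma_momentE c : gamma_moment c = c`!%:R%:E.
Proof.
elim: c => [|c IH]; last by rewrite gamma_moment_rec IH -EFinM -natrM.
have dF (x : R) : is_derive x 1 (fun y => -1 * expR (- y)) (x ^+ 0 * expR (- x)).
  have := is_derive_scale (-1) (is_derive_expRN x); move=> /is_derive_eq; apply.
  by rewrite expr0; ring.
have Foo : -1 * expR (- x) @[x --> +oo%R] --> (0 : R).
  apply: cvgN1M0; have := @cvg_pow_expRN 0.
  by under eq_fun do rewrite expr0 mul1r.
rewrite /gamma_moment (ge0_integral_derive_y dF (continuous_pow_expRN (p := 0)) _ Foo).
  by rewrite oppr0 expR0 mulr1 sub0r opprK.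
by move=> x x0; rewrite mulr_ge0 ?expr0// expR_ge0.
Qed.

End GaussGamma.

(** * Moments of a sum of squares of normal variables *)

Section Density.
Context d (T : measurableType d) (R : realType).
Variables (mu nu : {measure set T -> \bar R}) (w : T -> R).
Hypothesis mw : measurable_fun [set: T] w.
Hypothesis w0 : forall x, 0 <= w x.
Hypothesis nuE : forall A, measurable A -> nu A = (\int[mu]_(x in A) (w x)%:E)%E.

Let integral_indic_density E : measurable E ->
  (\int[nu]_x (\1_E x)%:E = \int[mu]_x ((\1_E x)%:E * (w x)%:E))%E.
Proof.
move=> mE; rewrite integral_indic// setIT nuE// integral_mkcond.
apply: eq_integral => x _; rewrite patchE indicE.
by case: ifPn => xE; rewrite ?mul1e ?mul0e.
Qed.

Import HBNNSimple.

Let integral_nnsfun_density (f : {nnsfun T >-> R}) :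
  (\int[nu]_x (f x)%:E = \int[mu]_x ((f x)%:E * (w x)%:E))%E.
Proof.
under [LHS]eq_integral do rewrite fimfunE -fsumEFin//.
rewrite [LHS]ge0_integral_fsum//; last 2 first.
  - by move=> r; exact/measurable_EFinP/measurableT_comp.
  - by move=> n x _; rewrite EFinM nnfun_muleindic_ge0.
under [RHS]eq_integral.
  move=> x xD; rewrite fimfunE -fsumEFin// muleC ge0_mule_fsumr; last first.
    by move=> r; rewrite EFinM nnfun_muleindic_ge0.
  over.
rewrite [RHS]ge0_integral_fsum//; last 2 first.
  - move=> r; apply: emeasurable_funM; first exact/measurable_EFinP.
    by apply/measurable_EFinP; apply/measurableT_comp.
  - move=> n x _; rewrite mule_ge0//; first by rewrite lee_fin.
    by rewrite EFinM nnfun_muleindic_ge0.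
apply: eq_fsbigr => r _.
rewrite integralZl_indic_nnsfun//= integral_indic_density//.
have [r0|r0] := leP 0 r.
  rewrite -ge0_integralZl//.
  - by apply: eq_integral => x _; rewrite [RHS]muleC EFinM -muleA.
  - by apply: emeasurable_funM; apply/measurable_EFinP.
  - by move=> x _; rewrite mule_ge0// lee_fin.
have -> : f @^-1` [set r] = set0.
  by rewrite preimage_nnfun0.
rewrite [LHS](_ : _ = 0%E); last first.
  by under eq_integral do rewrite indic0 mul0e; rewrite integral0 mule0.
by under eq_integral do rewrite indic0 mulr0 mule0; rewrite integral0.
Qed.

(** The change of measure for a density, from indicators to simple functions to
    monotone limits. *)
Lemma ge0_integral_density (f : T -> \bar R) :
  measurable_fun [set: T] f -> (forall x, 0 <= f x)%E ->
  (\int[nu]_x f x = \int[mu]_x (f x * (w x)%:E))%E.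
Proof.
move=> mf f0.
pose f_ := nnsfun_approx measurableT mf.
transitivity (lim (\int[nu]_x (f_ n x)%:E @[n --> \oo])%E).
  rewrite -monotone_convergence//=.
  - apply: eq_integral => ? /[!inE] xD; apply/esym/cvg_lim => //=.
    exact: cvg_nnsfun_approx.
  - by move=> n; exact/measurable_EFinP/measurable_funTS.
  - by move=> n ? _; rewrite lee_fin.
  - by move=> ? _ ? ? mn; rewrite lee_fin; exact/lefP/nd_nnsfun_approx.
transitivity (lim (\int[mu]_x ((f_ n x)%:E * (w x)%:E) @[n --> \oo])%E).
  by apply: congr_lim; apply/funext => n /=; exact: integral_nnsfun_density.
rewrite -monotone_convergence//=.
- apply: eq_integral => x /[!inE] xD; apply: cvg_lim => //=.
  by apply: cvgeMr => //; exact: cvg_nnsfun_approx.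
- by move=> n; apply: emeasurable_funM; apply/measurable_EFinP => //; exact: measurable_funTS.
- by move=> n ? _; rewrite mule_ge0// lee_fin.
- move=> x _ ? ? mn; rewrite lee_wpmul2r ?lee_fin//; exact/lefP/nd_nnsfun_approx.
Qed.

End Density.

Section RiseMoments.
Context {R : realType}.

(** The moments of twice a Gamma variable of parameter [p]. *)
Definition rise_moments d (T : measurableType d) (mu : {measure set T -> \bar R})
    (g : T -> R) (p : R) : Prop :=
  [/\ measurable_fun [set: T] g, forall x, 0 <= g x &
   forall i, (\int[mu]_x (g x ^+ i)%:E = (2 ^+ i * rise p i)%:E)%E].

(** Fubini and the binomial formula reduce the statement to Vandermonde's
    identity for rising factorials. *)
Lemma rise_moments_conv d1 d2 (T1 : measurableType d1) (T2 : measurableType d2)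
  (m1 : probability T1 R) (m2 : probability T2 R)
  (g1 : T1 -> R) (g2 : T2 -> R) (p1 p2 : R) :
  rise_moments m1 g1 p1 -> rise_moments m2 g2 p2 -> 0 <= p1 -> 0 <= p2 ->
  rise_moments (m1 \x m2)%E (fun z => g1 z.1 + g2 z.2) (p1 + p2).
Proof.
move=> [mg1 g10 h1] [mg2 g20 h2] p10 p20.
have mg : measurable_fun [set: T1 * T2] (fun z => g1 z.1 + g2 z.2).
  by apply: measurable_funD; apply: measurableT_comp.
split => // [z|c]; first by rewrite addr_ge0.
rewrite fubini_tonelli1//=; first last.
  by move=> z; rewrite lee_fin exprn_ge0// addr_ge0.
  by apply/measurable_EFinP; exact: measurable_funX.
rewrite /fubini_F /=.
have inner x : (\int[m2]_y ((g1 x + g2 y) ^+ c)%:E)%E =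
   (\sum_(i < c.+1) ('C(c, i)%:R * (2 ^+ i * rise p2 i))%:E * (g1 x ^+ (c - i))%:E)%E.
  transitivity (\int[m2]_y (\sum_(i < c.+1) ('C(c, i)%:R * g1 x ^+ (c - i))%:E * (g2 y ^+ i)%:E))%E.
    apply: eq_integral => y _; rewrite exprDn -sumEFin; apply: eq_bigr => i _.
    by rewrite -EFinM; congr EFin; rewrite -mulr_natl; ring.
  rewrite ge0_integral_sum//=; first last.
  - by move=> i y _; apply: mule_ge0; rewrite lee_fin ?exprn_ge0// mulr_ge0// exprn_ge0.
  - move=> i; apply/measurable_EFinP; apply: measurable_funM => //.
    exact: measurable_funX.
  apply: eq_bigr => i _.
  rewrite ge0_integralZl//=.
  - by rewrite h2 -!EFinM; congr EFin; ring.
  - by apply/measurable_EFinP; exact: measurable_funX.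
  - by move=> y _; rewrite lee_fin exprn_ge0.
  - by rewrite lee_fin mulr_ge0// exprn_ge0.
under eq_integral do rewrite inner.
have r0 i : 0 <= 2 ^+ i * rise p2 i by rewrite mulr_ge0 ?exprn_ge0// rise_ge0.
rewrite ge0_integral_sum//=; first last.
- by move=> i y _; apply: mule_ge0; rewrite lee_fin ?exprn_ge0// mulr_ge0// exprn_ge0.
- move=> i; apply/measurable_EFinP; apply: measurable_funM => //.
  exact: measurable_funX.
transitivity (\sum_(i < c.+1) ('C(c, i)%:R * (2 ^+ i * rise p2 i) * (2 ^+ (c - i) * rise p1 (c - i)))%:E)%E.
  apply: eq_bigr => i _; rewrite ge0_integralZl//=.
  - by rewrite h1 -!EFinM.
  - by apply/measurable_EFinP; exact: measurable_funX.
  - by move=> y _; rewrite lee_fin exprn_ge0.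
  - by rewrite lee_fin mulr_ge0.
rewrite sumEFin -rise_binomial mulr_sumr; congr EFin; apply: eq_bigr => i _.
have -> : 2 ^+ c = 2 ^+ i * 2 ^+ (c - i) :> R by rewrite -exprD subnKC// -ltnS.
by ring.
Qed.

Lemma normal_pdf_gauss_weight (x : R) : normal_pdf 0 1 x = normal_peak 1 * gauss_weight x.
Proof.
rewrite normal_pdfE ?oner_eq0// /normal_fun subr0 expr1n.
by rewrite /gauss_weight mulNr mulr2n.
Qed.

Lemma normal_pow_half j :
  (\int[lebesgue_measure]_x (((x ^+ 2) ^+ j)%:E * (normal_pdf 0 1 x)%:E) =
    2%:E * ((normal_peak 1)%:E * gauss_moment R (2 * j)))%E.
Proof.
have cont : continuous (fun x : R => (x ^+ 2) ^+ j * normal_pdf 0 1 x).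
  move=> x; under eq_fun do rewrite normal_pdf_gauss_weight mulrCA -exprM.
  by apply: cvgM; [exact: cvg_cst|exact: continuous_pow_gauss_weight].
under eq_integral do rewrite -EFinM.
rewrite ge0_symfun_integralT//; first last.
- by move=> x /=; rewrite !normal_pdf_gauss_weight /gauss_weight !sqrrN.
- by move=> x; apply: mulr_ge0; [apply: exprn_ge0; exact: sqr_ge0|exact: normal_pdf_ge0].
congr (_ * _)%E; rewrite -set_itvcy -ge0_integralZl//=.
- by apply: eq_integral => x _; rewrite -EFinM normal_pdf_gauss_weight mulrCA exprM.
- apply/measurable_EFinP; apply: measurable_funS (continuous_measurable_fun _) => //.
  exact: continuous_pow_gauss_weight.
- move=> x; rewrite in_itv/= andbT => x0.
  by rewrite lee_fin mulr_ge0 ?exprn_ge0// expR_ge0.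
- by rewrite lee_fin; exact: normal_peak_ge0.
Qed.

Lemma normal_mass_half : (2%:E * ((normal_peak 1)%:E * gauss_moment R 0) = 1)%E.
Proof.
rewrite -[RHS](integral_normal_pdf (0 : R) 1) -(normal_pow_half 0).
by apply: eq_integral => x _; rewrite expr0 mul1e.
Qed.

(** The square of a standard normal variable is twice a Gamma variable of
    parameter one half. *)
Lemma rise_moments_normal : rise_moments (normal_prob (0 : R) 1) (fun x => x ^+ 2) 2^-1.
Proof.
split => [|x|i]; [exact: measurable_funX|exact: sqr_ge0|].
rewrite (@ge0_integral_density _ _ R lebesgue_measure _ (normal_pdf 0 1))//=; first last.
- by move=> x; rewrite lee_fin exprn_ge0// sqr_ge0.
- by apply/measurable_EFinP; apply: measurable_funX; exact: measurable_funX.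
- by move=> x; exact: normal_pdf_ge0.
- exact: measurable_normal_pdf.
rewrite normal_pow_half; elim: i => [|i IH].
  by rewrite rise0 expr0 mulr1 muln0 normal_mass_half.
rewrite mulnS gauss_moment_rec.
rewrite (muleCA (normal_peak 1)%:E) (muleCA 2%:E) IH -EFinM; congr EFin.
by rewrite riseS exprS -natr1 natrM; field.
Qed.

End RiseMoments.

(** * Three representations of the limit law *)

Section WeightedMean.
Context d (T : measurableType d) (R : realType).
Variables (mu : {measure set T -> \bar R}) (D : set T) (w Y : T -> R).
Hypothesis mD : measurable D.
Hypothesis mw : measurable_fun D w.
Hypothesis w0 : forall x, D x -> 0 <= w x.
Hypothesis mY : measurable_fun D Y.
Hypothesis Y0 : forall x, D x -> 0 <= Y x.
Variable mom : nat -> R.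
Hypothesis momE : forall q, (\int[mu]_(x in D) (Y x ^+ (2 * q) * w x)%:E = (mom q)%:E)%E.
Hypothesis mom0 : mom 0 = 1.

Let measurable_poly_growth (f : R -> R) : continuous f ->
  measurable_fun D (fun x => f (Y x) * w x).
Proof.
move=> cf; apply: measurable_funM => //.
by apply: measurableT_comp mY => //; exact: continuous_measurable_fun.
Qed.

(** Dominated by two even moments. *)
Lemma weighted_integrable (f : R -> R) : poly_growth f ->
  mu.-integrable D (EFin \o (fun x => f (Y x) * w x)).
Proof.
move=> [cf [C C0 [p hf]]].
have ipow q : mu.-integrable D (EFin \o (fun x => Y x ^+ (2 * q) * w x)).
  apply/integrableP; split.
    by apply/measurable_EFinP; apply: (measurable_poly_growth (f := fun y => y ^+ (2 * q))); exact: exprn_continuous.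
  under eq_integral.
    move=> x /[!inE] Dx; rewrite /= ger0_norm; last first.
      by apply: mulr_ge0; [apply: exprn_ge0; exact: Y0|exact: w0].
    over.
  by rewrite momE ltry.
apply: (@le_integrable _ _ _ mu D mD _ (EFin \o (fun x => C * (Y x ^+ (2 * 0) * w x + Y x ^+ (2 * p) * w x)))).
- by apply/measurable_EFinP; exact: measurable_poly_growth.
- move=> x Dx; rewrite lee_fin normrM (ger0_norm (w0 Dx)).
  apply: le_trans (ler_norm _); rewrite -mulrDl mulrA muln0 expr0.
  by rewrite ler_wpM2r ?w0// hf// Y0.
- have := integrableZl mD C (integrableD mD (ipow 0%N) (ipow p)).
  by apply: eq_integrable => // x _; rewrite /= EFinM EFinD.
Qed.

Definition weighted_mean (f : R -> R) : R := \int[mu]_(x in D) (f (Y x) * w x).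

Lemma weighted_mean_moment q : weighted_mean (fun x => x ^+ (2 * q)) = mom q.
Proof. by rewrite /weighted_mean /Rintegral momE. Qed.

Lemma weighted_mean_functional : mean_functional weighted_mean.
Proof.
split.
- move=> a f g pf pg; rewrite /weighted_mean.
  have iF := weighted_integrable pf; have iG := weighted_integrable pg.
  rewrite -RintegralZl// -RintegralD//.
    by apply: eq_Rintegral => x _; ring.
  have := integrableZl mD a iF; apply: eq_integrable => // x _.
- move=> f g pf pg fg; apply: le_Rintegral => //; try exact: weighted_integrable.
  by move=> x Dx; rewrite ler_wpM2r ?w0// fg// Y0.
- rewrite -[RHS]mom0 -weighted_mean_moment; apply: eq_Rintegral => x _.
  by rewrite muln0 expr0.
Qed.

End WeightedMean.

Section Unique.
Variable R : realType.
Implicit Types (L : (R -> R) -> R).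

Definition chi_moment (kappa : R) (c : nat) : R := kappa ^+ (2 * c) * (c.+1)`!%:R.

(** The moments [(K + 1)!] grow much more slowly than [(2 K)!], so that the
    terms are dominated by those of an exponential series. *)
Lemma chi_moment_small (kappa t : R) :
  t ^+ (2 * K) / (2 * K)`!%:R * chi_moment kappa K @[K --> \oo] --> (0 : R).
Proof.
pose a := 2 * ((t * kappa) ^+ 2).
have a0 : 0 <= a by rewrite mulr_ge0// sqr_ge0.
apply: (@squeeze_cvgr _ _ _ _ (cst 0) (exp_coeff a)); last 2 first.
- exact: cvg_cst.
- exact: cvg_series_cvg_0 (is_cvg_series_exp_coeff a).
near=> K.
have p2 (x : R) : 0 <= x ^+ (2 * K) by rewrite exprM exprn_ge0// sqr_ge0.
rewrite /cst /=; apply/andP; split.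
  by apply: mulr_ge0; [apply: divr_ge0|apply: mulr_ge0].
rewrite /chi_moment /exp_coeff /=.
rewrite [X in X <= _](_ : _ = (K.+1`!%:R / (2 * K)`!%:R) * (t * kappa) ^+ (2 * K)); last first.
  by rewrite exprMn; ring.
rewrite [X in _ <= X](_ : _ = (2 ^+ K / K`!%:R) * (t * kappa) ^+ (2 * K)); last first.
  by rewrite /a exprMn -exprM; ring.
rewrite ler_wpM2r// ler_pdivrMr ?ltr0n ?fact_gt0//.
rewrite mulrAC ler_pdivlMr ?ltr0n ?fact_gt0// -natrX -!natrM ler_nat.
have -> : ((2 * K)`! = 'C(2 * K, K) * (K`! * K`!))%N.
  have KK : (K <= 2 * K)%N by rewrite mul2n -addnn leq_addr.
  by rewrite -(bin_fact KK) mul2n -addnn addnK.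
have C0 : (0 < 'C(2 * K, K))%N by rewrite bin_gt0 mul2n -addnn leq_addr.
rewrite factS -[X in (X <= _)%N]mulnA [X in (_ <= X)%N]mulnA; apply: leq_mul => //.
by apply: leq_trans (ltn_expl K (ltnSn 1)) _; rewrite leq_pmulr.
Unshelve. all: by end_near. Qed.

(** Equal even moments give equal means of cosines, hence of all functions of
    polynomial growth. *)
Lemma mean_unique L1 L2 (kappa : R) : mean_functional L1 -> mean_functional L2 ->
  (forall q, L1 (fun x => x ^+ (2 * q)) = chi_moment kappa q) ->
  (forall q, L2 (fun x => x ^+ (2 * q)) = chi_moment kappa q) ->
  forall f, poly_growth f -> L1 f = L2 f.
Proof.
move=> m1 m2 h1 h2 f pf.
have hc t : L1 (fun x => cos (t * x)) = L2 (fun x => cos (t * x)).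
  apply/eqP; rewrite -subr_eq0 -normr_le0; apply/ler_addgt0Pl => e e0; rewrite addr0.
  have [K [dl [d0 hd]]] := cos_of_moments (chi_moment_small kappa t) e0.
  by apply: hd => // c _; rewrite ?h1 ?h2 subrr normr0 ltW.
have hcos t : (fun=> L1) n (fun x => cos (t * x)) @[n --> \oo] --> L2 (fun x => cos (t * x)).
  by rewrite -hc; exact: cvg_cst.
have hb q : exists2 C : R, 0 <= C & exists N, forall n, (N <= n)%N -> L1 (fun x => x ^+ (2 * q)) <= C.
  exists `|chi_moment kappa q| => //; exists 0%N => n _; rewrite h1; exact: ler_norm.
have h := @cvg_poly_growth R (fun=> L1) L2 (fun=> m1) m2 hcos hb f pf.
by apply: cvg_unique h => //; exact: cvg_cst.
Qed.

Lemma continuous_norm_powR (r : R) : 0 < r -> continuous (fun x : R => `|x| `^ r).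
Proof.
move=> r0 x; have [->|xn0] := eqVneq x 0.
  apply/cvgrPdist_le => e e0.
  have d0 : 0 < e `^ r^-1 by rewrite powR_gt0.
  near=> y.
  rewrite normr0 powR0 ?gt_eqF// sub0r normrN ger0_norm ?powR_ge0//.
  have yd : `|y| <= e `^ r^-1.
    near: y; apply/nbhs_ballP; exists (e `^ r^-1) => //= y.
    by rewrite /ball /= sub0r normrN => /ltW.
  apply: (@le_trans _ _ ((e `^ r^-1) `^ r)).
    by rewrite ge0_ler_powR ?nnegrE ?powR_ge0// ltW.
  by rewrite -powRrM mulVf ?powRr1 ?(ltW e0)// gt_eqF.
apply: (@continuous_comp _ _ _ (fun x : R => `|x|) (fun y : R => y `^ r)).
  exact: norm_continuous.
apply: differentiable_continuous; apply/derivable1_diffP.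
by apply: derivable_powR; rewrite in_itv/= andbT normr_gt0.
Unshelve. all: by end_near. Qed.

Lemma poly_growth_powR (r : R) : 0 < r -> poly_growth (fun x : R => `|x| `^ r).
Proof.
move=> r0; split; first exact: continuous_norm_powR.
exists 1 => //; exists (Num.truncn r).+1 => x x0.
rewrite mul1r ger0_norm ?powR_ge0// (ger0_norm x0).
have [x1|x1] := leP x 1.
  apply: (@le_trans _ _ 1); last by rewrite lerDl exprn_ge0.
  by have := @ge0_ler_powR R r (ltW r0) x 1; rewrite !nnegrE powR1 => ->.
apply: (@le_trans _ _ (x ^+ (2 * (Num.truncn r).+1))); last by rewrite lerDr.
rewrite -powR_mulrn// ler_powR ?(ltW x1)//.
apply: (@le_trans _ _ (Num.truncn r).+1%:R); first exact/ltW/truncnS_gt.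
by rewrite ler_nat mul2n -addnn leq_addr.
Qed.

End Unique.

Section ChiLaws.
Variable R : realType.
Notation mu := (@lebesgue_measure R).
Notation cc := (pi / (2 * Num.sqrt 2) : R).

Lemma chi_scale_ge0 : 0 <= cc.
Proof. by rewrite divr_ge0 ?pi_ge0// mulr_ge0. Qed.

(** The constant [pi / (2 * sqrt 2)] turns [2 ^+ q] times the Gamma moment into
    [(pi / 2) ^+ (2 * q)] times it. *)
Lemma chi_scale_pow q : cc ^+ (2 * q) * 2 ^+ q = (pi / 2) ^+ (2 * q).
Proof.
rewrite !exprM -exprMn; congr (_ ^+ _).
by rewrite expr_div_n exprMn sqr_sqrtr//; field.
Qed.

Definition chi_density (x : R) : R := 2^-1 * (x ^+ 3 * gauss_weight x).
(** The law of [pi / (2 * sqrt 2) * chi_4], through the density of [chi_4]. *)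
Definition mean_chi_density : (R -> R) -> R := weighted_mean mu `[(0%R : R), +oo[ chi_density (fun x => cc * x).
(** The same law as that of [pi / 2 * sqrt t] for [t] of density [t * exp (-
    t)]. *)
Definition mean_gamma : (R -> R) -> R :=
  weighted_mean mu `](0%R : R), +oo[ (fun t => t ^+ 1 * expR (- t)) (fun t => pi / 2 * Num.sqrt t).

Lemma continuous_chi_density : continuous chi_density.
Proof. by move=> x; apply: cvgM; [exact: cvg_cst|exact: continuous_pow_gauss_weight]. Qed.

Lemma mean_chi_density_spec : mean_functional mean_chi_density /\
  forall q, mean_chi_density (fun x => x ^+ (2 * q)) = chi_moment (pi / 2) q.
Proof.
have mw : measurable_fun `[(0%R : R), +oo[ chi_density.
  by apply: measurable_funS (continuous_measurable_fun continuous_chi_density).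
have w0 (x : R) : `[(0%R : R), +oo[%classic x -> 0 <= chi_density x.
  by rewrite /= in_itv/= andbT => x0; rewrite mulr_ge0// mulr_ge0 ?exprn_ge0// expR_ge0.
have mY : measurable_fun `[(0%R : R), +oo[ (fun x : R => cc * x).
  by apply: measurable_funM.
have Y0 (x : R) : `[(0%R : R), +oo[%classic x -> 0 <= cc * x.
  by rewrite /= in_itv/= andbT => x0; rewrite mulr_ge0// chi_scale_ge0.
have momE q : (\int[mu]_(x in `[(0%R : R), +oo[) ((cc * x) ^+ (2 * q) * chi_density x)%:E = (chi_moment (pi / 2) q)%:E)%E.
  transitivity ((cc ^+ (2 * q) / 2)%:E * gauss_moment R (2 * q.+1).+1)%E.
    rewrite /gauss_moment -ge0_integralZl//=.
    - apply: eq_integral => x _; rewrite -EFinM; congr EFin.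
      rewrite exprMn /chi_density (_ : (2 * q.+1).+1 = 2 * q + 3)%N; last by rewrite mulnS !addnS addn0.
      by rewrite exprD; ring.
    - apply/measurable_EFinP; apply: measurable_funS (continuous_measurable_fun _) => //.
      exact: continuous_pow_gauss_weight.
    - move=> x; rewrite in_itv/= andbT => x0.
      by rewrite lee_fin mulr_ge0 ?exprn_ge0// expR_ge0.
    - by rewrite lee_fin divr_ge0// exprn_ge0// chi_scale_ge0.
  rewrite gauss_moment_odd -EFinM; congr EFin; rewrite /chi_moment -chi_scale_pow exprS.
  by field.
have mom0 : chi_moment (pi / 2) 0 = 1 :> R by rewrite /chi_moment muln0 expr0 mul1r.
split; first exact: (weighted_mean_functional (mu := mu) (mom := chi_moment (pi / 2)) (measurable_itv _) mw w0 mY Y0 momE mom0).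
by move=> q; exact: (weighted_mean_moment (mu := mu) (mom := chi_moment (pi / 2)) momE q).
Qed.

Lemma mean_gamma_spec : mean_functional mean_gamma /\
  forall q, mean_gamma (fun x => x ^+ (2 * q)) = chi_moment (pi / 2) q.
Proof.
have mw : measurable_fun `](0%R : R), +oo[ (fun t : R => t ^+ 1 * expR (- t)).
  apply: measurable_funS (continuous_measurable_fun _) => //.
  exact: continuous_pow_expRN.
have w0 (x : R) : `](0%R : R), +oo[%classic x -> 0 <= x ^+ 1 * expR (- x).
  by rewrite /= in_itv/= andbT => x0; rewrite mulr_ge0 ?exprn_ge0 ?(ltW x0)// expR_ge0.
have mY : measurable_fun `](0%R : R), +oo[ (fun x : R => pi / 2 * Num.sqrt x).
  apply: measurable_funS (continuous_measurable_fun _) => // x.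
  by apply: cvgM; [exact: cvg_cst|exact: sqrt_continuous].
have Y0 (x : R) : `](0%R : R), +oo[%classic x -> 0 <= pi / 2 * Num.sqrt x.
  by move=> _; rewrite mulr_ge0// divr_ge0// pi_ge0.
have momE q : (\int[mu]_(x in `](0%R : R), +oo[) ((pi / 2 * Num.sqrt x) ^+ (2 * q) * (x ^+ 1 * expR (- x)))%:E = (chi_moment (pi / 2) q)%:E)%E.
  transitivity (((pi / 2) ^+ (2 * q))%:E * gamma_moment R q.+1)%E.
    rewrite /gamma_moment -integral_itv_obnd_cbnd; last first.
      apply/measurable_EFinP; apply: measurable_funS (continuous_measurable_fun _) => //.
      exact: continuous_pow_expRN.
    rewrite -ge0_integralZl//=.
    - apply: eq_integral => x; rewrite inE /= in_itv/= andbT => x0.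
      rewrite -EFinM; congr EFin.
      rewrite exprMn (exprM (Num.sqrt x)) sqr_sqrtr ?(ltW x0)// expr1 exprSr.
      by ring.
    - apply/measurable_EFinP; apply: measurable_funS (continuous_measurable_fun _) => //.
      exact: continuous_pow_expRN.
    - move=> x; rewrite in_itv/= andbT => x0.
      by rewrite lee_fin mulr_ge0 ?exprn_ge0 ?(ltW x0)// expR_ge0.
    - by rewrite lee_fin exprn_ge0// divr_ge0// pi_ge0.
  by rewrite gamma_momentE -EFinM.
have mom0 : chi_moment (pi / 2) 0 = 1 :> R by rewrite /chi_moment muln0 expr0 mul1r.
split; first exact: (weighted_mean_functional (mu := mu) (mom := chi_moment (pi / 2)) (measurable_itv _) mw w0 mY Y0 momE mom0).
by move=> q; exact: (weighted_mean_moment (mu := mu) (mom := chi_moment (pi / 2)) momE q).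
Qed.

End ChiLaws.

(** * Moments of the limit law *)

Section ChiLaw.
Variable R : realType.
Notation cc := (pi / (2 * Num.sqrt 2) : R).

Lemma rise_two q : rise 2 q = (q.+1)`!%:R :> R.
Proof. by have := rise_one R q.+1; rewrite riseSl mul1r => <-; congr rise. Qed.

(** If the integral is infinite both sides are 0 by convention, so that the
    identity covers this case. *)
Lemma Rintegral_scale d (T : measurableType d) (mu : {measure set T -> \bar R})
    (D : set T) (a : R) (f : T -> R) : measurable D -> measurable_fun D f ->
  (forall x, D x -> 0 <= f x) -> 0 < a ->
  \int[mu]_(x in D) (a * f x) = a * \int[mu]_(x in D) f x.
Proof.
move=> mD mf f0 a0; rewrite /Rintegral.
under eq_integral do rewrite EFinM.
rewrite ge0_integralZl//; [|exact/measurable_EFinP|by rewrite lee_fin ltW].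
case: (\int[mu]_(x in D) (f x)%:E)%E => [x| |]; first by [].

- by rewrite gt0_muley ?lte_fin//= mulr0.
- by rewrite gt0_muleNy ?lte_fin//= mulr0.
Qed.

(** In this representation the r-th moment is a Gamma integral by definition. *)
Lemma mean_gamma_powR (r : R) : 0 < r ->
  mean_gamma (fun x : R => `|x| `^ r) = (pi / 2) `^ r * Gamma (r / 2 + 2).
Proof.
move=> r0.
have p0 : 0 < pi / 2 :> R by rewrite divr_gt0// pi_gt0.
rewrite /mean_gamma /weighted_mean /Gamma -Rintegral_scale//; last 2 first.
- by move=> t _; rewrite mulr_ge0 ?powR_ge0// expR_ge0.
- by rewrite powR_gt0.
- apply: eq_Rintegral => t; rewrite inE/= in_itv/= andbT => t0.
  rewrite /= (ger0_norm (mulr_ge0 (ltW p0) (sqrtr_ge0 t))) (powRM _ (ltW p0) (sqrtr_ge0 t)).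
  rewrite -(powR12_sqrt (ltW t0)).
  rewrite -powRrM -mulrA; congr (_ * _); rewrite mulrA; congr (_ * _).
  rewrite (_ : r / 2 + 2 - 1 = 2^-1 * r + 1); last by field.
  by rewrite powRD ?(gt_eqF t0) ?implybT// powRr1// ltW.
- apply: measurable_funM; first by apply: measurable_funS (measurable_powR _).
  apply: measurable_funS (continuous_measurable_fun _) => // t.
  have := @continuous_pow_expRN R 0 t; rewrite (_ : (fun _ => _) = (fun y : R => expR (- y)))//.
  by apply/funext => y; rewrite expr0 mul1r.
Qed.

(** In this representation the first moment is the fourth Gaussian moment, known
    from [gauss_moment_rec] and the mass of the normal law. *)
Lemma mean_chi_density_id : mean_chi_density (fun x : R => x) = 3 * pi `^ (3 / 2) / 8.
Proof.
have pi0 : 0 < pi :> R by exact: pi_gt0.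
have g0 : gauss_moment R 0 = (Num.sqrt (pi *+ 2) / 2)%:E.
  have := @normal_mass_half R.
  rewrite /normal_peak expr1n mul1r.
  have s0 : 0 < Num.sqrt (pi *+ 2) :> R by rewrite sqrtr_gt0 pmulrn_lgt0.
  case: (gauss_moment R 0) => [x||].
  - rewrite -!EFinM => -[] h; congr EFin.
    have -> : x = (2 * ((Num.sqrt (pi *+ 2))^-1 * x)) * (Num.sqrt (pi *+ 2) / 2) by field; rewrite gt_eqF.
    by rewrite h mul1r.
  - by rewrite gt0_muley ?lte_fin ?invr_gt0// gt0_muley ?lte_fin.
  - by rewrite gt0_muleNy ?lte_fin ?invr_gt0// gt0_muleNy ?lte_fin.
rewrite /mean_chi_density /weighted_mean /Rintegral.
transitivity (fine ((cc / 2)%:E * gauss_moment R 4)%E).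
  congr fine; rewrite /gauss_moment -ge0_integralZl//=.
  - apply: eq_integral => x _; rewrite -EFinM; congr EFin.
    by rewrite /chi_density (exprS x 3); ring.
  - apply/measurable_EFinP; apply: measurable_funS (continuous_measurable_fun _) => //.
    exact: continuous_pow_gauss_weight.
  - move=> x; rewrite in_itv/= andbT => x0.
    by rewrite lee_fin mulr_ge0 ?exprn_ge0// expR_ge0.
  - by rewrite lee_fin divr_ge0// chi_scale_ge0.
rewrite !gauss_moment_rec g0 -!EFinM /=.
rewrite (_ : 3 / 2 = 1 + 2^-1 :> R); last by field.
rewrite powRD ?(gt_eqF pi0) ?implybT// powRr1 ?(ltW pi0)// powR12_sqrt ?(ltW pi0)//.
rewrite (_ : pi *+ 2 = 2 * pi :> R) ?sqrtrM// ?[RHS]mulr_natl//.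
by field; rewrite gt_eqF// sqrtr_gt0.
Qed.

Section ScaledRoot.
Context d (T : measurableType d) (P : probability T R) (s : T -> R).
Hypothesis hs : rise_moments P s 2.

Let rt (x : T) : R := Num.sqrt (s x).

Lemma measurable_sqrt_of : measurable_fun [set: T] rt.
Proof.
case: hs => ms _ _.
have msq : measurable_fun [set: R] (@Num.sqrt R).
  by apply: continuous_measurable_fun; exact: sqrt_continuous.
exact: (measurableT_comp msq ms).
Qed.

Let meas1 : measurable_fun [set: T] (fun=> 1 : R).
Proof. exact: measurable_cst. Qed.

Let measY : measurable_fun [set: T] (fun x => cc * rt x).
Proof. by apply: measurable_funM => //; exact: measurable_sqrt_of. Qed.

Let Y0 (z : T) : [set: T] z -> 0 <= cc * rt z.
Proof. by move=> _; rewrite mulr_ge0 ?chi_scale_ge0// sqrtr_ge0. Qed.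

Let momE q : (\int[P]_(x in setT) ((cc * rt x) ^+ (2 * q) * 1)%:E)%E
  = (chi_moment (pi / 2) q)%:E.
Proof.
case: hs => ms s0 hsi.
transitivity ((cc ^+ (2 * q))%:E * \int[P]_x (s x ^+ q)%:E)%E.
  rewrite -ge0_integralZl//=.
  - apply: eq_integral => x _; rewrite -EFinM; congr EFin.
    by rewrite mulr1 exprMn /rt (exprM (Num.sqrt _)) sqr_sqrtr.
  - by apply/measurable_EFinP; exact: measurable_funX.
  - by move=> x _; rewrite lee_fin exprn_ge0.
  - by rewrite lee_fin exprn_ge0// chi_scale_ge0.
by rewrite hsi -EFinM rise_two mulrA chi_scale_pow.
Qed.

(** The same law, as the image of a law whose variable [s] has the moments of
    twice a Gamma variable of parameter 2, such as the squared norm of a normal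
    vector. *)
Definition mean_scaled_root : (R -> R) -> R := weighted_mean P setT (fun=> 1) (fun x => cc * rt x).

Lemma mean_scaled_root_spec : mean_functional mean_scaled_root /\
  forall q, mean_scaled_root (fun x => x ^+ (2 * q)) = chi_moment (pi / 2) q :> R.
Proof.
have mom0 : chi_moment (pi / 2) 0 = 1 :> R by rewrite /chi_moment muln0 expr0 mul1r.
split; first exact: (weighted_mean_functional (mu := P) (mom := chi_moment (pi / 2)) measurableT meas1 (fun _ _ => ler01) measY Y0 momE mom0).
by move=> q; exact: (weighted_mean_moment (mu := P) (mom := chi_moment (pi / 2)) momE q).
Qed.

Lemma mean_scaled_root_integrable (f : R -> R) : poly_growth f ->
  P.-integrable setT (EFin \o (fun x => f (cc * rt x) * 1)).
Proof.
exact: (weighted_integrable (mu := P) (mom := chi_moment (pi / 2)) measurableT meas1 (fun _ _ => ler01) measY Y0 momE).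
Qed.

Variables (dS : measure_display) (S : measurableType dS) (Q : probability S R).
Variable X : {RV Q >-> R}.
Hypothesis hX : forall A, measurable A -> distribution Q X A = P (rt @^-1` A).

HB.instance Definition _ := @isMeasurableFun.Build _ _ _ _ rt measurable_sqrt_of.
Let rtN : {RV P >-> R} := rt.

Let eq_dist (f : R -> \bar R) :
  (\int[distribution Q X]_y f y = \int[distribution P rtN]_y f y)%E.
Proof. apply: eq_measure_integral => A mA _; exact: hX. Qed.

(** Transfer of expectations along the equality of laws; [h] is only prescribed
    on the half-line, where the square root takes its values. *)
Lemma expectation_scaled_root (h f : R -> R) : poly_growth f -> measurable_fun [set: R] h ->
  (forall y, 0 <= y -> h y = f (cc * y)) ->
  'E_Q[fun w => h (X w)]%E = (mean_scaled_root f)%:E.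
Proof.
move=> pf mh hf.
have iN := mean_scaled_root_integrable pf.
have hN x : h (rt x) = f (cc * rt x) * 1.
  by rewrite mulr1 hf// sqrtr_ge0.
have iN' : P.-integrable setT ((EFin \o h) \o rtN).
  by apply: eq_integrable iN => // x _; rewrite /= hN.
have mhE : measurable_fun [set: R] (EFin \o h) by exact/measurable_EFinP.
have iQ : Q.-integrable setT ((EFin \o h) \o X).
  apply/integrableP; split; first exact: measurableT_comp.
  have -> : (\int[Q]_x `|((EFin \o h) \o X) x| = \int[distribution Q X]_y `|(h y)%:E|)%E.
    rewrite (ge0_integral_distribution X (f := fun y => `|(h y)%:E|%E))//.
    exact: measurableT_comp.
  rewrite eq_dist (ge0_integral_distribution rtN (f := fun y => `|(h y)%:E|%E))//; last first.
    exact: measurableT_comp.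
  by have /integrableP[_] := iN'.
rewrite unlock; transitivity (\int[distribution Q X]_y (EFin \o h) y)%E.
  by rewrite (integral_distribution mhE iQ).
rewrite eq_dist (integral_distribution mhE iN').
rewrite /mean_scaled_root /weighted_mean /Rintegral fineK; last exact: (integrable_fin_num measurableT iN).
by apply: eq_integral => x _ /=; rewrite hN.
Qed.

Lemma mean_scaled_root_powR (r : R) : 0 < r ->
  mean_scaled_root (fun x : R => `|x| `^ r) = (pi / 2) `^ r * Gamma (r / 2 + 2).
Proof.
move=> r0; have [mN hN] := mean_scaled_root_spec; have [mJ hJ] := mean_gamma_spec R.
have -> := mean_unique mN mJ hN hJ (poly_growth_powR r0).
by rewrite mean_gamma_powR.
Qed.

Lemma mean_scaled_root_id : mean_scaled_root (fun x : R => x) = 3 * pi `^ (3 / 2) / 8.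
Proof.
have [mN hN] := mean_scaled_root_spec; have [mG hG] := mean_chi_density_spec R.
rewrite -mean_chi_density_id; apply: (mean_unique mN mG hN hG (f := fun x : R => x)).
split; first by move=> x; exact: cvg_id.
by exists 1 => //; exists 1%N => x x0; rewrite ger0_norm// mul1r; nra.
Qed.

End ScaledRoot.

Definition sumsq4 (z : R * R * R * R) : R :=
  (z.1.1.1 ^+ 2 + z.1.1.2 ^+ 2) + z.1.2 ^+ 2 + z.2 ^+ 2.

Notation mR := (measurableTypeR R).

(** The measure is rebuilt as a [probability] so that the convolution lemma
    applies three times. *)
Lemma std_normal4_moments : exists2 P : probability (mR * mR * mR * mR)%type R,
  rise_moments P sumsq4 2 & forall A, P A = @std_normal4 R A.
Proof.
have h := @rise_moments_normal R.
have i2 : 0 <= 2^-1 :> R by rewrite invr_ge0.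
pose N1 : probability _ R := normal_prob (0 : R) 1.
pose N2 : probability _ R := (N1 \x N1)%E.
pose N3 : probability _ R := (N2 \x N1)%E.
pose N4 : probability _ R := (N3 \x N1)%E.
have h2 : rise_moments N2 (fun z => z.1 ^+ 2 + z.2 ^+ 2) (2^-1 + 2^-1).
  exact: (@rise_moments_conv R _ _ _ _ N1 N1 _ _ _ _ h h i2 i2).
have h3 : rise_moments N3 (fun z => z.1.1 ^+ 2 + z.1.2 ^+ 2 + z.2 ^+ 2) (2^-1 + 2^-1 + 2^-1).
  exact: (@rise_moments_conv R _ _ _ _ N2 N1 _ _ _ _ h2 h (addr_ge0 i2 i2) i2).
have h4 := @rise_moments_conv R _ _ _ _ N3 N1 _ _ _ _ h3 h (addr_ge0 (addr_ge0 i2 i2) i2) i2.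
exists N4 => //.
rewrite (_ : 2 = 2^-1 + 2^-1 + 2^-1 + 2^-1 :> R); last by field.
exact: h4.
Qed.

Lemma euclidean_norm4E (z : R * R * R * R) : euclidean_norm4 z = Num.sqrt (sumsq4 z).
Proof. by case: z => [[[a b] c] e]. Qed.

End ChiLaw.

(** * Exploring the descendants from the top *)

Section Exploration.
Implicit Type o : nat -> 'I_2 -> nat.

(** [S] collects the endpoints of the arcs leaving the descendants found so far. *)
Definition explore o k (S : seq nat) : seq nat :=
  if k \in S then o k ord0 :: o k ord_max :: S else S.

Fixpoint found o k (S : seq nat) : nat :=
  if k is k'.+1 then ((k \in S) + found o k' (explore o k S))%N else 0%N.

Lemma found_le o k S : (found o k S <= k)%N.
Proof.
elim: k S => [|k IH] S //=; rewrite -addn1 addnC; apply: leq_add => //.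
by case: (_ \in _).
Qed.

Lemma reachableS o k j :
  reachable o k j <-> k = j \/ (1 < k)%N /\ exists i, reachable o (o k i) j.
Proof.
split.
  case=> -[|a p] /= [hp hl]; first by left.
  case/andP: hp => /andP[k1 /existsP[i /eqP <-]] hp in hl *; right.
  by split=> //; exists i, p.
case=> [->|[k1 [i [p [hp hl]]]]]; first by exists [::].
exists (o k i :: p); split => //=; rewrite hp andbT /Defs.arc k1/=.
by apply/existsP; exists i.
Qed.

Definition valid_dag n o :=
  forall k i, (1 < k <= n)%N -> (0 < o k i < k)%N.

Lemma reachable_le n o k j : valid_dag n o -> (k <= n)%N -> reachable o k j -> (j <= k)%N.
Proof.
move=> vo kn [p [hp <-]]; elim: p k kn hp => [|a p IH] k kn //=.
case/andP => /andP[k1 /existsP[i /eqP oa]] hp.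
have /andP[_] := vo k i (introT andP (conj k1 kn)); rewrite oa => ak.
by apply: leq_trans (ltnW ak); apply: IH => //; apply: leq_trans kn; exact: ltnW.
Qed.

(** The invariant is that the hidden descendants are the vertices reachable from
    the hidden endpoints in [S]. As arcs go downwards, the highest hidden vertex
    is reachable iff it is itself an endpoint. *)
Lemma count_reachable n o k S : valid_dag n o -> (k <= n)%N ->
  (forall j, (1 <= j <= k)%N ->
     reachable o n j <-> exists s, [/\ s \in S, (s <= k)%N & reachable o s j]) ->
  count (fun j => `[< reachable o n j >]) (iota 1 k) = found o k S.
Proof.
move=> vo; elim: k S => [|k IH] S kn hS //.
have -> : iota 1 k.+1 = rcons (iota 1 k) k.+1 by rewrite -[in LHS](addn1 k) iotaD cats1.
rewrite -cats1 count_cat [count _ [:: _]]/= addn0 addnC.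
have -> : `[< reachable o n k.+1 >] = (k.+1 \in S).
  apply/asboolP/idP => [/hS|kS].
    rewrite ltnS leqnn => /(_ isT) [s [sS sk rs]].
    have := reachable_le vo (leq_trans sk kn) rs => ks.
    by rewrite (_ : k.+1 = s)//; apply/eqP; rewrite eqn_leq ks sk.
  apply/hS; first by rewrite ltnS leqnn.
  by exists k.+1; split=> //; exists [::].
congr (_ + _)%N; apply: IH; first exact: ltnW.
move=> j /andP[j0 jk]; have jk1 : (1 <= j <= k.+1)%N by rewrite j0 (leq_trans jk).
have k1n : (1 < k.+1 <= n)%N by rewrite ltnS kn andbT (leq_trans j0).
rewrite hS// /explore; split.
  case=> s [sS sk rs]; move: sk; rewrite leq_eqVlt => /orP[/eqP sk|sk]; last first.
    by exists s; split => //; case: ifP => // _; rewrite !inE sS !orbT.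
  rewrite -sk sS; move/reachableS: rs => [sj|[s1 [i ri]]].
    by move: jk; rewrite -sj sk ltnn.
  exists (o s i); split => //; last first.
    by have /andP[_] := vo _ i k1n; rewrite ltnS sk.
  have [->|->] : i = ord0 \/ i = ord_max.
    by case: i {ri} => -[|[|//]] hi; [left|right]; apply/val_inj.
    by rewrite mem_head.
  by rewrite !inE eqxx orbT.
case: ifP => kS [s [sS sk rs]]; last by exists s; split => //; exact: leqW.
have [sS'|sS'] := boolP (s \in S); first by exists s; split => //; exact: leqW.
have [i si] : exists i, s = o k.+1 i.
  by move: sS; rewrite !inE (negPf sS') orbF => /orP[/eqP->|/eqP->]; eexists.
exists k.+1; split => //; apply/reachableS; right; split; first by case/andP: k1n.
by exists i; rewrite -si.
Qed.

Lemma num_descendants_found n o : valid_dag n o ->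
  num_descendants o n = found o n [:: n].
Proof.
move=> vo; apply: (count_reachable vo (leqnn n)) => j _; split=> [rj|].
  by exists n; rewrite mem_head.
by case=> s []; rewrite inE => /eqP->.
Qed.

End Exploration.

Section Recursion.
Variable R : realType.
Implicit Types (f : nat -> R) (S : seq nat).

(** For [k = 0] this is the value at 1 rather than an empty average, so that
    [avg k] is a mean in every case, including the last step of the exploration. *)
Definition avg k f : R := k.-1.+1%:R^-1 * \sum_(j < k.-1.+1) f j.+1.

Lemma eq_avg k f g : (forall j, (j <= k.-1)%N -> f j.+1 = g j.+1) -> avg k f = avg k g.
Proof. by move=> fg; congr (_ * _); apply: eq_bigr => j _; apply: fg; rewrite -ltnS. Qed.

Lemma avg_cst k (a : R) : avg k (fun=> a) = a.
Proof. by rewrite /avg sumr_const card_ord -[X in _ * X]mulr_natl mulKf// pnatr_eq0. Qed.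

(** The mean of [f] of the number of descendants found among [1], ..., [k] when
    the endpoints in [S] are given and the arcs of these vertices are random. *)
Fixpoint found_mean k S f : R :=
  if k is k'.+1 then
    avg k' (fun a => avg k' (fun b =>
      found_mean k' (if k \in S then [:: a, b & S] else S) (fun x => f ((k \in S) + x)%N)))
  else f 0%N.

Lemma eq_found_mean k S S' f g : (forall j, (1 <= j <= k)%N -> (j \in S) = (j \in S')) ->
  (forall x, (x <= k)%N -> f x = g x) -> found_mean k S f = found_mean k S' g.
Proof.
elim: k S S' f g => [|k IH] S S' f g hS fg /=; first exact: fg.
apply: eq_avg => a _; apply: eq_avg => b _.
rewrite -hS ?leqnn//; apply: IH => [j /andP[j0 jk]|x xk].
  by case: ifP => _; rewrite ?inE hS// j0 (leqW jk).
by apply: fg; rewrite -addn1 addnC leq_add//; case: (_ \in _).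
Qed.

(** The mean over [y] independent uniform pointers. *)
Fixpoint list_avg k y (G : seq nat -> R) : R :=
  if y is y'.+1 then avg k (fun a => list_avg k y' (fun s => G (a :: s))) else G [::].

Lemma eq_list_avg k y G H : G =1 H -> list_avg k y G = list_avg k y H.
Proof.
elim: y G H => [|y IH] G H GH //=; apply: eq_avg => a _; apply: IH => s; exact: GH.
Qed.

Lemma list_avg_cst k y (a : R) : list_avg k y (fun=> a) = a.
Proof. by elim: y => //= y IH; rewrite -[RHS](avg_cst k); apply: eq_avg => ? _. Qed.

Lemma list_avg_avg k y l (H : nat -> seq nat -> R) :
  list_avg k y (fun s => avg l (fun a => H a s)) = avg l (fun a => list_avg k y (H a)).
Proof.
elim: y H => [|y IH] H //=.
transitivity (avg k (fun b => avg l (fun a => list_avg k y (fun s => H a (b :: s))))).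
  by apply: eq_avg => b _; rewrite -IH.
rewrite /avg -big_distrr /= mulrCA; congr (_ * _).
by rewrite -big_distrr /= exchange_big.
Qed.

(** Sorting [y] uniform pointers on [1], ..., [k + 1] by whether they hit [k +
    1]: the number of hits is binomial and the others are uniform on [1], ...,
    [k]. *)
Lemma list_avg_split k y (G : nat -> seq nat -> R) :
  list_avg k.+1 y (fun S => G (count_mem k.+1 S) [seq j <- S | j != k.+1]) =
  binom_mean y k.+1%:R^-1 (fun z => list_avg k (y - z) (G z)).
Proof.
elim: y G => [|y IH] G //=.
rewrite {1}/avg /= big_ord_recr /= eqxx mulrDr addrC.
congr (_ + _).
  by congr (_ * _); rewrite -(IH (fun z => G z.+1)); apply: eq_list_avg => S.
have -> : \sum_(j < k) list_avg k.+1 y (fun s => G ((j.+1 == k.+1) + count_mem k.+1 s)%N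
    (if j.+1 != k.+1 then j.+1 :: [seq j <- s | j != k.+1] else [seq j <- s | j != k.+1]))
  = \sum_(j < k) binom_mean y k.+1%:R^-1 (fun z => list_avg k (y - z) (fun s => G z (j.+1 :: s))).
  apply: eq_bigr => j _; rewrite -(IH (fun z s => G z (j.+1 :: s))).
  by apply: eq_list_avg => s; rewrite eqSS (ltn_eqF (ltn_ord j)).
case: k IH => [|k] IH; first by rewrite big_ord0 mulr0 invr1 subrr mul0r.
rewrite -(binom_mean_sum y _ k.+1 (fun j z => list_avg k.+1 (y - z) (fun s => G z (j.+1 :: s)))).
rewrite (@eq_binom_mean R y _ _ (fun z => k.+1%:R * list_avg k.+1 (y.+1 - z) (G z))); last first.
  by move=> z zy; rewrite subSn//= /avg /= mulrA mulfV ?mul1r// pnatr_eq0.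
rewrite binom_meanZ mulrA; congr (_ * _).
rewrite -[k.+2%:R]natr1 -[k.+1%:R]natr1; field.
by apply: lt0r_neq0; have := ler0n R k; lra.
Qed.

(** One step of exploration from random endpoints leaves random endpoints, in
    the number given by the chain. *)
Lemma list_avg_found_mean_step k y f :
  list_avg k.+1 y (fun S => found_mean k.+1 S f) =
  binom_mean y k.+1%:R^-1 (fun z =>
    list_avg k (next y z) (fun S => found_mean k S (fun x => f ((0 < z) + x)%N))).
Proof.
pose G z (S : seq nat) : R := if (0 < z)%N
  then avg k (fun a => avg k (fun b => found_mean k [:: a, b & S] (fun x => f x.+1)))
  else found_mean k S f.
transitivity (list_avg k.+1 y (fun S => G (count_mem k.+1 S) [seq j <- S | j != k.+1])).
  apply: eq_list_avg => S; rewrite /= /G -has_count has_pred1.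
  have mf j : (1 <= j <= k)%N -> (j \in [seq j <- S | j != k.+1]) = (j \in S).
    by move=> /andP[_ jk]; rewrite mem_filter (ltn_eqF (_ : j < k.+1)%N).
  case: ifP => kS.
    apply: eq_avg => a _; apply: eq_avg => b _; apply: eq_found_mean => // j jk.
    by rewrite !inE mf.
  rewrite -[RHS](avg_cst k); apply: eq_avg => a _.
  by rewrite avg_cst; apply: eq_found_mean => // j jk; rewrite mf.
rewrite (list_avg_split k y G); apply: eq_binom_mean => z _; rewrite /next /G.
case: z => [|z] /=; first by rewrite addn0.
rewrite addn2 /= list_avg_avg; apply: eq_avg => a _.
by rewrite list_avg_avg.
Qed.

(** The two arcs of the top vertex provide the two initial pointers; its own
    discovery accounts for the successor. *)
Lemma found_mean_hist_mean m f : found_mean m.+1 [:: m.+1] f = hist_mean m m (fun s => f (visits s).+1).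
Proof.
have step i : (i <= m)%N -> list_avg m 2 (fun S => found_mean m S (fun x => f x.+1)) =
    hist_mean m i (fun s => list_avg (m - i) (ptrs s) (fun S => found_mean (m - i) S (fun x => f (visits s + x).+1))).
  elim: i => [|i IH] im; first by rewrite /= subn0.
  rewrite (IH (ltnW im)) /=; apply: eq_hist_mean => s _.
  have -> : (m - i = (m - i.+1).+1)%N by lia.
  rewrite list_avg_found_mean_step; apply: eq_binom_mean => z _; apply: eq_list_avg => S.
  by apply: eq_found_mean => // x _; rewrite /visits /= addnA (addnC (count _ _)).
transitivity (list_avg m 2 (fun S => found_mean m S (fun x => f x.+1))).
  rewrite /= mem_head; apply: eq_avg => a _; apply: eq_avg => b _.
  apply: eq_found_mean => // j /andP[_ jm]; rewrite !inE.
  by rewrite (ltn_eqF (_ : j < m.+1)%N)// orbF.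
rewrite (step m (leqnn m)); apply: eq_hist_mean => s _.
by rewrite subnn /= list_avg_cst addn0.
Qed.

End Recursion.

(** * The law of the number of descendants *)

Section RandomDag.
Context (dT : measure_display) (T : measurableType dT) (R : realType).
Variables (P : probability T R) (n : nat) (out : nat -> 'I_2 -> {RV P >-> nat}).
Hypothesis hD : random_dag n out.

Notation outw w := (fun k i => out k i w).

Lemma measurable_out k i (B : set nat) : measurable [set w | B (out k i w)].
Proof. by have := @measurable_funPT _ _ _ _ (out k i) measurableT B I; rewrite setTI; apply. Qed.

Lemma measurable_found k S (B : set nat) : measurable [set w | B (found (outw w) k S)].
Proof.
elim: k S B => [|k IH] S B /=.
  have [B0|B0] := pselect (B 0%N).
    by rewrite (_ : [set _ | _] = setT)//; apply/seteqP; split.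
  by rewrite (_ : [set _ | _] = set0)//; apply/seteqP; split.
rewrite /explore; case kS : (k.+1 \in S); last exact: (IH S (fun x => B (false + x)%N)).
rewrite (_ : [set _ | _] = \bigcup_a \bigcup_b
   ([set w | out k.+1 ord0 w = a] `&` [set w | out k.+1 ord_max w = b] `&`
    [set w | B (true + found (outw w) k [:: a, b & S])%N])); last first.
  apply/seteqP; split => w /=; first by move=> Bw; exists (out k.+1 ord0 w) => //; exists (out k.+1 ord_max w).
  by case=> a _ [b _ /= [[-> ->]]].
apply: bigcupT_measurable => a; apply: bigcupT_measurable => b.
apply: measurableI; first by apply: measurableI; exact: (measurable_out _ _ (eq^~ _)).
exact: (IH [:: a, b & S] (fun x => B (true + x)%N)).
Qed.

Lemma measurable_path k p : measurable [set w | path (Defs.arc (outw w)) k p].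
Proof.
elim: p k => [|j p IH] k /=; first by rewrite (_ : [set _ | _] = setT)//; apply/seteqP; split.
rewrite (_ : [set _ | _] = [set w | Defs.arc (outw w) k j] `&` [set w | path (Defs.arc (outw w)) j p]); last first.
  by apply/seteqP; split => w /= => [/andP[]|[-> ->]].
apply: measurableI; last exact: IH.
rewrite /Defs.arc; case: (1 < k)%N => /=; last first.
  by rewrite (_ : [set _ | _] = set0)//; apply/seteqP; split.
rewrite (_ : [set _ | _] = [set w | out k ord0 w = j] `|` [set w | out k ord_max w = j]); last first.
  apply/seteqP; split => w /=.
    case/existsP => -[[|[|//]] hi] /eqP <-; [left|right]; by congr (out k _ w); apply/val_inj.
  by case=> <-; apply/existsP; [exists ord0|exists ord_max].
by apply: measurableU; exact: (measurable_out _ _ (eq^~ _)).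
Qed.

(** A countable union over the finite paths. *)
Lemma measurable_reachable k j : measurable [set w | reachable (outw w) k j].
Proof.
rewrite (_ : [set _ | _] = \bigcup_(p : seq nat) ([set w | path (Defs.arc (outw w)) k p] `&` [set w | last k p = j])); last first.
  by apply/seteqP; split => w /= => [[p []]|[p _ []]] ? ?; exists p.
apply: countable_bigcupT_measurable => [|p]; first exact: countableP.
apply: measurableI; first exact: measurable_path.
have [lp|lp] := pselect (last k p = j).
  by rewrite (_ : [set _ | _] = setT)//; apply/seteqP; split.
by rewrite (_ : [set _ | _] = set0)//; apply/seteqP; split.
Qed.

Lemma measurable_descendants : measurable_fun [set: T] (descendants n out).
Proof.
rewrite (_ : descendants n out = fun w => \sum_(j <- iota 1 n) \1_[set w | reachable (outw w) n j] w).
  by apply: measurable_sum => j; apply: measurable_indic; exact: measurable_reachable.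
apply/funext => w; rewrite /descendants /num_descendants -sum1_count natr_sum.
rewrite big_mkcond; apply: eq_bigr => j _; rewrite indicE.
by case: asboolP => r; [rewrite mem_set|rewrite memNset].
Qed.

Definition endpoint_range k i : set T := [set w | (0 < out k i w < k)%N].

Lemma split_endpoint k i (A : set T) : (1 < k <= n)%N -> measurable A ->
  P (A `&` endpoint_range k i) = (\sum_(j < k.-1) P (A `&` [set w | out k i w = j.+1]))%E.
Proof.
move=> kn mA; rewrite -measure_bigsetU_ord.
- congr (P _); rewrite -(bigcup_mkord _ (fun j => A `&` [set w | out k i w = j.+1])); apply/seteqP; split => w /=.
    move=> [Aw /andP[lo hi]]; exists (out k i w).-1 => /=; last by rewrite prednK.
    by rewrite -ltnS !prednK// (leq_trans _ hi).
  case=> j /= jk [Aw ow]; split => //; rewrite /endpoint_range/= ow ltnS leq0n.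
  by rewrite -[k in (_ < k)%N]prednK//; case/andP: kn => /ltnW.
- by move=> j; apply: measurableI => //; exact: (measurable_out k i (eq^~ _)).
- apply/trivIsetP => /= a b _ _ ab; rewrite setIACA.
  rewrite (_ : [set w | _] `&` [set w | _] = set0) ?setI0//.
  apply/seteqP; split => w //= [-> [/val_inj/eqP]]; exact/negP.
Qed.

Lemma measurable_endpoint_range k i : measurable (endpoint_range k i).
Proof. exact: (measurable_out k i (fun x => (0 < x < k)%N)). Qed.

(** The prescribed probabilities of the possible endpoints sum up to 1. *)
Lemma endpoint_range1 k i : (1 < k <= n)%N -> P (endpoint_range k i) = 1%E.
Proof.
move=> kn; have := split_endpoint i kn measurableT; rewrite setTI => ->.
under eq_bigr do rewrite setTI.
have [h _] := hD; rewrite (eq_bigr (fun=> (k.-1%:R^-1 : R)%:E)); last first.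
  move=> j _; apply: h => //=.
  by rewrite -ltn_predRL ltn_ord.
rewrite sumEFin sumr_const card_ord -[X in X%:E]mulr_natl mulfV// pnatr_eq0.
by case/andP: kn; case: (k) => [|[|]].
Qed.

Lemma endpoint_range0 k i : (1 < k <= n)%N -> P (~` endpoint_range k i) = 0%E.
Proof.
move=> kn; rewrite probability_setC; last exact: measurable_endpoint_range.
by rewrite endpoint_range1// subee.
Qed.

Lemma split_endpoint_full k i (A : set T) : (1 < k <= n)%N -> measurable A ->
  P A = (\sum_(j < k.-1) P (A `&` [set w | out k i w = j.+1]))%E.
Proof.
move=> kn mA; rewrite -split_endpoint//.
have mE := measurable_endpoint_range k i.
rewrite (measureDI P mA mE) [X in (X + _)%E = _](_ : _ = 0%E) ?add0e//.
apply: (@subset_measure0 _ _ _ P _ (~` endpoint_range k i)).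
- exact: measurableD.
- exact: measurableC.
- by move=> w [].
- exact: endpoint_range0.
Qed.

Definition prescribed (J : {fset nat * 'I_2}) (v : nat * 'I_2 -> nat) : set T :=
  \bigcap_(e in [set` J]) [set w | out e.1 e.2 w = v e].

Lemma measurable_prescribed J v : measurable (prescribed J v).
Proof.
apply: fin_bigcap_measurable => // e _.
exact: (measurable_out e.1 e.2 (eq^~ _)).
Qed.

Definition after k : set (nat * 'I_2) := [set e | (k < e.1 <= n)%N].

Lemma prescribed_add J v k i : (1 < k <= n)%N -> [set` J] `<=` after 1 ->
  (k, i) \notin J -> (0 < v (k, i) < k)%N ->
  P (prescribed ((k, i) |` J)%fset v) = ((k.-1%:R^-1)%:E * P (prescribed J v))%E.
Proof.
move=> kn JD kJ vk; have [h ind] := hD.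
have prodE J' : [set` J'] `<=` after 1 -> P (prescribed J' v) =
    (\prod_(e <- J') P [set w | out e.1 e.2 w = v e])%E.
  by move=> J'D; rewrite -(ind J' J'D (fun e => [set v e])).
rewrite !prodE//; last first.
  by move=> e /=; rewrite in_fset1U => /orP[/eqP ->|/JD].
by rewrite big_fsetU1//= h.
Qed.

(** Independence in the form needed by the exploration: once the arcs of the
    vertices above [k] are prescribed, the number of vertices found has the law
    computed by [found_mean]. The step prescribes in addition the two arcs of [k
    + 1], over whose values one sums. *)
Lemma prescribed_found k J v S (B : set nat) : (k <= n)%N ->
  [set` J] `<=` after (maxn 1 k) ->
  P (prescribed J v `&` [set w | B (found (outw w) k S)]) =
  (P (prescribed J v) * (found_mean k S (fun x => (x \in B)%:R))%:E)%E.
Proof.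
elim: k J v S B => [|k IH] J v S B kn JD /=.
  have [B0|B0] := pselect (B 0%N).
    by rewrite mem_set// mule1 (_ : [set _ | _] = setT) ?setIT//; apply/seteqP; split.
  by rewrite memNset// mule0 (_ : [set _ | _] = set0) ?setI0 ?measure0//; apply/seteqP; split.
have [k0|k0] := posnP k.
  rewrite k0 in kn JD *; rewrite /= !avg_cst.
  have [B0|B0] := pselect (B ((1%N \in S) + 0)%N).
    by rewrite mem_set// mule1 (_ : [set _ | _] = setT) ?setIT//; apply/seteqP; split.
  by rewrite memNset// mule0 (_ : [set _ | _] = set0) ?setI0 ?measure0//; apply/seteqP; split.
have k1n : (1 < k.+1 <= n)%N by rewrite ltnS k0.
set A := _ `&` _.
have mA : measurable A by apply: measurableI; [exact: measurable_prescribed|exact: (measurable_found k.+1)].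
pose S' (a b : nat) := if k.+1 \in S then [:: a, b & S] else S.
(* The prescription extended to the two arcs of vertex [k.+1]. *)
pose v' (a b : nat) (e : nat * 'I_2) :=
  if e == (k.+1, ord0) then a else if e == (k.+1, ord_max) then b else v e.
pose J1 := ((k.+1, ord_max) |` J)%fset; pose J2 := ((k.+1, ord0) |` J1)%fset.
pose B' : set nat := fun x => B ((k.+1 \in S) + x)%N.
have JD1 : [set` J] `<=` after 1.
  by move=> e /JD; rewrite /after /= => /andP[h ->]; rewrite (leq_ltn_trans _ h)// leq_maxl.
have notJ i : (k.+1, i) \notin J.
  apply/negP => /JD; rewrite /after /= => /andP[]; by rewrite ltnNge leq_maxr.
have J1D : [set` J1] `<=` after 1.
  by move=> e /=; rewrite in_fset1U => /orP[/eqP ->//|/JD1].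
have notJ1 : (k.+1, ord0) \notin J1 by rewrite in_fset1U negb_or notJ andbT xpair_eqE eqxx.
have cell (a b : 'I_k) :
    P (A `&` [set w | out k.+1 ord0 w = a.+1] `&` [set w | out k.+1 ord_max w = b.+1]) =
    ((k%:R^-1)%:E * ((k%:R^-1)%:E * (P (prescribed J v) *
      (found_mean k (S' a.+1 b.+1) (fun x => (x \in B')%:R))%:E)))%E.
  have -> : A `&` [set w | out k.+1 ord0 w = a.+1] `&` [set w | out k.+1 ord_max w = b.+1] =
      prescribed J2 (v' a.+1 b.+1) `&` [set w | B' (found (outw w) k (S' a.+1 b.+1))].
    apply/seteqP; split => w.
      move=> [[[hJ /= hB] oa] ob]; split; last first.
        by move: hB; rewrite /= /B' /explore /S' oa ob.
      move=> e /=; rewrite !in_fset1U /v' => /orP[/eqP->|/orP[/eqP->|eJ]].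
      - by rewrite eqxx; exact: oa.
      - by rewrite eqxx xpair_eqE eqxx /=; exact: ob.
      have ne i : (e == (k.+1, i)) = false by apply: contraNF (notJ i) => /eqP <-.
      by rewrite !ne; exact: hJ.
    move=> [hJ /= hB].
    have oa : out k.+1 ord0 w = a.+1.
      have := hJ (k.+1, ord0); rewrite /= /v' eqxx; apply.
      by rewrite !in_fset1U eqxx.
    have ob : out k.+1 ord_max w = b.+1.
      have := hJ (k.+1, ord_max); rewrite /= /v' eqxx xpair_eqE eqxx; apply.
      by rewrite !in_fset1U eqxx orbT.
    split => //; split => //; split; last first.
      by move: hB; rewrite /= /B' /explore /S' oa ob.
    move=> e /= eJ; have := hJ e; rewrite /= !in_fset1U eJ !orbT => /(_ isT).
    have ne i : (e == (k.+1, i)) = false by apply: contraNF (notJ i) => /eqP <-.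
    by rewrite /v' !ne.
  rewrite IH; last 2 first.
  - exact: ltnW.
  - move=> e /=; rewrite !in_fset1U => /orP[/eqP->|/orP[/eqP->|/JD]].
    + by rewrite /after /= (maxn_idPr k0) leqnn.
    + by rewrite /after /= (maxn_idPr k0) leqnn.
    + rewrite /after /= => /andP[h ->]; rewrite andbT; apply: leq_trans h.
      by rewrite (maxn_idPr k0) ltnS (leq_trans (leqnSn k))// leq_maxr.
  rewrite !prescribed_add//.
  - rewrite (_ : prescribed J (v' _ _) = prescribed J v) ?muleA//.
    apply/seteqP; split => w hJ e eJ; have := hJ e eJ; rewrite /= /v'.
      have ne i : (e == (k.+1, i)) = false by apply: contraNF (notJ i) => /eqP <-.
      by rewrite !ne.
    have ne i : (e == (k.+1, i)) = false by apply: contraNF (notJ i) => /eqP <-.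
    by rewrite !ne.
  - by rewrite /v' !xpair_eqE !eqxx /=; exact: (ltn_ord b).
  - by rewrite /v' !xpair_eqE !eqxx /=; exact: (ltn_ord a).
rewrite (split_endpoint_full ord0 k1n mA).
under eq_bigr.
  move=> a _; rewrite (split_endpoint_full ord_max k1n); last first.
    by apply: measurableI => //; exact: (measurable_out _ _ (eq^~ _)).
  under eq_bigr do rewrite cell.
  over.
have /fineK <- : P (prescribed J v) \is a fin_num.
  by apply: fin_num_measure; exact: measurable_prescribed.
set p := fine _.
rewrite (eq_bigr (fun a : 'I_k => (\sum_(b < k) k%:R^-1 * (k%:R^-1 * (p *
  found_mean k (S' a.+1 b.+1) (fun x => (x \in B')%:R))))%:E)); last first.
  by move=> a _; rewrite -sumEFin.
rewrite sumEFin -EFinM; congr EFin; rewrite /avg prednK//.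
rewrite mulrCA mulr_sumr mulr_sumr; apply: eq_bigr => a _.
rewrite [in RHS]mulrCA mulr_sumr !mulr_sumr; apply: eq_bigr => b _.
by rewrite [RHS]mulrCA [in RHS](mulrCA p).
Qed.

Lemma prob_found (B : set nat) :
  P [set w | B (found (outw w) n [:: n])] = (found_mean n [:: n] (fun x => (x \in B)%:R))%:E.
Proof.
have := @prescribed_found n fset0 (fun=> 0%N) [:: n] B (leqnn n).
rewrite (_ : prescribed _ _ = setT) ?setTI ?probability_setT ?mul1e; first by apply; move=> e.
by apply/seteqP; split => w // _ e.
Qed.

(** The endpoints are in range only almost surely, so that the exploration
    agrees with reachability outside a null set. *)
Lemma ae_descendants :
  {ae P, forall w, descendants n out w = (found (outw w) n [:: n])%:R}.
Proof.
have rng k i : (1 < k <= n)%N -> {ae P, forall w, endpoint_range k i w}.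
  move=> kn; exists (~` endpoint_range k i); split => //.
  - by apply: measurableC; exact: measurable_endpoint_range.
  - exact: endpoint_range0.
have : {ae P, forall w, forall k, forall i, (1 < k <= n)%N -> endpoint_range k i w}.
  apply: ae_foralln => k; have [kn|kn] := boolP (1 < k <= n)%N; last first.
    by apply: filterE => w i.
  apply: filterS2 (rng k ord0 kn) (rng k ord_max kn) => w r0 r1 -[[|[|//]] hi] _.
    by rewrite (_ : Ordinal hi = ord0)//; apply/val_inj.
  by rewrite (_ : Ordinal hi = ord_max)//; apply/val_inj.
apply: filterS => w hw; rewrite /descendants num_descendants_found//.
Qed.

End RandomDag.

(** The number of descendants takes finitely many values, so that its
    expectation is a finite sum of probabilities. *)
Lemma expectation_descendants (dT : measure_display) (T : measurableType dT)
    (R : realType) (P : probability T R) (m : nat)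
    (out : nat -> 'I_2 -> {RV P >-> nat}) (f : R -> R) :
  random_dag m.+1 out -> measurable_fun [set: R] f ->
  ('E_P[fun w => f (descendants m.+1 out w)] =
   (hist_mean m m (fun s => f (visits s).+1%:R))%:E)%E.
Proof.
move=> hD mf; set n := m.+1; set fo := fun w => found (fun k i => out k i w) n [:: n].
have mfo x : measurable [set w | fo w = x] by exact: (measurable_found _ n [:: n] (eq^~ x)).
have foE w : f (fo w)%:R = \sum_(x < n.+1) f x%:R * \1_[set w | fo w = x] w.
  have fn : (fo w < n.+1)%N by rewrite ltnS; exact: found_le.
  rewrite (bigD1 (Ordinal fn))//= indicE mem_set// mulr1 big1 ?addr0// => x xf.
  rewrite indicE memNset ?mulr0// => /= e; by move/eqP: xf; apply; apply/val_inj.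
have mffo : measurable_fun [set: T] (fun w => f (fo w)%:R).
  under eq_fun do rewrite foE.
  apply: measurable_sum => x; apply: measurable_funM; first exact: measurable_cst.
  exact: measurable_indic.
rewrite unlock (@ae_eq_integral _ _ _ P setT (fun w => (f (fo w)%:R)%:E))//; last 3 first.
- apply/measurable_EFinP; apply: measurableT_comp => //; exact: measurable_descendants.
- exact/measurable_EFinP.
- by apply: filterS (ae_descendants hD) => w + _ => ->.
under eq_integral do rewrite foE -sumEFin.
rewrite integral_sum//; last first.
  move=> x; have := @integrableZl _ _ _ P setT measurableT (f x%:R) (fun w => (\1_[set w | fo w = x] w)%:E).
  move=> h; apply: eq_integrable (h _) => //.
  exact: integrable_indic.
transitivity (\sum_(x < n.+1) (f x%:R * hist_mean m m (fun s => ((visits s).+1 \in [set x : nat])%:R))%:E)%E.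
  apply: eq_bigr => x _.
  under eq_integral do rewrite EFinM.
  rewrite integralZl//; last exact: integrable_indic.
  rewrite integral_indic// setIT.
  by rewrite EFinM -(found_mean_hist_mean m (fun y => (y \in [set x : nat])%:R)) -(prob_found hD).
rewrite sumEFin; congr EFin.
under eq_bigr do rewrite -hist_meanZ.
rewrite -(@hist_mean_sum R m m n.+1 (fun x s => f x%:R * ((visits s).+1 \in [set x : nat])%:R)); apply: eq_hist_mean => s sm.
have vn : ((visits s).+1 < n.+1)%N by rewrite !ltnS -sm; exact: count_size.
rewrite (bigD1 (Ordinal vn))//= mem_set// mulr1 big1 ?addr0// => x xf.
rewrite memNset ?mulr0// => /= e; by move/eqP: xf; apply; apply/val_inj.
Qed.

(** * Convergence of the number of visits *)

Section VisitsLimit.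
Variable R : realType.
Notation root m := (Num.sqrt m.+1%:R : R).

Lemma hist_mean_mean_functional m i (Y : seq nat -> R) : (i <= m)%N ->
  (forall s, 0 <= Y s) -> mean_functional (fun f => hist_mean m i (fun s => f (Y s))).
Proof.
move=> im Y0; split => [a f g _ _|f g _ _ fg|].
- exact: hist_mean_lin.
- by apply: hist_mean_le => // s _; exact: fg.
- exact: hist_mean_cst.
Qed.

Definition scaled_visits m (s : seq nat) : R := (visits s).+1%:R / root m.
(** The prediction of [scaled_visits] from the martingale. *)
Definition scaled_pred m (s : seq nat) : R := pi / 2 * Num.sqrt (quad_mart_hist R m s / m.+1%:R).

Lemma scaled_visits_ge0 m s : 0 <= scaled_visits m s.
Proof. by rewrite divr_ge0. Qed.

Lemma scaled_pred_ge0 m s : 0 <= scaled_pred m s.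
Proof. by rewrite mulr_ge0// divr_ge0// pi_ge0. Qed.

Let rescale1 (x y z M : R) : M != 0 -> x / M * y - x * z = x / M * (y - z * M).
Proof. by move=> M0; field. Qed.

Let rescale2 (x y z M : R) : M != 0 -> z != 0 -> x / M * (y * M / z) = x * y / z.
Proof. by move=> M0 z0; field; rewrite ?M0 ?z0. Qed.

Lemma scaled_pred_moment b (d : R) K : 0 < d -> exists k1, forall c, (c <= K)%N ->
  forall m i, (i < m)%N -> (k1 <= m - i)%N -> (m.+1 <= b * (m - i) ^ 2)%N ->
  ((m - i) ^ 2 <= b * m.+1)%N ->
  `|hist_mean m i (fun s => scaled_pred m s ^+ (2 * c)) - chi_moment (pi / 2) c| <= d.
Proof.
move=> d0.
have one c : exists k1, forall m i, (i < m)%N -> (k1 <= m - i)%N ->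
    (m.+1 <= b * (m - i) ^ 2)%N -> ((m - i) ^ 2 <= b * m.+1)%N ->
    `|hist_mean m i (fun s => scaled_pred m s ^+ (2 * c)) - chi_moment (pi / 2) c| <= d.
  have [C C0 [k1 hC]] := quad_mart_hist_moment R b c.
  set a := (pi / 2 : R) ^+ (2 * c).
  have a0 : 0 <= a by rewrite exprn_ge0// divr_ge0// pi_ge0.
  exists (maxn k1 (Num.truncn (a * C / d)).+1) => m i im.
  rewrite geq_max => /andP[kk dk] nb bn.
  have := hC m i im kk nb bn; set H := hist_mean _ _ _ => hH.
  have M0 : 0 < m.+1%:R ^+ c :> R by rewrite exprn_gt0// ltr0n.
  have -> : hist_mean m i (fun s => scaled_pred m s ^+ (2 * c)) = a / m.+1%:R ^+ c * H.
    rewrite /H -hist_meanZ; apply: eq_hist_mean => s _.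
    rewrite /scaled_pred exprMn (exprM (Num.sqrt _)) sqr_sqrtr ?divr_ge0 ?quad_mart_hist_ge0//.
    by rewrite -/a expr_div_n [RHS]mulrAC mulrA.
  rewrite /chi_moment -/a.
  have -> : a / m.+1%:R ^+ c * H - a * (c.+1)`!%:R =
      a / m.+1%:R ^+ c * (H - (c.+1)`!%:R * m.+1%:R ^+ c).
    exact: (rescale1 _ _ _ (lt0r_neq0 M0)).
  have k0 : 0 < (m - i)%:R :> R by rewrite ltr0n subn_gt0.
  rewrite normrM ger0_norm ?divr_ge0 ?(ltW M0)//.
  rewrite -ler_pdivlMr// in hH.
  apply: (le_trans (ler_wpM2l (divr_ge0 a0 (ltW M0)) hH)).
  rewrite (rescale2 _ _ (lt0r_neq0 M0) (lt0r_neq0 k0)).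
  rewrite ler_pdivrMr// [leRHS]mulrC -ler_pdivrMr//.
  by apply: (le_trans (ltW (truncnS_gt _))); rewrite ler_nat.
elim: K => [|K [k hk]].
  by have [k hk] := one 0%N; exists k => c; rewrite leqn0 => /eqP ->.
have [k' hk'] := one K.+1; exists (maxn k k') => c; rewrite leq_eqVlt => /orP[/eqP->|cK] m i im.
  by rewrite geq_max => /andP[_ h]; exact: hk'.
by rewrite geq_max => /andP[h _]; exact: hk.
Qed.

(** The cosine is Lipschitz, so that [main_approx] allows replacing the visits
    by the prediction, whose even moments are close to those of the limit. *)
Lemma cvg_cos_visits (L0 : (R -> R) -> R) t : mean_functional L0 ->
  (forall q, L0 (fun x => x ^+ (2 * q)) = chi_moment (pi / 2) q) ->
  hist_mean m m (fun s => cos (t * scaled_visits m s)) @[m --> \oo] --> L0 (fun x => cos (t * x)).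
Proof.
move=> mL0 h0; apply/cvgrPdist_le => e e0.
have e2 : 0 < e / 2 by rewrite divr_gt0.
have [K [d [d0 hK]]] := cos_of_moments (chi_moment_small (pi / 2) t) e2.
have t1 : 0 < 1 + `|t| by rewrite ltr_pwDl.
have ep0 : 0 < e / 2 / (1 + `|t|) by rewrite divr_gt0.
have [b hb] := main_approx ep0.
have [k1 hk1] := scaled_pred_moment b K d0.
have [N hN] := hb k1.
exists N => // m /= Nm; have [i [im kk nb bn happ]] := hN m Nm.
pose L2 (f : R -> R) := hist_mean m i (fun s => f (scaled_pred m s)).
have mL2 : mean_functional L2 by apply: hist_mean_mean_functional; [exact: ltnW|exact: scaled_pred_ge0].
have near0 : `|L0 (fun x => cos (t * x)) - L2 (fun x => cos (t * x))| <= e / 2.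
  apply: hK => // c cK; first by rewrite h0 subrr normr0 ltW.
  exact: hk1.
have dropE (F : seq nat -> R) : hist_mean m m (fun s => F (drop (m - i) s)) = hist_mean m i F.
  by rewrite -(hist_mean_drop m i (m - i) F) subnKC// ltnW.
have near1 : `|L2 (fun x => cos (t * x)) - hist_mean m m (fun s => cos (t * scaled_visits m s))| <= e / 2.
  have -> : L2 (fun x => cos (t * x)) = hist_mean m m (fun s => cos (t * scaled_pred m (drop (m - i) s))).
    by rewrite (dropE (fun s => cos (t * scaled_pred m s))).
  rewrite -hist_meanB; apply: (le_trans (hist_mean_norm _ (leqnn m))).
  pose G s : R := `|(visits s)%:R - pi / 2 * Num.sqrt (quad_mart_hist R m s)| + (m - i).+1%:R.
  apply: (@le_trans _ _ (hist_mean m m (fun s => `|t| / root m * G (drop (m - i) s)))).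
    apply: hist_mean_le => // s _; apply: (le_trans (cos_lip _ _)).
    rewrite -mulrBr normrM -mulrA ler_wpM2l//.
    have -> : scaled_pred m (drop (m - i) s) - scaled_visits m s =
        (root m)^-1 * (pi / 2 * Num.sqrt (quad_mart_hist R m (drop (m - i) s)) - (visits s).+1%:R).
      rewrite /scaled_pred /scaled_visits sqrtrM ?quad_mart_hist_ge0// sqrtrV//.
      by ring.
    rewrite normrM ger0_norm ?invr_ge0 ?sqrtr_ge0// ler_wpM2l ?invr_ge0 ?sqrtr_ge0//.
    rewrite /G; set v' := visits (drop _ _); set y := pi / 2 * _.
    have v1 : (v' <= visits s)%N by exact: visits_drop_ge.
    have v2 : (visits s <= v' + (m - i))%N by exact: visits_drop.
    have -> : y - (visits s).+1%:R = - (v'%:R - y) - ((visits s).+1 - v')%:R.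
      by rewrite natrB ?(leqW v1)//; ring.
    apply: (le_trans (ler_normB _ _)); rewrite normrN lerD2l normr_nat ler_nat.
    by rewrite leq_subLR addnS ltnS.
  rewrite hist_meanZ.
  rewrite (dropE G).
  have -> : hist_mean m i G = hist_mean m i (fun s => `|(visits s)%:R - pi / 2 * Num.sqrt (quad_mart_hist R m s)|) + (m - i).+1%:R.
    by rewrite /G hist_meanD hist_mean_cst.
  rewrite mulrAC ler_pdivrMr//; apply: (le_trans (ler_wpM2l (normr_ge0 t) happ)).
  rewrite mulrA ler_wpM2r ?sqrtr_ge0//.
  rewrite mulrA ler_pdivrMr// mulrC ler_wpM2l ?(ltW e2)//.
  by rewrite lerDr.
apply: (le_trans (ler_distD (L2 (fun x => cos (t * x))) _ _)).
by rewrite [leRHS]splitr lerD.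
Qed.

Lemma cvg_visits (L0 : (R -> R) -> R) : mean_functional L0 ->
  (forall q, L0 (fun x => x ^+ (2 * q)) = chi_moment (pi / 2) q) ->
  forall f, poly_growth f ->
  hist_mean m m (fun s => f (scaled_visits m s)) @[m --> \oo] --> L0 f.
Proof.
move=> mL0 h0 f pf.
have mL m : mean_functional (fun f => hist_mean m m (fun s => f (scaled_visits m s))).
  by apply: hist_mean_mean_functional => //; exact: scaled_visits_ge0.
apply: (cvg_poly_growth mL mL0) pf; first by move=> t; exact: cvg_cos_visits.
case=> [|q].
  by exists 1 => //; exists 0%N => m _; rewrite (mf_cst (mL m)).
have [C C0 [N hN]] := visits_moment_bound R q; exists C => //; exists N => m Nm.
have M0 : 0 < m.+1%:R ^+ q.+1 :> R by rewrite exprn_gt0// ltr0n.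
rewrite -(ler_pM2r M0); apply: le_trans (hN m Nm).
rewrite mulrC -hist_meanZ; apply: hist_mean_le => // s _.
rewrite /scaled_visits expr_div_n (exprM (Num.sqrt _)) sqr_sqrtr//.
by rewrite mulrC divfK// gt_eqF.
Qed.

End VisitsLimit.

(** * Conclusion *)

Section Limits.
Variable R : realType.
Notation cc := (pi / (2 * Num.sqrt 2) : R).

(** The limit law as a mean functional, with the values of its moments. *)
Lemma chi4_mean (dS : measure_display) (S : measurableType dS) (Q : probability S R)
    (Y : {RV Q >-> R}) : has_chi4_distribution Y ->
  exists L : (R -> R) -> R, [/\ mean_functional L,
    forall q, L (fun x => x ^+ (2 * q)) = chi_moment (pi / 2) q,
    forall h f : R -> R, poly_growth f -> measurable_fun [set: R] h ->
      (forall y, 0 <= y -> h y = f (cc * y)) ->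
      'E_Q[fun w => h (Y w)]%E = (L f)%:E,
    forall r, 0 < r -> L (fun x => `|x| `^ r) = (pi / 2) `^ r * Gamma (r / 2 + 2) &
    L (fun x => x) = 3 * pi `^ (3 / 2) / 8].
Proof.
move=> hY; have [P hP PE] := std_normal4_moments R.
exists (mean_scaled_root P (@sumsq4 R)); split.
- by have [] := mean_scaled_root_spec hP.
- by have [] := mean_scaled_root_spec hP.
- move=> h f pf mh hf; apply: (expectation_scaled_root hP _ pf mh hf) => A mA.
  rewrite hY// -PE; congr (P _); apply/seteqP; split => z /=; by rewrite euclidean_norm4E.
- by move=> r; exact: mean_scaled_root_powR.
- exact: mean_scaled_root_id.
Qed.

(** Asymptotic equivalence needs a nonzero limit: the second moment would
    otherwise be too small, as [x ^+ 2] is at most [e] for small [x], [x ^+ 4 /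
    B] for large [x], and a multiple of [x `^ r] in between. *)
Lemma mean_powR_gt0 (L : (R -> R) -> R) (r : R) : mean_functional L ->
  (forall q, L (fun x => x ^+ (2 * q)) = chi_moment (pi / 2) q) -> 0 < r ->
  0 < L (fun x => `|x| `^ r).
Proof.
move=> mL hL r0.
set k := (pi / 2 : R) ^+ 2.
have k0 : 0 < k by rewrite exprn_gt0// divr_gt0// pi_gt0.
(* The second and fourth moments are [2 * k] and [6 * k ^+ 2], so [e] and [6 *
   k ^+ 2 / B] are each a quarter of the second moment. *)
set e := k / 2; set B := 12 * k.
have e0 : 0 < e by rewrite divr_gt0.
have B0 : 0 < B by rewrite mulr_gt0.
set D := B / e `^ (r / 2).
have D0 : 0 < D by rewrite divr_gt0// powR_gt0.
have pr := poly_growth_powR r0.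
have p4 : poly_growth (fun x : R => B^-1 * x ^+ (2 * 2) + e) by apply: poly_growth_lin; [exact: poly_growth_pow|exact: poly_growth_cst].
have : L (fun x => x ^+ (2 * 1)) <= L (fun x => D * `|x| `^ r + (B^-1 * x ^+ (2 * 2) + e)).
  apply: (mf_le mL); [exact: poly_growth_pow|exact: poly_growth_lin|] => x x0.
  have x40 : 0 <= B^-1 * x ^+ (2 * 2) by rewrite mulr_ge0 ?exprn_ge0// invr_ge0 ltW.
  have t0 : 0 <= D * `|x| `^ r by rewrite mulr_ge0 ?powR_ge0// ltW.
  have [xe|xe] := leP (x ^+ 2) e; first by rewrite muln1; lra.
  have [xB|xB] := leP B (x ^+ 2).
    suff : x ^+ 2 <= B^-1 * x ^+ (2 * 2) by rewrite muln1; lra.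
    by rewrite exprM [X in _ <= _ * X]expr2 mulrA ler_peMl ?sqr_ge0// mulrC ler_pdivlMr// mul1r.
  suff : B <= D * `|x| `^ r by rewrite muln1; lra.
  rewrite /D -mulrA ler_peMr ?(ltW B0)// mulrC ler_pdivlMr ?powR_gt0// mul1r.
  have -> : `|x| `^ r = (x ^+ 2) `^ (r / 2).
    rewrite ger0_norm// -powR_mulrn// -powRrM; congr (_ `^ _); by field.
  by rewrite ge0_ler_powR ?nnegrE ?divr_ge0 ?sqr_ge0 ?(ltW r0) ?(ltW e0) ?(ltW xe).
rewrite (mf_lin mL)// (mf_lin mL) ?(mf_cst mL) ?hL; [|exact: poly_growth_pow|exact: poly_growth_cst].
rewrite /chi_moment muln1 (exprM _ 2 2) -/k.
have -> : B^-1 * (k ^+ 2 * (3)`!%:R) = k / 2 by rewrite /B !factS fact0; field; rewrite gt_eqF.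
rewrite (_ : (2)`!%:R = 2 :> R)// => h.
have : 0 < D * L (fun x => `|x| `^ r) by move: h; rewrite /e; lra.
by rewrite pmulr_rgt0.
Qed.

Lemma equiv_of_cvg (a b s : nat -> R) (l : R) : 0 < l -> (forall n, 0 <= s n) ->
  (forall m, a m.+1 = s m.+1 * b m) -> b n @[n --> \oo] --> l ->
  (a : nat -> R^o) ~_\oo (fun n => l * s n).
Proof.
move=> l0 s0 ab bl; apply/eqaddoP => e e0.
have el : 0 < e * l by rewrite mulr_gt0.
have /cvgrPdist_le/(_ _ el) [N _ hN] := bl.
exists N.+1 => //= -[|n]//= Nn; rewrite !fctE ab.
have -> : s n.+1 * b n - l * s n.+1 = s n.+1 * (b n - l) by ring.
rewrite !normrM (ger0_norm (s0 _)) (ger0_norm (ltW l0)) mulrA mulrC ler_wpM2r//.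
by rewrite distrC; exact: hN.
Qed.

Section Descendants.
Variables (dT : nat -> measure_display) (T : forall n, measurableType (dT n)).
Variables (P : forall n, probability (T n) R).
Variable out : forall n, nat -> 'I_2 -> {RV (P n) >-> nat}.
Hypothesis hD : forall n, random_dag n (out n).

Lemma expectation_scaled m (h : R -> R) : measurable_fun [set: R] h ->
  'E_(P m.+1)[fun w => h (descendants m.+1 (out m.+1) w / Num.sqrt m.+1%:R)%R]%E =
  (hist_mean m m (fun s => h (scaled_visits R m s)))%:E.
Proof.
move=> mh; apply: (expectation_descendants (f := fun x => h (x / Num.sqrt m.+1%:R)) (hD m.+1)).
by apply: measurableT_comp => //; exact: measurable_funM.
Qed.

Lemma cvg_expectation (L : (R -> R) -> R) (h f : R -> R) : mean_functional L ->
  (forall q, L (fun x => x ^+ (2 * q)) = chi_moment (pi / 2) q) ->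
  poly_growth f -> measurable_fun [set: R] h -> (forall y, 0 <= y -> h y = f y) ->
  ('E_(P n)[fun w => h (descendants n (out n) w / Num.sqrt n%:R)%R] @[n --> \oo] --> (L f)%:E)%E.
Proof.
move=> mL hL pf mh hf; rewrite -cvg_shiftS.
under eq_fun do rewrite expectation_scaled//.
apply: cvg_EFin; first by apply: nearW.
rewrite (_ : _ \o _ = fun m => hist_mean m m (fun s => f (scaled_visits R m s))); last first.
  by apply/funext => m /=; apply: eq_hist_mean => s _; rewrite hf// scaled_visits_ge0.
exact: cvg_visits.
Qed.

End Descendants.
End Limits.

Theorem theorem1p3 (R : realType)
    (dT : nat -> measure_display) (T : forall n, measurableType (dT n))
    (P : forall n, probability (T n) R)
    (out : forall n, nat -> 'I_2 -> {RV (P n) >-> nat})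
    (hD : forall n, random_dag n (out n))
    (dS : measure_display) (S : measurableType dS) (Q : probability S R)
    (chi4 : {RV Q >-> R}) (hchi4 : has_chi4_distribution chi4) :
  let X : forall n, T n -> R := fun n => descendants n (out n) in
  let c : R := pi / (2 * Num.sqrt 2) in
  [/\ cvg_in_distribution P (fun n w => X n w / Num.sqrt n%:R)
        Q (fun w => c * chi4 w),
      forall r : R, 0 < r ->
        ('E_(P n)[fun w => ((X n w / Num.sqrt n%:R) `^ r)%R] @[n --> \oo] -->
         'E_Q[fun w => ((c * chi4 w) `^ r)%R])%E,
      forall r : R, 0 < r ->
        (fun n : nat => fine 'E_(P n)[fun w => X n w `^ r] : R^o) ~_\oo
        (fun n : nat => (pi / 2) `^ r * Gamma (r / 2 + 2) * n%:R `^ (r / 2)) &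
      (fun n : nat => fine 'E_(P n)[X n] : R^o) ~_\oo
      (fun n : nat => 3 * pi `^ (3 / 2) / 8 * Num.sqrt n%:R)].
Proof.
move=> X c.
have [L [mL hL hQ hr h1]] := chi4_mean hchi4.
have mcM : measurable_fun [set: R] (fun y : R => c * y) by exact: measurable_funM.
have c0 : 0 <= c by exact: chi_scale_ge0.
have mpow (r : R) : measurable_fun [set: R] (fun y : R => y `^ r) by exact: measurable_powR.
have normE (r y : R) : 0 <= y -> y `^ r = `|y| `^ r by move=> y0; rewrite ger0_norm.
have rootE (n : nat) (r : R) : Num.sqrt n%:R `^ r = n%:R `^ (r / 2) :> R.
  by rewrite -powR12_sqrt// -powRrM mulrC.
split.
- split.
  + by move=> n; apply: measurable_funM => //; exact: measurable_descendants.
  + by apply: measurable_funM => //; exact: measurable_funPT.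
  + move=> f cf [M hM].
    have pf : poly_growth f by apply: (poly_growth_bounded (M := M)).
    have mf : measurable_fun [set: R] f by exact: continuous_measurable_fun.
    rewrite (hQ (fun y => f (c * y)) f pf)//; last exact: measurableT_comp.
    exact: (cvg_expectation hD mL hL pf mf).
- move=> r r0; have pr := poly_growth_powR r0.
  rewrite (hQ (fun y => (c * y) `^ r) _ pr); last 2 first.
  + exact: (measurableT_comp (mpow r) mcM).
  + by move=> y y0; rewrite normE// mulr_ge0.
  exact: (cvg_expectation hD mL hL pr (mpow r) (normE r)).
- move=> r r0; rewrite -hr//.
  apply: (equiv_of_cvg (b := fun m => hist_mean m m (fun s => `|scaled_visits R m s| `^ r))).
  + exact: mean_powR_gt0.
  + by move=> n; exact: powR_ge0.
  + move=> m; rewrite (expectation_descendants (f := fun x => x `^ r) (hD m.+1))//=.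
    rewrite -hist_meanZ; apply: eq_hist_mean => s _; rewrite -normE ?scaled_visits_ge0//.
    rewrite -rootE -powRM ?sqrtr_ge0 ?scaled_visits_ge0//; congr (_ `^ _).
    by rewrite /scaled_visits mulrC divfK// gt_eqF// sqrtr_gt0.
  + exact: (cvg_visits mL hL (poly_growth_powR r0)).
- rewrite -h1; apply: (equiv_of_cvg (b := fun m => hist_mean m m (scaled_visits R m))).
  + by rewrite h1 divr_gt0// mulr_gt0// powR_gt0// pi_gt0.
  + by move=> n; exact: sqrtr_ge0.
  + move=> m; rewrite (expectation_descendants (f := fun x => x) (hD m.+1))//=.
    rewrite -hist_meanZ; apply: eq_hist_mean => s _.
    by rewrite /scaled_visits mulrC divfK// gt_eqF// sqrtr_gt0.
  + apply: (cvg_visits mL hL (f := fun x => x)).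
    by split; [move=> x; exact: cvg_id|exists 1 => //; exists 1%N => x x0; rewrite ger0_norm// mul1r; nra].
Qed.
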